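(* Let $\gamma\colon J\to\mathcal S$ be a general critical curve (of the total CR twist functional) parametrized by the natural parameter on the maximal interval $J\ni 0$ of definition of its twist $\tau$, with modulus $\mathbf c=(c_1,c_2)$ and with $\lambda_1,\lambda_2,\lambda_3$ the three distinct eigenvalues of its momentum. For $j=1,2,3$ put $$\mathbf y_j={}^t\Bigl(\tau(3-i\tau')-\lambda_j^2-3c_1,\ \ 9-\tfrac{9c_1}{\tau}-\lambda_j\tau-3i\tau',\ \ i(\tau^2-3\lambda_j)\Bigr),$$ and let $V\colon J\to\mathfrak{gl}(3,\mathbb C)$ be the matrix-valued map with columns $\mathbf y_1,\mathbf y_2,\mathbf y_3$. Then the functions $\det(V)$ and $\tau^2-3\lambda_j$, $j=1,2,3$, are nowhere zero on $J$. Let $r_j$ be continuous determinations of $\sqrt{\tau^2-3\lambda_j}$ on $J$ and let $$\phi_j(s)=\int_0^s\frac{3c_1\lambda_j-(4c_1+\lambda_j^2)\tau^2(u)+3\tau^3(u)}{\tau^2(u)\bigl(3\lambda_j-\tau^2(u)\bigr)}\,du .$$ Then $\gamma$ is congruent to the curve $$J\ni s\longmapsto\bigl[M\,D\bigl(r_1e^{i\phi_1},r_2e^{i\phi_2},r_3e^{i\phi_3}\bigr)V^{-1}\mathbf e_1\bigr]\in\mathcal S,$$ where $M=V(0)\,D(r_1(0),r_2(0),r_3(0))^{-1}$.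
   Context: $\mathbb C^{2,1}$ denotes $\mathbb C^3$ with the Hermitian form $\langle \mathbf z,\mathbf w\rangle={}^t\overline{\mathbf z}\,\mathbf h\,\mathbf w$, $\mathbf h=\begin{pmatrix}0&0&i\\0&1&0\\-i&0&0\end{pmatrix}$ (signature $(2,1)$). $\mathcal S\subset\mathbb{CP}^2$ is the set of null lines, $\mathcal S=\{[\mathbf z]: \langle\mathbf z,\mathbf z\rangle=0\}\cong S^3$. $G=\{A\in SL(3,\mathbb C): {}^t\bar A\mathbf hA=\mathbf h\}$ acts on $\mathcal S$ by $A[\mathbf z]=[A\mathbf z]$. The contact distribution $\mathcal D$ of $\mathcal S$ is the kernel of the real 1-form $\zeta$ obtained by restricting $-i\langle\mathbf z,d\mathbf z\rangle/(\overline{\mathbf z}\cdot\mathbf z)$ to $T\mathcal S$. A smooth immersed curve $\gamma\colon J\to\mathcal S$ is transversal if $\gamma'(t)\notin\mathcal D_{\gamma(t)}$ for all $t$; it is always assumed positively parametrized, i.e. $\zeta(\gamma')>0$. A lift of $\gamma$ is a smooth map $\Gamma$ into the nonzero null vectors with $\gamma=[\Gamma]$. A transversal curve is generic if $\det(\Gamma,\Gamma',\Gamma'')\neq0$ everywhere for one (hence any) lift. A Wilczynski lift is a lift with $\det(\Gamma,\Gamma',\Gamma'')=-1$. The infinitesimal strain is $ds=a_\gamma\,dt$, where $a_\gamma=i\langle\Gamma,\Gamma'\rangle^{-1}>0$ for a Wilczynski lift $\Gamma$; the curve is parametrized by the natural parameter if $a_\gamma=1$. For such a generic transversal curve there is a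 smooth map $\mathcal F=(F_1,F_2,F_3)\colon J\to G$ (a Wilczynski frame, unique up to a constant cube root of unity), with $F_1$ a Wilczynski lift, such that $$\mathcal F^{-1}\mathcal F'=\begin{pmatrix} i\kappa & -i & \tau\\ 0 & -2i\kappa & 1\\ 1 & 0 & i\kappa\end{pmatrix}$$ for smooth real functions $\kappa$ (bending) and $\tau$ (twist). The total CR twist functional is $\mathcal W[\gamma]=\int\tau\,ds$; critical curves are its critical points with respect to compactly supported variations through generic transversal curves. Equivalently, $2\kappa\tau'+\tau\kappa'=0$ and $\tau''+9\kappa(1-\tau\kappa)-\tau^2=0$. Along a critical curve the matrix $\mathfrak M=\mathcal F L\mathcal F^{-1}$, with $L=\begin{pmatrix}0 & i\tau'+3(1-\tau\kappa) & 2i\tau\\ \tau & 0 & \tau'+3i(1-\tau\kappa)\\ 3i & -i\tau & 0\end{pmatrix}$, is constant; it is the momentum of $\gamma$. The quantities $c_1=\kappa\tau^2$ and $c_2=-18\kappa\tau+9\kappa^2\tau^2-\tfrac23\tau^3+\tau'^2$ are constant, and $\mathbf c=(c_1,c_2)$ is the modulus of $\gamma$. The eigenvalues of $\mathfrak M$ are the roots of $Q_{\mathbf c}(x)=x^3+6c_1x+(27+3c_2)$. If $c_1\ne0$, then $\tau$ is nowhere zero and $\kappa=c_1\tau^{-2}$; if $c_1=0$, then $\kappa=0$. Put $\Delta_1(\mathbf c)=-27\bigl(32c_1^3+9(9+c_2)^2\bigr)$ (discriminant of $Q_{\mathbf c}$) and $\Delta_2(\mathbf c)=9c_1^3(c_1^3+216)+6c_1^3c_2(c_2+36)+(c_2+9)(c_2+18)^3$.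 A critical curve with modulus $\mathbf c$ is general if $\Delta_1(\mathbf c)\Delta_2(\mathbf c)\ne0$. $D(z_1,z_2,z_3)$ is the diagonal matrix with entries $z_1,z_2,z_3$; $\mathbf e_1={}^t(1,0,0)$. Two curves are congruent if one is the image of the other under an element of $G$. When $c_1=0$, the term $9c_1/\tau$ is read as $0$ and the integrand of $\phi_j$ as $(3\tau-\lambda_j^2)(3\lambda_j-\tau^2)^{-1}$. *)

(* Defs.v *)
(* A point of the complex projective plane is represented by the corresponding
   line of ['cV[R[i]]_3], where [R : realType]. *)
From HB Require Import structures.
From mathcomp Require Import all_boot all_order all_algebra.
From mathcomp Require Import all_classical all_reals all_analysis.
From mathcomp Require Import complex.
Set Implicit Arguments.
Unset Strict Implicit.
Unset Printing Implicit Defensive.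
Import Order.TTheory GRing.Theory Num.Theory numFieldNormedType.Exports.
Local Open Scope classical_set_scope.
Local Open Scope ring_scope.
Local Open Scope complex_scope.

(* Class C^k on an open set [U] of a finite-dimensional space: all iterated
   directional derivatives up to order [k] exist and are continuous. *)
Fixpoint Ck (R : realType) (V : normedModType R) (k : nat) (U : set V)
    (f : V -> R) : Prop :=
  (forall x, U x -> {for x, continuous f}) /\
  match k with
  | 0%N => True
  | k'.+1 => forall v : V,
      (forall x, U x -> derivable f x v) /\ Ck k' U ('D_v f)
  end.

Definition smooth (R : realType) (V : normedModType R) (U : set V)
  (f : V -> R) : Prop := forall k, Ck k U f.

Definition smooth_mx (R : realType) (V : normedModType R) (m n : nat)
    (U : set V) (A : V -> 'M[R[i]]_(m, n)) : Prop :=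
  forall i j, smooth U (fun x => complex.Re (A x i j)) /\
              smooth U (fun x => complex.Im (A x i j)).

Definition continuousC (R : realType) (J : set R) (f : R -> R[i]) : Prop :=
  forall s, J s -> {for s, continuous (fun t => complex.Re (f t))} /\
                   {for s, continuous (fun t => complex.Im (f t))}.

Definition entrywise_deriv (R : realType) (m n : nat) (A : R -> 'M[R[i]]_(m, n))
    (t : R) : 'M[R[i]]_(m, n) :=
  \matrix_(i, j) (derive1 (fun u => complex.Re (A u i j)) t
               +i* derive1 (fun u => complex.Im (A u i j)) t).

Definition oint (R : realType) (f : R -> R) (a b : R) : R :=
  if a <= b then \int[lebesgue_measure]_(u in `[a, b]) f u
  else - \int[lebesgue_measure]_(u in `[b, a]) f u.

Definition ointC (R : realType) (f : R -> R[i]) (a b : R) : R[i] :=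
  oint (fun u => complex.Re (f u)) a b +i* oint (fun u => complex.Im (f u)) a b.

Definition expC (R : realType) (z : R[i]) : R[i] :=
  (expR (complex.Re z))%:C * (cos (complex.Im z) +i* sin (complex.Im z)).

Definition mx3 (R : realType) (s : seq (seq R[i])) : 'M[R[i]]_3 :=
  \matrix_(i, j) nth 0 (nth [::] s i) j.

Definition col3 (R : realType) (x y z : R[i]) : 'cV[R[i]]_3 :=
  \col_i nth 0 [:: x; y; z] i.

Definition columns3 (R : realType) (u v w : 'cV[R[i]]_3) : 'M[R[i]]_3 :=
  \matrix_(i, j) nth 0 [:: u i 0; v i 0; w i 0] j.

Definition diag3 (R : realType) (z : 'I_3 -> R[i]) : 'M[R[i]]_3 :=
  diag_mx (\row_j z j).

Definition hform (R : realType) : 'M[R[i]]_3 :=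
  mx3 [:: [:: 0; 0; 'i]; [:: 0; 1; 0]; [:: - 'i; 0; 0]].

Definition adjoint (R : realType) (m n : nat) (A : 'M[R[i]]_(m, n)) :
  'M[R[i]]_(n, m) := (map_mx (@conjc R) A)^T.

Definition herm (R : realType) (z w : 'cV[R[i]]_3) : R[i] :=
  (adjoint z *m hform R *m w) 0 0.

Definition sphereS (R : realType) : set {vspace 'cV[R[i]]_3} :=
  [set l | exists z, [/\ z != 0, herm z z = 0 & l = <[z]>%VS]].

Definition groupG (R : realType) : set 'M[R[i]]_3 :=
  [set A | \det A = 1 /\ adjoint A *m hform R *m A = hform R].

Definition act (R : realType) (A : 'M[R[i]]_3) (l : {vspace 'cV[R[i]]_3}) :
  {vspace 'cV[R[i]]_3} := (linfun (fun z : 'cV[R[i]]_3 => A *m z) @: l)%VS.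

Definition congruent (R : realType) (J : set R)
    (gamma eta : R -> {vspace 'cV[R[i]]_3}) : Prop :=
  exists2 A, groupG A & forall s, J s -> gamma s = act A (eta s).

Definition is_lift (R : realType) (J : set R)
    (gamma : R -> {vspace 'cV[R[i]]_3}) (Gam : R -> 'cV[R[i]]_3) : Prop :=
  smooth_mx J Gam /\
  forall t, J t ->
    [/\ Gam t != 0, herm (Gam t) (Gam t) = 0 & gamma t = <[Gam t]>%VS].

(* The value of the contact form on the velocity of a curve with lift [z] and
   derivative of the lift [w]; it does not depend on the lift. *)
Definition zeta (R : realType) (z w : 'cV[R[i]]_3) : R[i] :=
  - 'i * herm z w / (adjoint z *m z) 0 0.

Definition det_jet (R : realType) (Gam : R -> 'cV[R[i]]_3) (t : R) : R[i] :=
  \det (columns3 (Gam t) (entrywise_deriv Gam t)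
                 (entrywise_deriv (entrywise_deriv Gam) t)).

(* Smoothness of a curve of lines on an interval is the existence of a smooth
   lift, and positivity of [zeta] (for the order of [R[i]]: real and positive)
   makes the curve an immersion. *)
Definition generic_transversal (R : realType) (J : set R)
    (gamma : R -> {vspace 'cV[R[i]]_3}) : Prop :=
  exists Gam, [/\ is_lift J gamma Gam,
    forall t, J t -> 0 < zeta (Gam t) (entrywise_deriv Gam t) &
    forall t, J t -> det_jet Gam t != 0].

Definition wilczynski_lift (R : realType) (J : set R)
    (gamma : R -> {vspace 'cV[R[i]]_3}) (Gam : R -> 'cV[R[i]]_3) : Prop :=
  is_lift J gamma Gam /\ forall t, J t -> det_jet Gam t = -1.

Definition wilczynski_mx (R : realType) (k t : R) : 'M[R[i]]_3 :=
  mx3 [:: [:: 'i * k%:C; - 'i; t%:C];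
          [:: 0; - (2 * 'i * k%:C); 1];
          [:: 1; 0; 'i * k%:C]].

(* [F] is a Wilczynski frame along [gamma], with strain [a], bending [kappa] and
   twist [tau], for an arbitrary parameter [t].  Passing from [t] to the natural
   parameter [s], where [ds = a dt], multiplies Wilczynski lifts by [a]; hence
   the first column of [F] is [a] times a Wilczynski lift with respect to [t],
   and the structure equation reads [F^-1 dF = wilczynski_mx kappa tau ds].
   The parameter is natural when [a] is the constant 1. *)
Definition wilczynski_frame (R : realType) (J : set R)
    (gamma : R -> {vspace 'cV[R[i]]_3}) (a kappa tau : R -> R)
    (F : R -> 'M[R[i]]_3) : Prop :=
  let Gam t : 'cV[R[i]]_3 := ((a t)^-1)%:C *: col 0 (F t) in
  [/\ [/\ smooth J a, smooth J kappa, smooth J tau & smooth_mx J F],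
      wilczynski_lift J gamma Gam,
      forall t, J t -> 0 < a t /\
        (a t)%:C = 'i * (herm (Gam t) (entrywise_deriv Gam t))^-1,
      forall t, J t -> groupG (F t) &
      forall t, J t -> invmx (F t) *m entrywise_deriv F t =
        (a t)%:C *: wilczynski_mx (kappa t) (tau t)].

Definition total_twist (R : realType) (a tau : R -> R) (x y : R) : R :=
  \int[lebesgue_measure]_(t in `[x, y]) (tau t * a t).

(* [g e] is the curve with variation parameter [e] in [(-d, d)]; all these
   curves agree with [gamma] off the compact interval [[x, y]] of [J]. *)
Definition compact_variation (R : realType) (J : set R)
    (gamma : R -> {vspace 'cV[R[i]]_3}) (x y d : R)
    (g : R -> R -> {vspace 'cV[R[i]]_3}) : Prop :=
  [/\ forall t, x <= t <= y -> J t,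
      exists2 H : R * R -> 'cV[R[i]]_3,
        smooth_mx [set p : R * R | - d < p.1 < d /\ J p.2] H &
        forall e t, - d < e < d -> J t ->
          [/\ H (e, t) != 0, herm (H (e, t)) (H (e, t)) = 0 &
              g e t = <[H (e, t)]>%VS],
      forall t, J t -> g 0 t = gamma t,
      forall e t, - d < e < d -> J t -> ~~ (x <= t <= y) -> g e t = gamma t &
      forall e, - d < e < d -> generic_transversal J (g e)].

Definition critical (R : realType) (J : set R)
    (gamma : R -> {vspace 'cV[R[i]]_3}) : Prop :=
  generic_transversal J gamma /\
  forall (x y d : R) (g : R -> R -> {vspace 'cV[R[i]]_3})
      (a kappa tau : R -> R -> R) (F : R -> R -> 'M[R[i]]_3),
    0 < d -> compact_variation J gamma x y d g ->
    (forall e, - d < e < d ->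
       wilczynski_frame J (g e) (a e) (kappa e) (tau e) (F e)) ->
    is_derive (0 : R) (1 : R) (fun e => total_twist (a e) (tau e) x y) 0.

(* The Euler-Lagrange equations of the functional, in the natural parameter.
   They only serve to say that [J] is the maximal interval of definition of the
   twist: the solution does not extend to a larger open interval. *)
Definition euler_lagrange (R : realType) (J : set R) (kappa tau : R -> R) :
    Prop :=
  [/\ smooth J kappa, smooth J tau &
      forall s, J s ->
        2 * kappa s * derive1 tau s + tau s * derive1 kappa s = 0 /\
        derive1 (derive1 tau) s + 9 * kappa s * (1 - tau s * kappa s)
          - tau s ^+ 2 = 0].

Definition maximal_twist (R : realType) (J : set R) (kappa tau : R -> R) :
    Prop :=
  forall (J' : set R) (kappa' tau' : R -> R),
    open J' -> is_interval J' -> J `<=` J' -> euler_lagrange J' kappa' tau' ->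
    (forall s, J s -> kappa' s = kappa s /\ tau' s = tau s) ->
    J' `<=` J.

Definition momentum_mx (R : realType) (k t t' : R) : 'M[R[i]]_3 :=
  let u := 3 * (1 - t * k) in
  mx3 [:: [:: 0; u +i* t'; 2 * 'i * t%:C];
          [:: t%:C; 0; t' +i* u];
          [:: 3 * 'i; - 'i * t%:C; 0]].

(* Along a critical curve the momentum and the modulus are constant; they are
   evaluated at the parameter 0. *)
Definition momentum (R : realType) (kappa tau : R -> R)
    (F : R -> 'M[R[i]]_3) : 'M[R[i]]_3 :=
  F 0 *m momentum_mx (kappa 0) (tau 0) (derive1 tau 0) *m invmx (F 0).

Definition is_modulus (R : realType) (kappa tau : R -> R) (c1 c2 : R) : Prop :=
  c1 = kappa 0 * tau 0 ^+ 2 /\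
  c2 = - (18 * kappa 0 * tau 0) + 9 * kappa 0 ^+ 2 * tau 0 ^+ 2
       - 2 / 3 * tau 0 ^+ 3 + derive1 tau 0 ^+ 2.

Definition Delta1 (R : realType) (c1 c2 : R) : R :=
  - 27 * (32 * c1 ^+ 3 + 9 * (9 + c2) ^+ 2).

Definition Delta2 (R : realType) (c1 c2 : R) : R :=
  9 * c1 ^+ 3 * (c1 ^+ 3 + 216) + 6 * c1 ^+ 3 * c2 * (c2 + 36)
  + (c2 + 9) * (c2 + 18) ^+ 3.

Definition general_modulus (R : realType) (c1 c2 : R) : Prop :=
  Delta1 c1 c2 * Delta2 c1 c2 != 0.

(* For [c1 = 0] the quotient [9 * c1 / t] is 0 even where [t = 0]. *)
Definition yvec (R : realType) (c1 t t' : R) (l : R[i]) : 'cV[R[i]]_3 :=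
  col3 (t%:C * (3 - 'i * t'%:C) - l ^+ 2 - 3 * c1%:C)
       (9 - (9 * c1 / t)%:C - l * t%:C - 3 * 'i * t'%:C)
       ('i * (t%:C ^+ 2 - 3 * l)).

Definition Vmx (R : realType) (c1 : R) (tau : R -> R) (lambda : 'I_3 -> R[i])
    (s : R) : 'M[R[i]]_3 :=
  \matrix_(i, j) yvec c1 (tau s) (derive1 tau s) (lambda j) i 0.

(* For [c1 = 0] the common factor [t ^+ 2] is cancelled. *)
Definition phi_integrand (R : realType) (c1 t : R) (l : R[i]) : R[i] :=
  if c1 == 0 then (3 * t%:C - l ^+ 2) / (3 * l - t%:C ^+ 2)
  else (3 * c1%:C * l - (4 * c1%:C + l ^+ 2) * t%:C ^+ 2 + 3 * t%:C ^+ 3)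
       / (t%:C ^+ 2 * (3 * l - t%:C ^+ 2)).

Definition phi (R : realType) (c1 : R) (tau : R -> R) (l : R[i]) (s : R) :
  R[i] := ointC (fun u => phi_integrand c1 (tau u) l) 0 s.

Definition explicit_curve (R : realType) (c1 : R) (tau : R -> R)
    (lambda : 'I_3 -> R[i]) (r : 'I_3 -> R -> R[i]) (s : R) :
    {vspace 'cV[R[i]]_3} :=
  let V := Vmx c1 tau lambda in
  let M := V 0 *m invmx (diag3 (fun j => r j 0)) in
  let D := diag3 (fun j => r j s * expC ('i * phi c1 tau (lambda j) s)) in
  let z := M *m D *m invmx (V s) *m col3 1 0 0 in
  <[z]>%VS.

(* Main.v *)
(* Write F for the Wilczynski frame, K = F^-1 F' and L for the matrix of the
   momentum in the frame.

   Criticality gives the Euler-Lagrange equations.  L' + [K, L] has only two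
   nonzero entries, EL and i * conj EL, where EL = 0 is the Euler-Lagrange system.
   For a function w with compact support, multiply F(t) by the lower unitriangular
   element of G with parameter e * w(t) and correct the result on the right by upper
   triangular elements of G, which do not move the curve, until it is a Wilczynski
   frame A(e, t), with structure matrix N = A^-1 dA/dt and twist density T.  With
   B = F^-1 A one has d/dt tr(L B) = tr((L' + [K, L]) B) + tr(L B N) - tr(L B K)
   and tr(L N) = 3 i T.  Integrating the imaginary part in t and differentiating
   at e = 0 shows that the integral of 2 Im(EL * w) + 3 dT/de vanishes; choosing
   w = i * bump * conj EL forces EL = 0.

   Then y_j is an eigenvector of L with eigenvalue lambda_j, and
   (F y_j)' = rho_j F y_j with rho_j = r_j' / r_j + i phi_j'.  Hence
   F V D^-1 is constant, where D = diag(r_j e^(i phi_j)), and the first column of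
   F = F(0) M D V^-1 is a lift of gamma.  If tau^2 = 3 lambda_j at some point, then
   Q_c(lambda_j) = 0 is the vanishing of the sum of squares
   27 (1 - kappa tau - tau^3/27)^2 + 3 tau'^2, which implies Delta2 = 0. *)
Require Import Defs.
From HB Require Import structures.
From mathcomp Require Import all_boot all_order all_algebra.
From mathcomp Require Import all_classical all_reals all_analysis.
From mathcomp Require Import complex.
From mathcomp Require Import ring lra.
Set Implicit Arguments.
Unset Strict Implicit.
Unset Printing Implicit Defensive.
Import Order.TTheory GRing.Theory Num.Theory numFieldNormedType.Exports.
Local Open Scope classical_set_scope.
Local Open Scope ring_scope.
Local Open Scope complex_scope.

(** * Smooth functions of real and complex values *)

Section SmoothCalculus.
Context {R : realType} {V : normedModType R}.
Implicit Types (U : set V) (f g : V -> R) (k : nat) (v x : V).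

(** Criticality is tested only against families that carry a Wilczynski frame on all of J for every
    e in one interval (-d, d). Such frames must therefore be constructed, jointly smooth in (e, t)
    and with a uniform d. This is why the reduction consists of explicit gauge factors, algebraic in
    the structure matrix with a single cube root. The principal branch suffices: where the variation
    is trivial the radicand is 1, and the remaining t fill a compact interval, on which its real
    part stays positive for small e. The matrix L acts as a Lagrange multiplier: paired with any
    structure matrix in Wilczynski form it sees the twist density alone, so the variations of strain
    and bending never have to be computed. Since L has trace 0 and B is the identity outside the
    support of w, integration leaves no boundary term. The set where the variation is trivial
    contains the axis e = 0 and need not be a neighbourhood of its points. Statements there rest on
    directional derivatives, which depend only on values along a line. *)

Lemma open_near_eq (T : Type) U (f g : V -> T) x : open U ->
  (forall y, U y -> f y = g y) -> U x -> \near x, f x = g x.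
Proof.
move=> oU fg Ux; apply: filterS (open_nbhs_nbhs (conj oU Ux)).
by move=> y /= /fg.
Qed.

Lemma Ck_continuous k U f x : Ck k U f -> U x -> {for x, continuous f}.
Proof. by case: k => [|k] [cf _] /cf. Qed.

Lemma CkS_derivable k U f v x : Ck k.+1 U f -> U x -> derivable f x v.
Proof. by move=> [_ /(_ v)[df _]] /df. Qed.

Lemma CkS_derive k U f v : Ck k.+1 U f -> Ck k U ('D_v f).
Proof. by move=> [_ /(_ v)[]]. Qed.

Lemma CkW k U f : Ck k.+1 U f -> Ck k U f.
Proof.
elim: k f => [|k IH] f [cf df]; split=> // v; split; first by case: (df v).
by apply: IH; case: (df v).
Qed.

Lemma eq_Ck k U f g : open U -> (forall x, U x -> f x = g x) ->
  Ck k U f -> Ck k U g.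
Proof.
move=> oU; elim: k f g => [|k IH] f g fg [cf df]; split=> //.
- move=> x Ux; rewrite /prop_for /continuous_at -(fg x Ux).
  apply: cvg_trans (cf x Ux); apply: near_eq_cvg.
  by apply: (open_near_eq oU _ Ux) => y /fg.
- move=> x Ux; rewrite /prop_for /continuous_at -(fg x Ux).
  apply: cvg_trans (cf x Ux); apply: near_eq_cvg.
  by apply: (open_near_eq oU _ Ux) => y /fg.
move=> v; have [dfv ckf] := df v; split.
  move=> x Ux; apply: near_eq_derivable (dfv x Ux); exact: (open_near_eq oU fg Ux).
apply: IH ckf => x Ux; apply: near_eq_derive; exact: (open_near_eq oU fg Ux).
Qed.

Lemma Ck_subset k U U' f : U' `<=` U -> Ck k U f -> Ck k U' f.
Proof.
move=> sU; elim: k f => [|k IH] f [cf df]; split => //.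
- by move=> x /sU /cf.
- by move=> x /sU /cf.
move=> v; have [dfv ckf] := df v; split; last exact: IH.
by move=> x /sU /dfv.
Qed.

Lemma Ck_cst k U (a : R) : Ck k U (fun=> a).
Proof.
elim: k a => [|k IH] a; split=> //; try by move=> x _; exact: cst_continuous.
move=> v; split; first by move=> x _; exact: derivable_cst.
rewrite (_ : 'D_v _ = fun=> 0) //; apply/funext => x; exact: derive_cst.
Qed.

Lemma CkD k U f g : open U -> Ck k U f -> Ck k U g ->
  Ck k U (fun x => f x + g x).
Proof.
move=> oU; elim: k f g => [|k IH] f g [cf df] [cg dg]; split=> //.
- by move=> x Ux; apply: cvgD; [exact: cf|exact: cg].
- by move=> x Ux; apply: cvgD; [exact: cf|exact: cg].
move=> v; have [dfv ckf] := df v; have [dgv ckg] := dg v; split.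
  by move=> x Ux; apply: derivableD; [exact: dfv|exact: dgv].
apply: (eq_Ck (f:='D_v f \+ 'D_v g) oU _ (IH _ _ ckf ckg)) => x Ux.
by rewrite (deriveD (dfv x Ux) (dgv x Ux)).
Qed.

Lemma CkM k U f g : open U -> Ck k U f -> Ck k U g ->
  Ck k U (fun x => f x * g x).
Proof.
move=> oU; elim: k f g => [|k IH] f g fk gk; split=> //.
- move=> x Ux; apply: cvgM; [exact: (Ck_continuous fk Ux)|exact: (Ck_continuous gk Ux)].
- move=> x Ux; apply: cvgM; [exact: (Ck_continuous fk Ux)|exact: (Ck_continuous gk Ux)].
move=> v; split.
  by move=> x Ux; apply: derivableM; [exact: (CkS_derivable fk Ux)|exact: (CkS_derivable gk Ux)].
apply: (eq_Ck (f:=fun x => f x * 'D_v g x + g x * 'D_v f x)) => //.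
  by move=> x Ux; rewrite (deriveM (CkS_derivable (v:=v) fk Ux) (CkS_derivable (v:=v) gk Ux)).
by apply: CkD => //; apply: IH => //; by [exact: CkW | exact: CkS_derive].
Qed.

(** A directional derivative is an ordinary derivative along a line, so one-variable rules such as
    the chain rule apply on any normed space. *)
Lemma is_derive_dir f v x (df : R) :
  is_derive x v f df <-> is_derive (0 : R) (1 : R) (fun s => f (s *: v + x)) df.
Proof.
have E : (fun h : R => h^-1 *: (((fun s => f (s *: v + x)) \o shift 0) (h *: 1)
    - f (0 *: v + x))) = (fun h => h^-1 *: ((f \o shift x) (h *: v) - f x)).
  by apply/funext => h /=; rewrite addr0 scale0r add0r [h *: 1]mulr1.
by split=> -[d e]; split; rewrite /derivable /derive ?E // in d e *;
  move: d e; rewrite E.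
Qed.

Lemma is_derive_chain (h : R -> R) f v x (dh df : R) :
  is_derive (f x) (1 : R) h dh -> is_derive x v f df ->
  is_derive x v (fun y => h (f y)) (dh * df).
Proof.
move=> hh /is_derive_dir hf; apply/is_derive_dir.
apply: (@is_derive1_comp _ h (fun s => f (s *: v + x))) => //.
by rewrite scale0r add0r.
Qed.

End SmoothCalculus.

Section Composition.
Context {R : realType}.

Lemma Ck_comp (V : normedModType R) k (U : set V) (W : set R) (h : R -> R)
    (f : V -> R) : open U -> (forall x, U x -> W (f x)) ->
  Ck k W h -> Ck k U f -> Ck k U (fun x => h (f x)).
Proof.
move=> oU fW; elim: k h f fW => [|k IH] h f fW hk fk; split=> //.
- move=> x Ux; apply: (@continuous_comp _ _ _ f h); first exact: (Ck_continuous fk Ux).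
  by apply: (Ck_continuous hk); exact: fW.
- move=> x Ux; apply: (@continuous_comp _ _ _ f h); first exact: (Ck_continuous fk Ux).
  by apply: (Ck_continuous hk); exact: fW.
have H v x : U x -> is_derive x v (fun y => h (f y)) ('D_1 h (f x) * 'D_v f x).
  move=> Ux; apply: is_derive_chain; apply: derivableP.
    by apply: (CkS_derivable hk); exact: fW.
  exact: (CkS_derivable fk Ux).
move=> v; split; first by move=> x Ux; case: (H v x Ux).
apply: (eq_Ck (f:=fun x => 'D_1 h (f x) * 'D_v f x)) => //.
  by move=> x Ux; case: (H v x Ux) => _ ->.
apply: CkM => //; last exact: CkS_derive.
by apply: (IH ('D_1 h) f fW); [exact: CkS_derive|exact: CkW].
Qed.

(** [Ck] asks for derivatives in every direction; on the real line the direction only rescales the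
    derivative, so one explicit formula drives the inductions on [k] for the elementary
    functions. *)
Lemma CkS_real k (W : set R) (h h' : R -> R) : open W ->
  (forall x, W x -> is_derive x (1 : R) h (h' x)) -> Ck k W h' ->
  Ck k.+1 W h.
Proof.
move=> oW hh' h'k.
have H v x : W x -> is_derive x v h (h' x * v).
  move=> Wx; apply/is_derive_dir.
  have -> : (fun s : R => h (s *: v + x)) = h \o (fun s => s *: v + x) by [].
  apply: is_derive1_comp; first by rewrite scale0r add0r; exact: hh'.
  apply: is_derive_eq.
  by rewrite scaler0 add0r addr0 [_ *: _]mulr1.
split.
  move=> x Wx; apply/differentiable_continuous/derivable1_diffP.
  by case: (hh' x Wx).
move=> v; split; first by move=> x Wx; case: (H v x Wx).
apply: (eq_Ck (f:=fun x => h' x * v)) => //.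
  by move=> x Wx; case: (H v x Wx) => _ ->.
by apply: CkM => //; exact: Ck_cst.
Qed.

(** The difference quotients of the composite along [v] are literally those of [f] along [A0 v],
    with [A0] the linear part of [A]. No chain rule in several variables is involved, and
    projections, slices, translations and reflections are all covered. *)
Lemma Ck_affine (V V' : normedModType R) k (U : set V') (A A0 : V -> V')
    (f : V' -> R) : continuous A ->
  (forall p v (h : R), A (h *: v + p) = h *: A0 v + A p) ->
  Ck k U f -> Ck k (A @^-1` U) (fun p => f (A p)).
Proof.
move=> cA HA; elim: k f => [|k IH] f fk; split=> //.
- move=> p Up; apply: (@continuous_comp _ _ _ A f); first exact: cA.
  exact: (Ck_continuous fk Up).
- move=> p Up; apply: (@continuous_comp _ _ _ A f); first exact: cA.
  exact: (Ck_continuous fk Up).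
have E v p : (fun h : R => h^-1 *: (((fun p => f (A p)) \o shift p) (h *: v)
    - f (A p))) = (fun h => h^-1 *: ((f \o shift (A p)) (h *: A0 v) - f (A p))).
  by apply/funext => h /=; rewrite HA.
move=> v; split.
  move=> p Up; rewrite /derivable E; exact: (CkS_derivable fk Up).
have -> : 'D_v (fun p => f (A p)) = (fun p => 'D_(A0 v) f (A p)).
  by apply/funext => p; rewrite /derive E.
by apply: (IH ('D_(A0 v) f)); exact: CkS_derive.
Qed.

Lemma derive_affine (V V' : normedModType R) (A A0 : V -> V')
    (f : V' -> R) v p :
  (forall p v (h : R), A (h *: v + p) = h *: A0 v + A p) ->
  'D_v (fun p => f (A p)) p = 'D_(A0 v) f (A p).
Proof.
move=> HA; rewrite /derive; under eq_fun do rewrite /= HA.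
by [].
Qed.

End Composition.

Section Smooth.
Context {R : realType} {V : normedModType R}.
Implicit Types (U : set V) (f g : V -> R) (v x : V).

Lemma smooth_continuous U f x : smooth U f -> U x -> {for x, continuous f}.
Proof. by move=> /(_ 0%N); exact: Ck_continuous. Qed.

Lemma smooth_derivable U f v x : smooth U f -> U x -> derivable f x v.
Proof. by move=> /(_ 1%N); exact: CkS_derivable. Qed.

Lemma smooth_derive U f v : smooth U f -> smooth U ('D_v f).
Proof. by move=> sf k; apply: CkS_derive (sf k.+1). Qed.

Lemma eq_smooth U f g : open U -> (forall x, U x -> f x = g x) ->
  smooth U f -> smooth U g.
Proof. by move=> oU fg sf k; apply: (eq_Ck oU fg); exact: sf. Qed.

Lemma smooth_subset U U' f : U' `<=` U -> smooth U f -> smooth U' f.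
Proof. by move=> sU sf k; apply: Ck_subset (sf k). Qed.

Lemma smooth_cst U (a : R) : smooth U (fun=> a).
Proof. by move=> k; exact: Ck_cst. Qed.

Lemma smoothD U f g : open U -> smooth U f -> smooth U g ->
  smooth U (fun x => f x + g x).
Proof. by move=> oU sf sg k; exact: CkD. Qed.

Lemma smoothM U f g : open U -> smooth U f -> smooth U g ->
  smooth U (fun x => f x * g x).
Proof. by move=> oU sf sg k; exact: CkM. Qed.

Lemma smoothN U f : open U -> smooth U f -> smooth U (fun x => - f x).
Proof.
move=> oU sf; apply: (eq_smooth (f:=fun x => -1 * f x)) => //.
  by move=> x _; rewrite mulN1r.
by apply: smoothM => //; exact: smooth_cst.
Qed.

Lemma smoothB U f g : open U -> smooth U f -> smooth U g ->
  smooth U (fun x => f x - g x).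
Proof. by move=> oU sf sg; apply: smoothD => //; exact: smoothN. Qed.

Lemma smooth_comp U (W : set R) (h : R -> R) f : open U ->
  (forall x, U x -> W (f x)) -> smooth W h -> smooth U f ->
  smooth U (fun x => h (f x)).
Proof. by move=> oU fW sh sf k; apply: Ck_comp (sh k) (sf k). Qed.

End Smooth.

Section SmoothReal.
Context {R : realType}.

Lemma smooth_id : smooth setT (id : R -> R).
Proof.
case=> [|k]; first by split=> // x _; exact: cvg_id.
apply: (@CkS_real _ k setT id (fun=> 1)); last exact: Ck_cst.
  exact: openT.
Qed.

Lemma open_neq0 : open [set x : R | x != 0].
Proof.
rewrite (_ : [set _ | _] = ~` [set 0]); first exact/closed_openC/closed_eq.
by apply/seteqP; split => x /= /eqP.
Qed.

Lemma smooth_inv : smooth [set x : R | x != 0] GRing.inv.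
Proof.
elim=> [|k IH].
  by split=> // x /= x0; exact: inv_continuous.
apply: (@CkS_real _ k _ _ (fun x => - 1 * (x^-1 * x^-1))).
- exact: open_neq0.
- move=> x /= x0; apply: is_derive_eq; first exact: (is_deriveV (f:=id)).
  by rewrite [_ *: _]mulr1 mulN1r expr2 invfM.
by have o := open_neq0; apply: CkM => //; [exact: Ck_cst|exact: CkM].
Qed.

Lemma smooth_expR : smooth setT (@expR R).
Proof.
elim=> [|k IH]; first by split=> // x _; exact: continuous_expR.
by apply: CkS_real IH; exact: openT.
Qed.

Lemma smooth_ln : smooth [set x : R | 0 < x] (@ln R).
Proof.
case=> [|k]; first by split=> // x x0; exact: continuous_ln.
apply: (@CkS_real _ k _ _ GRing.inv); first exact: open_gt.
by apply: Ck_subset (smooth_inv k) => x /= x0; rewrite gt_eqF.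
Qed.

Lemma smooth_sincos : smooth setT (@sin R) /\ smooth setT (@cos R).
Proof.
suff H k : Ck k setT (@sin R) /\ Ck k setT (@cos R) by split=> k; case: (H k).
elim: k => [|k [IHs IHc]].
  by split; split=> // x _; [exact: continuous_sin|exact: continuous_cos].
split.
  apply: (@CkS_real _ k _ _ (@cos R)) => //; exact: openT.
apply: (@CkS_real _ k _ _ (fun x => -1 * sin x)); first exact: openT.
  by move=> x _; rewrite mulN1r; exact: is_derive_cos.
by apply: CkM => //; [exact: openT|exact: Ck_cst].
Qed.

Lemma smooth_atan : smooth setT (@atan R).
Proof.
case=> [|k]; first by split=> // x _; exact: continuous_atan.
apply: (@CkS_real _ k _ _ (fun x => (1 + x * x)^-1)); first exact: openT.
apply: (@smooth_comp _ _ _ [set x | x != 0] GRing.inv).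
- exact: openT.
- by move=> x _ /=; rewrite gt_eqF// ltr_pwDl// -expr2 sqr_ge0.
- exact: smooth_inv.
have o : open [set: R] by exact: openT.
apply: smoothD => //; first exact: smooth_cst.
by apply: smoothM => //; exact: smooth_id.
Qed.

End SmoothReal.

(** * Calculus of complex-valued functions, through real and imaginary parts *)

Section ComplexCalculus.
Context {R : realType} {V : normedModType R}.
Implicit Types (U : set V) (f g : V -> R[i]) (v x : V).

Definition smoothC U f :=
  smooth U (fun x => complex.Re (f x)) /\ smooth U (fun x => complex.Im (f x)).

Definition is_derC x v f (df : R[i]) :=
  is_derive x v (fun y => complex.Re (f y)) (complex.Re df) /\
  is_derive x v (fun y => complex.Im (f y)) (complex.Im df).

Definition DC v f x : R[i] :=
  'D_v (fun y => complex.Re (f y)) x +i* 'D_v (fun y => complex.Im (f y)) x.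

Lemma Re_mul (z w : R[i]) : complex.Re (z * w) =
  complex.Re z * complex.Re w - complex.Im z * complex.Im w.
Proof. by case: z => a b; case: w. Qed.

Lemma Im_mul (z w : R[i]) : complex.Im (z * w) =
  complex.Re z * complex.Im w + complex.Im z * complex.Re w.
Proof. by case: z => a b; case: w. Qed.

Lemma Re_add (z w : R[i]) : complex.Re (z + w) = complex.Re z + complex.Re w.
Proof. by case: z => a b; case: w. Qed.

Lemma Im_add (z w : R[i]) : complex.Im (z + w) = complex.Im z + complex.Im w.
Proof. by case: z => a b; case: w. Qed.

Lemma Re_opp (z : R[i]) : complex.Re (- z) = - complex.Re z.
Proof. by case: z. Qed.

Lemma Im_opp (z : R[i]) : complex.Im (- z) = - complex.Im z.
Proof. by case: z. Qed.

Lemma Re_conj (z : R[i]) : complex.Re (conjc z) = complex.Re z.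
Proof. by case: z. Qed.

Lemma Im_conj (z : R[i]) : complex.Im (conjc z) = - complex.Im z.
Proof. by case: z. Qed.

Lemma DC_val x v f df : is_derC x v f df -> DC v f x = df.
Proof. by move=> [[_ dr] [_ di]]; case: df dr di => a b; rewrite /DC /= => -> ->. Qed.

Lemma smoothC_is_derC U f v x : smoothC U f -> U x -> is_derC x v f (DC v f x).
Proof.
by move=> [sr si] Ux; split; apply: derivableP;
  [exact: (smooth_derivable sr)|exact: (smooth_derivable si)].
Qed.

Lemma smoothC_DC U f v : smoothC U f -> smoothC U (DC v f).
Proof. by move=> [sr si]; split; apply: (smooth_derive v). Qed.

Lemma eq_smoothC U f g : open U -> (forall x, U x -> f x = g x) ->
  smoothC U f -> smoothC U g.
Proof.
move=> oU fg [sr si]; split; [apply: (eq_smooth oU _ sr)|apply: (eq_smooth oU _ si)];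
  by move=> x Ux; rewrite fg.
Qed.

Lemma smoothC_subset U U' f : U' `<=` U -> smoothC U f -> smoothC U' f.
Proof. by move=> sU [sr si]; split; exact: smooth_subset sU _. Qed.

Lemma smoothC_cst U (a : R[i]) : smoothC U (fun=> a).
Proof. by split; exact: smooth_cst. Qed.

Lemma smoothC_real U (f : V -> R) : smooth U f -> smoothC U (fun x => (f x)%:C).
Proof. by move=> sf; split=> //; exact: smooth_cst. Qed.

Lemma smoothCD U f g : open U -> smoothC U f -> smoothC U g ->
  smoothC U (fun x => f x + g x).
Proof.
move=> oU [fr fi] [gr gi]; split.
  by under eq_fun do rewrite Re_add; exact: smoothD.
by under eq_fun do rewrite Im_add; exact: smoothD.
Qed.

Lemma smoothCN U f : open U -> smoothC U f -> smoothC U (fun x => - f x).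
Proof.
move=> oU [fr fi]; split.
  by under eq_fun do rewrite Re_opp; exact: smoothN.
by under eq_fun do rewrite Im_opp; exact: smoothN.
Qed.

Lemma smoothCB U f g : open U -> smoothC U f -> smoothC U g ->
  smoothC U (fun x => f x - g x).
Proof. by move=> oU sf sg; apply: smoothCD => //; exact: smoothCN. Qed.

Lemma smoothCM U f g : open U -> smoothC U f -> smoothC U g ->
  smoothC U (fun x => f x * g x).
Proof.
move=> oU [fr fi] [gr gi]; split.
  by under eq_fun do rewrite Re_mul; apply: smoothB => //; exact: smoothM.
by under eq_fun do rewrite Im_mul; apply: smoothD => //; exact: smoothM.
Qed.

Lemma smoothC_conj U f : open U -> smoothC U f -> smoothC U (fun x => conjc (f x)).
Proof.
move=> oU [fr fi]; split.
  by under eq_fun do rewrite Re_conj.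
by under eq_fun do rewrite Im_conj; exact: smoothN.
Qed.

(** The complex inverse is the conjugate over the squared modulus, which reduces the claim to the
    real inverse. *)
Lemma smoothC_inv U f : open U -> (forall x, U x -> f x != 0) ->
  smoothC U f -> smoothC U (fun x => (f x)^-1).
Proof.
move=> oU f0 [fr fi].
pose n x := (complex.Re (f x) * complex.Re (f x) +
             complex.Im (f x) * complex.Im (f x))^-1.
have sn : smooth U n.
  apply: (smooth_comp (W := [set x | x != 0]) oU _ smooth_inv).
    move=> x Ux /=; have := f0 x Ux; rewrite eq_complex /= -!expr2.
    by rewrite paddr_eq0 ?sqr_ge0// !sqrf_eq0.
  by apply: smoothD => //; exact: smoothM.
have E x : (f x)^-1 = conjc (f x) * (n x)%:C.
  rewrite /n -!expr2; case: (f x) => a b /=.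
  by apply/eqP; rewrite eq_complex /=; apply/andP; split; apply/eqP; rewrite /=; ring.
apply: (eq_smoothC (f:=fun x => conjc (f x) * (n x)%:C)) => //.
apply: smoothCM => //; first exact: smoothC_conj.
exact: smoothC_real.
Qed.

Lemma smoothC_sum U n (F : 'I_n -> V -> R[i]) : open U ->
  (forall k, smoothC U (F k)) -> smoothC U (fun x => \sum_k F k x).
Proof.
move=> oU; elim: n F => [|n IH] F sF.
  by under eq_fun do rewrite big_ord0; exact: smoothC_cst.
under eq_fun do rewrite big_ord_recl.
by apply: smoothCD => //; apply: (IH (fun k => F (lift ord0 k))).
Qed.

Lemma is_derC_eq x v f df df' : is_derC x v f df -> df = df' -> is_derC x v f df'.
Proof. by move=> h <-. Qed.

Lemma near_is_derC x v f g df : (\near x, f x = g x) -> is_derC x v f df ->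
  is_derC x v g df.
Proof.
move=> fg [hr hi]; split; [apply: near_eq_is_derive hr|apply: near_eq_is_derive hi];
  by apply: filterS fg => y ->.
Qed.

Lemma is_derC_cst x v (a : R[i]) : is_derC x v (fun=> a) 0.
Proof. by split; apply: is_derive_cst. Qed.

Lemma is_derC_real x v (f : V -> R) (df : R) : is_derive x v f df ->
  is_derC x v (fun y => (f y)%:C) df%:C.
Proof. by split=> //; apply: is_derive_cst. Qed.

Lemma is_derCD x v f g df dg : is_derC x v f df -> is_derC x v g dg ->
  is_derC x v (fun y => f y + g y) (df + dg).
Proof.
move=> [fr fi] [gr gi]; split.
  by under eq_fun do rewrite Re_add; rewrite Re_add; apply: is_deriveD.
by under eq_fun do rewrite Im_add; rewrite Im_add; apply: is_deriveD.
Qed.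

Lemma is_derCN x v f df : is_derC x v f df -> is_derC x v (fun y => - f y) (- df).
Proof.
move=> [fr fi]; split.
  by under eq_fun do rewrite Re_opp; rewrite Re_opp; apply: is_deriveN.
by under eq_fun do rewrite Im_opp; rewrite Im_opp; apply: is_deriveN.
Qed.

Lemma is_derCB x v f g df dg : is_derC x v f df -> is_derC x v g dg ->
  is_derC x v (fun y => f y - g y) (df - dg).
Proof. by move=> hf hg; apply: is_derCD => //; exact: is_derCN. Qed.

Lemma is_derCM x v f g df dg : is_derC x v f df -> is_derC x v g dg ->
  is_derC x v (fun y => f y * g y) (df * g x + f x * dg).
Proof.
move=> [fr fi] [gr gi]; split.
  under eq_fun do rewrite Re_mul; apply: is_derive_eq.
  by rewrite !(Re_add, Re_mul) /GRing.scale /=; ring.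
under eq_fun do rewrite Im_mul; apply: is_derive_eq.
by rewrite !(Im_add, Im_mul) /GRing.scale /=; ring.
Qed.

Lemma is_derC_conj x v f df : is_derC x v f df ->
  is_derC x v (fun y => conjc (f y)) (conjc df).
Proof.
move=> [fr fi]; split.
  by under eq_fun do rewrite Re_conj; rewrite Re_conj.
by under eq_fun do rewrite Im_conj; rewrite Im_conj; apply: is_deriveN.
Qed.

Lemma is_derC_sum x v n (F : 'I_n -> V -> R[i]) dF :
  (forall k, is_derC x v (F k) (dF k)) ->
  is_derC x v (fun y => \sum_k F k y) (\sum_k dF k).
Proof.
elim: n F dF => [|n IH] F dF sF.
  by under eq_fun do rewrite big_ord0; rewrite big_ord0; exact: is_derC_cst.
under eq_fun do rewrite big_ord_recl; rewrite big_ord_recl.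
apply: is_derCD => //.
by apply: (IH (fun k => F (lift ord0 k)) (fun k => dF (lift ord0 k))).
Qed.

End ComplexCalculus.

(** * Calculus of matrix-valued functions, entry by entry *)

Section MatrixCalculus.
Context {R : realType} {V : normedModType R}.
Implicit Types (U : set V) (v x : V).

Definition is_derM x v m n (A : V -> 'M[R[i]]_(m, n)) (dA : 'M[R[i]]_(m, n)) :=
  forall i j, is_derC x v (fun y => A y i j) (dA i j).

Definition DM v m n (A : V -> 'M[R[i]]_(m, n)) x : 'M[R[i]]_(m, n) :=
  \matrix_(i, j) DC v (fun y => A y i j) x.

Lemma DM_val x v m n (A : V -> 'M[R[i]]_(m, n)) dA :
  is_derM x v A dA -> DM v A x = dA.
Proof. by move=> h; apply/matrixP => i j; rewrite mxE; exact: DC_val. Qed.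

Lemma smooth_mx_is_derM U m n (A : V -> 'M[R[i]]_(m, n)) v x :
  smooth_mx U A -> U x -> is_derM x v A (DM v A x).
Proof.
move=> sA Ux i j; rewrite mxE; exact: (smoothC_is_derC (U:=U) v (sA i j)).
Qed.

Lemma smooth_mx_DM U m n (A : V -> 'M[R[i]]_(m, n)) v :
  smooth_mx U A -> smooth_mx U (DM v A).
Proof.
move=> sA i j; have [sr si] := smoothC_DC v (sA i j).
by split; under eq_fun do rewrite mxE.
Qed.

Lemma smooth_mx_subset U U' m n (A : V -> 'M[R[i]]_(m, n)) :
  U' `<=` U -> smooth_mx U A -> smooth_mx U' A.
Proof. by move=> sU sA i j; apply: (smoothC_subset sU (sA i j)). Qed.

Lemma eq_smooth_mx U m n (A B : V -> 'M[R[i]]_(m, n)) : open U ->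
  (forall x, U x -> A x = B x) -> smooth_mx U A -> smooth_mx U B.
Proof.
by move=> oU AB sA i j; apply: (eq_smoothC oU _ (sA i j)) => x Ux; rewrite AB.
Qed.

Lemma smooth_mx_cst U m n (A : 'M[R[i]]_(m, n)) : smooth_mx U (fun _ : V => A).
Proof. by move=> i j; exact: smoothC_cst. Qed.

Lemma smooth_mx_mul U m n p (A : V -> 'M[R[i]]_(m, n)) (B : V -> 'M[R[i]]_(n, p)) :
  open U -> smooth_mx U A -> smooth_mx U B -> smooth_mx U (fun x => A x *m B x).
Proof.
move=> oU sA sB i j; change (smoothC U (fun x => (A x *m B x) i j)).
under eq_fun do rewrite mxE.
by apply: smoothC_sum => // k; exact: (smoothCM oU (sA i k) (sB k j)).
Qed.

Lemma smooth_mx_adjoint U m n (A : V -> 'M[R[i]]_(m, n)) :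
  open U -> smooth_mx U A -> smooth_mx U (fun x => adjoint (A x)).
Proof.
move=> oU sA i j; change (smoothC U (fun x => (adjoint (A x)) i j)).
under eq_fun do rewrite !mxE.
exact: (smoothC_conj oU (sA j i)).
Qed.

Lemma is_derM_cst x v m n (A : 'M[R[i]]_(m, n)) : is_derM x v (fun _ : V => A) 0.
Proof. by move=> i j; rewrite mxE; exact: is_derC_cst. Qed.

Lemma is_derM_mul x v m n p (A : V -> 'M[R[i]]_(m, n)) (B : V -> 'M[R[i]]_(n, p))
    dA dB : is_derM x v A dA -> is_derM x v B dB ->
  is_derM x v (fun y => A y *m B y) (dA *m B x + A x *m dB).
Proof.
move=> hA hB i j; under eq_fun do rewrite mxE.
rewrite !mxE -big_split /=; apply: is_derC_sum => k.
exact: is_derCM.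
Qed.

Lemma is_derM_adjoint x v m n (A : V -> 'M[R[i]]_(m, n)) dA :
  is_derM x v A dA -> is_derM x v (fun y => adjoint (A y)) (adjoint dA).
Proof.
move=> hA i j; under eq_fun do rewrite !mxE.
by rewrite !mxE; exact: is_derC_conj.
Qed.

Lemma near_is_derM x v m n (A B : V -> 'M[R[i]]_(m, n)) dA :
  (\near x, A x = B x) -> is_derM x v A dA -> is_derM x v B dA.
Proof.
by move=> AB hA i j; apply: near_is_derC (hA i j); apply: filterS AB => y ->.
Qed.

Lemma is_derM_unique x v m n (A : V -> 'M[R[i]]_(m, n)) dA dA' :
  is_derM x v A dA -> is_derM x v A dA' -> dA = dA'.
Proof. by move=> /DM_val <- /DM_val <-. Qed.

End MatrixCalculus.

Lemma entrywise_derivE (R : realType) m n (A : R -> 'M[R[i]]_(m, n)) t :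
  entrywise_deriv A t = DM (1 : R) A t.
Proof. by apply/matrixP => i j; rewrite !mxE !derive1E. Qed.

(** * A smooth cube root on the right half plane *)

Section CubeRoot.
Context {R : realType}.

(* The principal cube root, on the half plane of positive real part. *)
Definition cbrt (z : R[i]) : R[i] :=
  let: a +i* b := z in
  let th := atan (b / a) / 3 in
  (expR (ln (a * a + b * b) / 6))%:C * (cos th +i* sin th).

Lemma cbrt_cube (z : R[i]) : 0 < complex.Re z -> cbrt z ^+ 3 = z.
Proof.
case: z => a b /= a0; set q := b / a; set m := expR _; set th := atan q / 3.
have nE : a * a + b * b = a ^+ 2 * (1 + q ^+ 2).
  by rewrite /q; field; rewrite gt_eqF.
have q1 : 0 < 1 + q ^+ 2 by rewrite ltr_pwDl// sqr_ge0.
(* The cube of [m] is the modulus of z: both sides are nonnegative and their squares equal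
   [a * a + b * b], the 6 in the exponent being 2 times 3. *)
have m3 : m ^+ 3 = a * Num.sqrt (1 + q ^+ 2).
  apply/eqP; rewrite -(@eqrXn2 _ 2)//; last 2 first.
  - by rewrite exprn_ge0// expR_ge0.
  - by rewrite mulr_ge0// ?sqrtr_ge0// ltW.
  rewrite [eqbRHS]exprMn sqr_sqrtr ?(ltW q1)// -nE -exprM /m -expRM_natl.
  rewrite (_ : _%:R * _ = ln (a * a + b * b)); last by field.
  by rewrite lnK// posrE nE mulr_gt0// exprn_gt0.
have atE : th + th + th = atan q by rewrite /th; field.
have cE : cos (th + th + th) = (Num.sqrt (1 + q ^+ 2))^-1 by rewrite atE cos_atan.
have sE : sin (th + th + th) = q * (Num.sqrt (1 + q ^+ 2))^-1.
  rewrite -cE atE -[X in _ = X * _](atanK q) /tan -mulrA mulVf ?mulr1//.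
  by rewrite cos_atan invr_neq0// gt_eqF// sqrtr_gt0.
have s0 : Num.sqrt (1 + q ^+ 2) != 0 by rewrite gt_eqF// sqrtr_gt0.
(* The angle is kept as a sum of three terms so that the addition formulas turn the cube into a
   polynomial identity. *)
have -> : (m%:C * (cos th +i* sin th)) ^+ 3 =
    (m ^+ 3 * cos (th + th + th)) +i* (m ^+ 3 * sin (th + th + th)).
  rewrite !(cosD, sinD); apply/eqP; rewrite eq_complex.
  by apply/andP; split; apply/eqP; rewrite /= ; ring.
rewrite cE sE m3 /q; apply/eqP; rewrite eq_complex /=.
by apply/andP; split; apply/eqP; field; rewrite ?s0 ?gt_eqF.
Qed.

Lemma cbrt1 : cbrt 1 = 1.
Proof.
rewrite -[1]/(1 +i* 0) /cbrt /= !mul0r atan0 !mul0r cos0 sin0 addr0 !mulr1.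
by rewrite ln1 mul0r expR0.
Qed.

Lemma smoothC_cbrt (V : normedModType R) (U : set V) (f : V -> R[i]) :
  open U -> (forall x, U x -> 0 < complex.Re (f x)) -> smoothC U f ->
  smoothC U (fun x => cbrt (f x)).
Proof.
move=> oU f0 [fr fi].
pose a x := complex.Re (f x); pose b x := complex.Im (f x).
have sa1 : smooth U (fun x => (a x)^-1).
  apply: (smooth_comp oU _ smooth_inv fr) => x Ux /=.
  by rewrite gt_eqF// f0.
have sth : smooth U (fun x => atan (b x / a x) / 3).
  apply: smoothM => //; last exact: smooth_cst.
  by apply: (smooth_comp (W := setT) oU _ smooth_atan) => //; exact: smoothM.
have sm : smooth U (fun x => expR (ln (a x * a x + b x * b x) / 6)).
  apply: (smooth_comp (W := setT) oU _ smooth_expR) => //.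
  apply: smoothM => //; last exact: smooth_cst.
  apply: (smooth_comp oU _ smooth_ln).
    by move=> x Ux /=; rewrite ltr_pwDl ?mulr_gt0 ?f0// -expr2 sqr_ge0.
  by apply: smoothD => //; exact: smoothM.
have [ss sc] := @smooth_sincos R.
apply: (eq_smoothC (f := fun x =>
  (expR (ln (a x * a x + b x * b x) / 6))%:C *
  (cos (atan (b x / a x) / 3) +i* sin (atan (b x / a x) / 3)))) => //.
  by move=> x _; rewrite /a /b /cbrt; case: (f x).
apply: smoothCM => //; first exact: smoothC_real.
by split; [exact: (smooth_comp (W := setT) oU _ sc)
          |exact: (smooth_comp (W := setT) oU _ ss)].
Qed.

End CubeRoot.

(** * A smooth bump function *)

Section Bump.
Context {R : realType}.

(** The powers of [t] are carried along so that the family is closed under differentiation: every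
    derivative of exp(-1/t) is a combination of its members. *)
Definition flat (n : nat) (t : R) : R :=
  if 0 < t then t ^- n * expR (- t^-1) else 0.

Lemma flat_ge0 n t : 0 <= flat n t.
Proof.
by rewrite /flat; case: ltP => // t0; rewrite mulr_ge0 ?expR_ge0// invr_ge0 exprn_ge0// ltW.
Qed.

(** One term of the exponential series bounds exp(1/t) below by a multiple of t^-(n+2); the two
    extra powers make the function quadratically small at 0. *)
Lemma flat_le n t : flat n t <= (n.+2)`!%:R * t ^+ 2.
Proof.
rewrite /flat; case: ltP => t0; last by rewrite mulr_ge0// sqr_ge0.
have h : (t^-1) ^+ n.+2 / (n.+2)`!%:R <= expR (t^-1).
  apply: le_trans (expR_ge1Dxn n.+1 _); last by rewrite invr_ge0 ltW.
  by rewrite lerDr.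
have f0 : (0 : R) < (n.+2)`!%:R by rewrite ltr0n fact_gt0.
rewrite expRN ler_pdivrMr ?expR_gt0//.
move: h; rewrite ler_pdivrMr// => h.
have -> : t ^- n = t ^+ 2 * t^-1 ^+ n.+2.
  by rewrite exprVn !exprS; field; rewrite expf_neq0 gt_eqF.
rewrite (_ : _ * _ * expR _ = t ^+ 2 * (expR t^-1 * (n.+2)`!%:R)); last by ring.
by rewrite ler_pM2l// exprn_gt0.
Qed.

Lemma is_derive_flat n (t : R) :
  is_derive t (1 : R) (flat n) (- n%:R * flat n.+1 t + flat n.+2 t).
Proof.
have [t0|t0|->] := ltgtP t 0.
- have -> : - n%:R * flat n.+1 t + flat n.+2 t = 0.
    by rewrite /flat ltNge (ltW t0) /= mulr0 addr0.
  apply: (@near_eq_is_derive _ _ _ (cst 0)).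
  have := lt_nbhsl t0.
  by apply: filterS => y /= y0; rewrite /flat ltNge (ltW y0).
- have tn0 : t != 0 by rewrite gt_eqF.
  have d1 : is_derive t (1 : R) (fun y : R => (y ^+ n)^-1) (- n%:R * t ^- n.+1).
    apply: is_derive_eq.
      apply: (is_deriveV (f := fun y : R => y ^+ n)); first by rewrite expf_neq0.
      by split; [exact: exprn_derivable|exact: exp_derive].
    rewrite /GRing.scale /= mulr1; case: n => [|n] /=.
      by rewrite !mul0r !mulr0 oppr0 mul0r.
    by rewrite !exprS; field; rewrite tn0 expf_neq0.
  have d2 : is_derive t (1 : R) (fun y : R => expR (- y^-1)) (t ^- 2 * expR (- t^-1)).
    apply: is_derive_eq.
      apply: (@is_derive1_comp _ (@expR R) (fun y => - y^-1)).
      apply: is_deriveN; exact: (is_deriveV (f:=id)).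
    by rewrite /GRing.scale /= mulr1 opprK mulrC.
  have fE : \near t, t ^- n * expR (- t^-1) = flat n t.
    by have := lt_nbhsr t0; apply: filterS => y /= y0; rewrite /flat y0.
  apply: near_eq_is_derive fE _; apply: is_derive_eq.
  by rewrite /GRing.scale /= /flat t0 !exprS; field; rewrite tn0 expf_neq0.
have z m : flat m 0 = 0 by rewrite /flat ltxx.
rewrite !z mulr0 addr0.
(* At 0 the quadratic bound makes the difference quotient at most a constant times |h|. *)
suff H : (fun h : R => h^-1 *: ((flat n \o shift 0) (h *: 1) - flat n 0)) @ 0^' --> (0 : R).
  by split; [apply/cvg_ex; exists 0|apply: cvg_lim].
set C : R := (n.+2)`!%:R.
have C0 : 0 < C by rewrite ltr0n fact_gt0.
apply/cvgrPdist_le => e e0 /=.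
have he : 0 < e / C by rewrite divr_gt0.
near=> h.
have h0 : h != 0 by near: h; exact: nbhs_dnbhs_neq.
have hlt : `|h| < e / C by near: h; apply: dnbhs0_lt.
rewrite sub0r normrN z subr0 addr0 [h *: 1]mulr1 normrM normfV (ger0_norm (flat_ge0 _ _)).
rewrite ler_pdivrMl ?normr_gt0//; apply: le_trans (flat_le _ _) _.
rewrite -real_normK ?num_real// expr2 mulrA mulrAC -/C mulrC.
by apply: ler_wpM2l => //; rewrite mulrC -ler_pdivlMr// ltW.
Unshelve. all: by end_near.
Qed.

Lemma smooth_flat n : smooth setT (flat n).
Proof.
move=> k; elim: k n => [|k IH] n.
  split=> // x _; apply/differentiable_continuous/derivable1_diffP.
  by case: (is_derive_flat n x).
have o : open [set: R] by exact: openT.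
apply: (CkS_real (h' := fun t => - n%:R * flat n.+1 t + flat n.+2 t)) => //.
  by move=> x _; exact: is_derive_flat.
by apply: CkD => //; apply: CkM => //; exact: Ck_cst.
Qed.

Lemma bump_exists (x y : R) : exists b : R -> R,
  [/\ smooth setT b, forall t, 0 <= b t, forall t, x < t < y -> 0 < b t &
      forall t, ~~ (x < t < y) -> b t = 0].
Proof.
have fp t : (0 < flat 0 t) = (0 < t).
  rewrite /flat; case: (ltP 0 t) => t0; rewrite ?ltxx//.
  by rewrite expr0 invr1 mul1r expR_gt0.
have fz t : (flat 0 t == 0) = (t <= 0).
  by rewrite leNgt -fp lt_neqAle flat_ge0 andbT negbK eq_sym.
have o : open [set: R] by exact: openT.
exists (fun t => flat 0 (t - x) * flat 0 (y - t)); split.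
- apply: smoothM => //; move=> k.
    apply: (@Ck_affine _ _ _ _ setT (fun t => t - x) id) (smooth_flat 0 k).
      by move=> t; apply: cvgB; [exact: cvg_id|exact: cvg_cst].
    by move=> p v h; rewrite addrA.
  apply: (@Ck_affine _ _ _ _ setT (fun t => y - t) -%R) (smooth_flat 0 k).
    by move=> t; apply: cvgB; [exact: cvg_cst|exact: cvg_id].
  by move=> p v h; rewrite /= scalerN opprD addrCA addrA.
- by move=> t; rewrite mulr_ge0// flat_ge0.
- by move=> t /andP[xt ty]; rewrite mulr_gt0// fp subr_gt0.
move=> t; rewrite negb_and -!leNgt => /orP[h|h]; apply/eqP; rewrite mulf_eq0 !fz !subr_le0 h //.
by rewrite orbT.
Qed.

End Bump.

(** * Integrals depending on a parameter *)

Section Integrals.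
Context {R : realType}.
Implicit Types (f g df : R -> R) (x y t : R).
Local Notation mu := (@lebesgue_measure R).

Lemma segment_continuous f x y :
  (forall t, x <= t <= y -> {for t, continuous f}) ->
  {within `[x, y], continuous f}.
Proof.
move=> cf; apply: continuous_in_subspaceT => t; rewrite inE /= in_itv /=.
exact: cf.
Qed.

Lemma segment_integrable f x y :
  (forall t, x <= t <= y -> {for t, continuous f}) ->
  mu.-integrable `[x, y] (EFin \o f).
Proof.
move=> cf; apply: continuous_compact_integrable; first exact: segment_compact.
exact: segment_continuous.
Qed.

Lemma Rintegral_derive f df x y : x < y ->
  (forall t, x <= t <= y -> is_derive t (1 : R) f (df t)) ->
  (forall t, x <= t <= y -> {for t, continuous df}) ->
  \int[mu]_(t in `[x, y]) df t = f y - f x.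
Proof.
move=> xy fdf cdf.
have cf t : x <= t <= y -> {for t, continuous f}.
  move=> /fdf[d _]; exact/differentiable_continuous/derivable1_diffP.
rewrite /Rintegral (continuous_FTC2 (F := f) xy)//.
- exact: segment_continuous.
- split.
  + by move=> t; rewrite in_itv /= => /andP[a b]; case: (fdf t) => //; rewrite !ltW.
  + by apply: cvg_at_right_filter; apply: cf; rewrite lexx ltW.
  + by apply: cvg_at_left_filter; apply: cf; rewrite lexx ltW.
by move=> t; rewrite in_itv /= => /andP[a b]; rewrite derive1E; case: (fdf t) => //; rewrite !ltW.
Qed.

(** A positive value at an inner point persists, up to a factor 1/2, on a small closed interval, and
    that interval alone makes the integral positive. *)
Lemma Rintegral_eq0_continuous f x y t :
  (forall t, x <= t <= y -> {for t, continuous f}) ->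
  (forall t, x <= t <= y -> 0 <= f t) ->
  \int[mu]_(t in `[x, y]) f t = 0 -> x < t < y -> f t = 0.
Proof.
move=> cf f0 intf /andP[xt ty].
have /f0 : x <= t <= y by rewrite !ltW.
rewrite le_eqVlt => /predU1P[<-//|ft]; exfalso.
have ft2 : f t / 2 < f t by rewrite ltr_pdivrMr// ltr_pMr// ltr1n.
have /nbhs_ballP[e /= e0 be] : nbhs t [set s | [/\ x < s, s < y & f t / 2 < f s]].
  near=> s; split; near: s.
  - exact: lt_nbhsr.
  - exact: lt_nbhsl.
  have := cf t; rewrite !ltW// => /(_ isT) /cvgr_gt; exact.
have eE : e / 2 < e by rewrite ltr_pdivrMr// ltr_pMr// ltr1n.
have e2 : 0 < e / 2 by rewrite divr_gt0.
pose a := t - e / 2; pose b := t + e / 2.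
have ab : a < b by rewrite /a /b ltrBlDr -addrA ltrDl addr_gt0.
have H s : a <= s <= b -> [/\ x < s, s < y & f t / 2 < f s].
  move=> /andP[as_ sb]; apply: be; rewrite /ball /=.
  by rewrite /a /b in as_ sb; rewrite ltr_norml; apply/andP; split; lra.
have /integrableP[mf _] := segment_integrable cf.
have sub : `[a, b] `<=` `[x, y].
  by move=> s /=; rewrite !in_itv /= => /H[xs sy _]; rewrite !ltW.
have fin : (\int[mu]_(s in `[x, y]) (f s)%:E = 0)%E.
  rewrite -[LHS]fineK; first by move: intf; rewrite /Rintegral => ->.
  exact: (integrable_fin_num _ (segment_integrable cf)).
have : (\int[mu]_(s in `[a, b]) (f t / 2)%:E <= 0)%E.
  rewrite -fin; apply: le_trans (_ : (\int[mu]_(s in `[a, b]) (f s)%:E <= _)%E).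
    apply: ge0_le_integral => //.
    - by move=> s _; rewrite lee_fin divr_ge0// ltW.
    - exact: (measurable_funS _ sub mf).
    - by move=> s /=; rewrite in_itv /= => /H[_ _ h]; rewrite lee_fin ltW.
  by apply: ge0_subset_integral.
rewrite integral_cst//= lebesgue_measure_itv /= lte_fin ab -EFinB -EFinM lee_fin.
by apply/negP; rewrite -ltNge mulr_gt0// ?subr_gt0// divr_gt0.
Unshelve. all: by end_near.
Qed.

(** Tube lemma: compactness of the segment lets a single width [d] serve for all t. *)
Lemma tube_gt0 (f : R * R -> R) x y :
  (forall t, x <= t <= y -> {for (0, t), continuous f} /\ 0 < f (0, t)) ->
  exists2 d, 0 < d & forall e t, - d < e < d -> x <= t <= y -> 0 < f (e, t).
Proof.
move=> H.
have /compact_near_coveringP := @segment_compact R x y.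
move=> /(_ R (nbhs (0 : R)) (fun e t => 0 < f (e, t)) _) [].
  move=> t /=; rewrite in_itv /= => /H[cf f0].
  have [[A B] /= [A0 Bt] AB] : nbhs (0, t) [set p | 0 < f p] by exact: (cvgr_gt _ cf).
  by exists (B, A) => //= -[t' e] [/= Bt' Ae]; apply: (AB (e, t')).
move=> d /= d0 hd; exists d => // e t ed xty.
by apply: (hd e); rewrite /= ?in_itv//= sub0r normrN ltr_norml.
Qed.

Lemma is_derive_Rintegral (f g : R * R -> R) d x y : 0 < d ->
  (forall e t, - d < e < d -> x <= t <= y ->
    [/\ {for (e, t), continuous f}, {for (e, t), continuous g} &
      is_derive e (1 : R) (fun e => f (e, t)) (g (e, t))]) ->
  is_derive (0 : R) (1 : R) (fun e => \int[mu]_(t in `[x, y]) f (e, t))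
    (\int[mu]_(t in `[x, y]) g (0, t)).
Proof.
move=> d0 H.
have d2 : d / 2 < d by rewrite ltr_pdivrMr// ltr_pMr// ltr1n.
have dh : 0 < d / 2 by rewrite divr_gt0.
have sl (h : R * R -> R) e t : {for (e, t), continuous h} ->
    {for t, continuous (fun t => h (e, t))}.
  move=> ch; apply: (continuous_comp (f := fun t => (e, t)) (g := h)) => //.
  move=> A [[P Q] /= [Pe Qt] PQ]; apply: filterS Qt => t' Qt'.
  by apply: (PQ (e, t')); split=> //=; exact: nbhs_singleton.
(* The dominating constant: [g] is continuous on a closed rectangle, which lies inside the domain
   because its half-width is [d / 2]. *)
have [C C0 HC] : exists2 C, 0 <= C & forall e t, - (d / 2) <= e <= d / 2 -> x <= t <= y ->
    `|g (e, t)| <= C.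
  pose K : set (R * R) := `[- (d / 2), d / 2] `*` `[x, y].
  have : compact (g @` K).
    apply: continuous_compact; last by apply: compact_setX; exact: segment_compact.
    apply: continuous_in_subspaceT => -[e t]; rewrite inE => -[] /=.
    rewrite !in_itv /= => /andP[e1 e2] ht; case: (H e t) => //.
    by rewrite (lt_le_trans _ e1) ?ltrN2// (le_lt_trans e2).
  move/compact_bounded => [M [Mr hM]].
  exists `|M + 1| => // e t he ht.
  apply: le_trans (ler_norm _); apply: hM; first by rewrite ltrDl.
  by exists (e, t) => //; split; rewrite /= in_itv.
have lo e : e \in `]- (d / 2), (d / 2)[ -> - d < e < d.
  by rewrite in_itv /= => /andP[a b]; rewrite (lt_trans _ a) ?ltrN2// (lt_trans b).
have m0 : `]- (d / 2), (d / 2)[%classic (0 : R) by rewrite /= in_itv /= oppr_lt0 dh.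
have mf e : `]- (d / 2), (d / 2)[%classic e -> mu.-integrable `[x, y] (EFin \o (fun t => f (e, t))).
  move=> he; apply: segment_integrable => t ht; apply: sl.
  by case: (H e t (lo _ he) ht).
have df e t : `]- (d / 2), (d / 2)[%classic e -> `[x, y]%classic t ->
    derivable (fun e => f (e, t)) e 1.
  move=> he; rewrite /= in_itv /= => ht.
  by case: (H e t (lo _ he) ht) => _ _ [].
have mC : mu.-integrable `[x, y] (EFin \o (fun=> C)).
  by apply: segment_integrable => t _; exact: cst_continuous.
have ub e t : `]- (d / 2), (d / 2)[%classic e -> `[x, y]%classic t ->
    `|partial1of2 (fun e t => f (e, t)) e t| <= C.
  move=> he; rewrite /= in_itv /= => ht; rewrite /partial1of2 derive1E.
  case: (H e t (lo _ he) ht) => _ _ [_ ->]; apply: HC => //.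
  by move: he; rewrite /= in_itv /= => /andP[a b]; rewrite !ltW.
have := @cvg_differentiation_under_integral R _ _ mu (fun e t => f (e, t))
  `[x, y]%classic (measurable_itv _) 0 _ _ m0 mf df (fun=> C) (fun=> C0) mC ub.
move=> h.
have -> : \int[mu]_(t in `[x, y]) g (0, t) =
    \int[mu]_(t in `[x, y]) partial1of2 (fun e t => f (e, t)) 0 t.
  apply: eq_Rintegral => t; rewrite inE /= in_itv /= => ht.
  rewrite /partial1of2 derive1E.
  by case: (H 0 t _ ht) => [|_ _ [_ ->]//]; rewrite oppr_lt0 d0.
have {}h : (fun h : R => h^-1 *: (((fun e => \int[mu]_(t in `[x, y]) f (e, t))
    \o shift 0) (h *: 1) - \int[mu]_(t in `[x, y]) f (0, t))) @ 0^' -->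
    \int[mu]_(t in `[x, y]) partial1of2 (fun e t => f (e, t)) 0 t.
  by under eq_fun do rewrite /= [_ *: 1]mulr1.
by split; [apply/cvg_ex; eexists; exact: h|apply: cvg_lim].
Qed.

(** The origin may lie on either side of [s]. Integrating from a point [a] to the left of both
    writes [oint], in either orientation, as a difference of two values of one primitive. *)
Lemma is_derive_oint (J : set R) g s : open J -> is_interval J -> J 0 -> J s ->
  (forall t, J t -> {for t, continuous g}) -> is_derive s (1 : R) (oint g 0) (g s).
Proof.
move=> oJ iJ J0 Js cg.
have ext r : J r -> exists a b, [/\ J a, J b, a < r & r < b].
  move=> Jr; have /nbhs_ballP[e /= e0 be] : nbhs r J by exact: open_nbhs_nbhs.
  have e2 : 0 < e / 2 by rewrite divr_gt0.
  have eE : e / 2 < e by rewrite ltr_pdivrMr// ltr_pMr// ltr1n.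
  exists (r - e / 2), (r + e / 2); split; last 2 first.
  - by rewrite ltrBlDr ltrDl.
  - by rewrite ltrDl.
  - by apply: be; rewrite /ball /= opprB addrCA subrr addr0 gtr0_norm.
  - by apply: be; rewrite /ball /= opprD addrA subrr sub0r normrN gtr0_norm.
have [a0 [b0 [Ja0 Jb0 a00 b00]]] := ext 0 J0.
have [a1 [b1 [Ja1 Jb1 a1s b1s]]] := ext s Js.
pose a := Num.min a0 a1; pose b := Num.max b0 b1.
have Ja : J a by rewrite /a; case: leP.
have Jb : J b by rewrite /b; case: leP.
have [a_0 a_s] : a < 0 /\ a < s by rewrite /a !gt_min a00 a1s orbT.
have [b_0 b_s] : 0 < b /\ s < b by rewrite /b !lt_max b00 b1s orbT.
have cab t : a <= t <= b -> {for t, continuous g}.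
  by move=> atb; apply: cg; exact: (iJ _ _ Ja Jb).
have iab r : r <= b -> mu.-integrable `[a, r] (EFin \o g).
  move=> rb; apply: segment_integrable => t /andP[at_ tr]; apply: cab.
  by rewrite at_ (le_trans tr).
pose G r := \int[mu]_(t in `[a, r]) g t.
have [dG GE] := continuous_FTC1_closed b_s (iab b (lexx _)) a_s (cg s Js).
have dGs : is_derive s (1 : R) (fun r => G r - G 0) (g s).
  have : is_derive s (1 : R) G (g s) by apply: DeriveDef; [exact: dG|rewrite -derive1E; exact: GE].
  by move=> h; apply: is_derive_eq; rewrite subr0.
have split_ p q : a < p -> p <= q -> q < b ->
    G q - G p = \int[mu]_(t in `[p, q]) g t.
  move=> ap pq qb; rewrite /G Rintegral_itvB.
  - rewrite Rintegral_itv_obnd_cbnd//.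
    apply: integrableS (iab q (ltW qb)) => //.
    by move=> t /=; rewrite !in_itv /= => /andP[pt ->]; rewrite (ltW (lt_trans ap pt)).
  - exact/iab/ltW.
  - by rewrite bnd_simp ltW.
  - by rewrite bnd_simp.
apply: near_eq_is_derive dGs.
have : \forall r \near s, a < r /\ r < b.
  near=> r; split; near: r; [exact: lt_nbhsr|exact: lt_nbhsl].
apply: filterS => r [ar rb]; rewrite /oint; case: ifPn => r0.
  by rewrite split_.
by rewrite -split_ ?opprB//; rewrite -ltNge in r0; rewrite ltW.
Unshelve. all: by end_near.
Qed.

End Integrals.

(** * Maps into the group G *)

Section Matrix3.
Context {R : realType}.
Implicit Types (A B N : 'M[R[i]]_3) (z w : R[i]).
Local Notation C := R[i].
Local Notation h := (@hform R).

Definition i0 : 'I_3 := @Ordinal 3 0 isT.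
Definition i1 : 'I_3 := @Ordinal 3 1 isT.
Definition i2 : 'I_3 := @Ordinal 3 2 isT.

Lemma ord3P (P : 'I_3 -> Prop) : P i0 -> P i1 -> P i2 -> forall i, P i.
Proof.
move=> p0 p1 p2 [[|[|[|//]]] Hi].
- by rewrite (_ : Ordinal Hi = i0)//; apply: val_inj.
- by rewrite (_ : Ordinal Hi = i1)//; apply: val_inj.
- by rewrite (_ : Ordinal Hi = i2)//; apply: val_inj.
Qed.

Lemma sum3 (T : nmodType) (f : 'I_3 -> T) : \sum_(k < 3) f k = f i0 + f i1 + f i2.
Proof.
rewrite !big_ord_recl big_ord0 addr0 addrA; congr (f _ + f _ + f _); exact: val_inj.
Qed.

Lemma mulmx3E m n (A : 'M[C]_(m, 3)) (B : 'M[C]_(3, n)) i j :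
  (A *m B) i j = A i i0 * B i0 j + A i i1 * B i1 j + A i i2 * B i2 j.
Proof. by rewrite mxE sum3. Qed.

Lemma mx3E (s : seq (seq C)) i j : mx3 s i j = nth 0 (nth [::] s i) j.
Proof. by rewrite mxE. Qed.

Lemma eq_mx3 A B :
  A i0 i0 = B i0 i0 -> A i0 i1 = B i0 i1 -> A i0 i2 = B i0 i2 ->
  A i1 i0 = B i1 i0 -> A i1 i1 = B i1 i1 -> A i1 i2 = B i1 i2 ->
  A i2 i0 = B i2 i0 -> A i2 i1 = B i2 i1 -> A i2 i2 = B i2 i2 -> A = B.
Proof. by move=> *; apply/matrixP; apply: ord3P; apply: ord3P. Qed.

Lemma det3 (T : comPzRingType) (A : 'M[T]_3) : \det A =
  A i0 i0 * (A i1 i1 * A i2 i2 - A i1 i2 * A i2 i1)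
  - A i0 i1 * (A i1 i0 * A i2 i2 - A i1 i2 * A i2 i0)
  + A i0 i2 * (A i1 i0 * A i2 i1 - A i1 i1 * A i2 i0).
Proof.
rewrite (expand_det_row _ i0) sum3 /cofactor.
have E (B : 'M[T]_2) : \det B = B ord0 ord0 * B ord_max ord_max - B ord0 ord_max * B ord_max ord0.
  rewrite (expand_det_row _ ord0) !big_ord_recl big_ord0 addr0 /cofactor !det_mx11 !mxE.
  have l0 : lift ord0 (0 : 'I_1) = ord_max :> 'I_2 by exact: val_inj.
  have l1 : lift ord_max (0 : 'I_1) = ord0 :> 'I_2 by exact: val_inj.
  by rewrite !l0 l1 /= expr0 expr1 mul1r mulN1r mulrN.
rewrite !E !mxE /=.
have l00 : lift i0 (ord0 : 'I_2) = i1 by exact: val_inj.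
have l0m : lift i0 (ord_max : 'I_2) = i2 by exact: val_inj.
have l10 : lift i1 (ord0 : 'I_2) = i0 by exact: val_inj.
have l1m : lift i1 (ord_max : 'I_2) = i2 by exact: val_inj.
have l20 : lift i2 (ord0 : 'I_2) = i0 by exact: val_inj.
have l2m : lift i2 (ord_max : 'I_2) = i1 by exact: val_inj.
rewrite !l00 !l0m !l10 !l1m !l20 !l2m !addn0 /=.
by rewrite /bump /= ?addn0 ?add0n expr0 expr1 sqrrN expr1n !mul1r mulN1r mulrN.
Qed.

Lemma hformK : h *m h = 1%:M.
Proof.
by apply: eq_mx3; rewrite mulmx3E !mxE /=; apply/eqP; rewrite eq_complex /=;
  apply/andP; split; apply/eqP; ring.
Qed.

Lemma adjointE m n (A : 'M[C]_(m, n)) i j : adjoint A i j = conjc (A j i).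
Proof. by rewrite !mxE. Qed.

Lemma adjoint_hform : adjoint h = h.
Proof.
by apply: eq_mx3; rewrite adjointE !mxE /=; apply/eqP; rewrite eq_complex /= ?oppr0 ?opprK !eqxx.
Qed.

Lemma adjoint_mul m n p (A : 'M[C]_(m, n)) (B : 'M[C]_(n, p)) :
  adjoint (A *m B) = adjoint B *m adjoint A.
Proof. by rewrite /adjoint map_mxM trmx_mul. Qed.

Lemma adjointK m n (A : 'M[C]_(m, n)) : adjoint (adjoint A) = A.
Proof. by apply/matrixP => i j; rewrite !adjointE conjcK. Qed.

(* The inverse of an element of G; unlike [invmx], it is visibly smooth in the entries. *)
Definition ginv A := h *m adjoint A *m h.

Lemma groupG_ginv A : groupG A -> ginv A *m A = 1%:M /\ A *m ginv A = 1%:M.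
Proof.
move=> [_ HA].
have E : ginv A *m A = 1%:M by rewrite /ginv -!mulmxA (mulmxA _ h) HA hformK.
by split=> //; exact: mulmx1C.
Qed.

Lemma groupG_unit A : groupG A -> A \in unitmx.
Proof. by move=> [dA _]; rewrite unitmxE dA unitr1. Qed.

Lemma groupG_invmx A : groupG A -> invmx A = ginv A.
Proof.
move=> gA; have [E _] := groupG_ginv gA.
by rewrite -[LHS]mul1mx -E mulmxK// groupG_unit.
Qed.

Lemma groupG_mul A B : groupG A -> groupG B -> groupG (A *m B).
Proof.
move=> [dA HA] [dB HB]; split; first by rewrite det_mulmx dA dB mulr1.
by rewrite adjoint_mul !mulmxA -(mulmxA _ _ h) -(mulmxA _ _ A) HA.
Qed.

Lemma ginv_mul A B : ginv (A *m B) = ginv B *m ginv A.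
Proof.
rewrite /ginv adjoint_mul -!mulmxA; congr (_ *m _); congr (_ *m _).
by rewrite !mulmxA hformK mul1mx.
Qed.

Lemma hermE (z w : 'cV[C]_3) : herm z w =
  'i%C * conjc (z i0 0) * w i2 0 + conjc (z i1 0) * w i1 0
  - 'i%C * conjc (z i2 0) * w i0 0.
Proof.
rewrite /herm !mulmx3E !adjointE /hform !mx3E; cbv beta iota delta [nth nat_of_ord i0 i1 i2];
  rewrite -?complexiE; ring.
Qed.

Lemma herm_mul A (z w : 'cV[C]_3) : adjoint A *m h *m A = h ->
  herm (A *m z) (A *m w) = herm z w.
Proof. by move=> HA; rewrite /herm adjoint_mul -!mulmxA (mulmxA _ h) (mulmxA _ A) HA. Qed.

End Matrix3.

Ltac mx3simp := cbv beta iota delta [nth nat_of_ord i0 i1 i2]; rewrite -?complexiE.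

(** * The Maurer-Cartan derivative of maps into G *)

Section MaurerCartan.
Context {R : realType} {V : normedModType R}.
Local Notation C := R[i].
Local Notation h := (@hform R).
Implicit Types (U : set V) (v p : V) (A B : V -> 'M[C]_3).

Lemma smooth_mx3 U (f00 f01 f02 f10 f11 f12 f20 f21 f22 : V -> C) :
  smoothC U f00 -> smoothC U f01 -> smoothC U f02 ->
  smoothC U f10 -> smoothC U f11 -> smoothC U f12 ->
  smoothC U f20 -> smoothC U f21 -> smoothC U f22 ->
  smooth_mx U (fun p => mx3 [:: [:: f00 p; f01 p; f02 p];
    [:: f10 p; f11 p; f12 p]; [:: f20 p; f21 p; f22 p]]).
Proof.
move=> *; suff H i j : smoothC U (fun p => mx3 [:: [:: f00 p; f01 p; f02 p];
    [:: f10 p; f11 p; f12 p]; [:: f20 p; f21 p; f22 p]] i j) by exact: H.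
by under eq_fun do rewrite mx3E; move: i j; apply: ord3P; apply: ord3P.
Qed.

Lemma smooth_mx_ginv U A : open U -> smooth_mx U A -> smooth_mx U (fun p => ginv (A p)).
Proof.
move=> oU sA; apply: smooth_mx_mul => //; last exact: smooth_mx_cst.
by apply: smooth_mx_mul => //; [exact: smooth_mx_cst|exact: smooth_mx_adjoint].
Qed.

(* The derivative A^-1 dA(v) of a map into G. *)
Definition mc v A p : 'M[C]_3 := ginv (A p) *m DM v A p.

Lemma smooth_mc U v A : open U -> smooth_mx U A -> smooth_mx U (mc v A).
Proof.
by move=> oU sA; apply: smooth_mx_mul => //; [exact: smooth_mx_ginv|exact: smooth_mx_DM].
Qed.

Lemma DM_mc v A p : groupG (A p) -> DM v A p = A p *m mc v A p.
Proof. by move=> /groupG_ginv[_ E]; rewrite mulmxA E mul1mx. Qed.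

Lemma is_derM_mc U v A p : smooth_mx U A -> U p -> groupG (A p) ->
  is_derM p v A (A p *m mc v A p).
Proof. by move=> sA Up gA; rewrite -DM_mc//; exact: smooth_mx_is_derM sA Up. Qed.

(** The gauge transformation rule behind each normalization of a frame. *)
Lemma mc_mul U v A B p : smooth_mx U A -> smooth_mx U B -> U p ->
  groupG (A p) -> groupG (B p) ->
  mc v (fun q => A q *m B q) p = ginv (B p) *m (mc v A p *m B p + DM v B p).
Proof.
move=> sA sB Up gA gB; have [E _] := groupG_ginv gA.
rewrite {1}/mc (DM_val (is_derM_mul (smooth_mx_is_derM v sA Up)
  (smooth_mx_is_derM v sB Up))) ginv_mul -mulmxA; congr (_ *m _).
by rewrite mulmxDr /mc !mulmxA E mul1mx.
Qed.

(** Comes from differentiating the constant [adjoint A *m h *m A]. *)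
Lemma mc_skew U v A p : open U -> smooth_mx U A -> (forall q, U q -> groupG (A q)) ->
  U p -> adjoint (mc v A p) *m h + h *m mc v A p = 0.
Proof.
move=> oU sA gA Up; have dA := smooth_mx_is_derM v sA Up.
have d1 := is_derM_mul (is_derM_mul (is_derM_adjoint dA) (is_derM_cst p v h)) dA.
have d2 : is_derM p v (fun q => adjoint (A q) *m h *m A q) 0.
  apply: near_is_derM (is_derM_cst p v h).
  by apply: filterS (open_nbhs_nbhs (conj oU Up)) => q /gA[_ ->].
have := is_derM_unique d1 d2; rewrite mulmx0 addr0 => E.
rewrite /mc /ginv !adjoint_mul adjointK adjoint_hform -!mulmxA hformK mulmx1 !mulmxA.
by rewrite hformK mul1mx addrC -[RHS]E addrC.
Qed.

(** Jacobi's formula for the constant determinant 1, verified on the expanded 3 by 3 determinant. *)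
Lemma mc_tr U v A p : open U -> smooth_mx U A -> (forall q, U q -> groupG (A q)) ->
  U p -> \tr (mc v A p) = 0.
Proof.
move=> oU sA gA Up; have dA := is_derM_mc v sA Up (gA p Up).
have d1 : is_derC p v (fun q => \det (A q)) (\tr (mc v A p) * \det (A p)).
  under eq_fun do rewrite det3.
  eapply is_derC_eq; first by repeat first
    [apply: is_derCD | apply: is_derCN | apply: is_derCM | apply: dA].
  rewrite /=; move: (A p) (mc v A p) => X N; rewrite /mxtrace sum3 det3 !mulmx3E.
  move: (X i0 i0) (X i0 i1) (X i0 i2) (X i1 i0) (X i1 i1) (X i1 i2) (X i2 i0) (X i2 i1) (X i2 i2).
  move: (N i0 i0) (N i0 i1) (N i0 i2) (N i1 i0) (N i1 i1) (N i1 i2) (N i2 i0) (N i2 i1) (N i2 i2).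
  by move=> *; ring.
have d2 : is_derC p v (fun q => \det (A q)) 0.
  apply: near_is_derC (is_derC_cst p v 1).
  by apply: filterS (open_nbhs_nbhs (conj oU Up)) => q /gA[->].
by have := DC_val d1; rewrite (DC_val d2); have [-> _] := gA p Up; rewrite mulr1.
Qed.

Lemma is_derM_slice v n m (A : V -> 'M[C]_(m, n)) p (X : 'M[C]_(m, n)) :
  (\forall s \near (0 : R), A (s *: v + p) = X) -> is_derM p v A 0.
Proof.
move=> AX i j; rewrite mxE; split; apply/is_derive_dir.
  apply: (@near_eq_is_derive _ _ _ (cst (complex.Re (X i j)))).
  by apply: filterS AX => s ->.
apply: (@near_eq_is_derive _ _ _ (cst (complex.Im (X i j)))).
by apply: filterS AX => s ->.
Qed.

End MaurerCartan.

(** * One-parameter pieces of G and coordinates on its Lie algebra *)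

Section Gauge.
Context {R : realType}.
Local Notation C := R[i].
Local Notation h := (@hform R).
Local Notation I := ('i%C : C).
Implicit Types (z b al c : C) (N : 'M[C]_3).

(** The imaginary entry in the corner is forced by invariance of the form; its real part, a third
    parameter transverse to the contact directions, is set to 0. The two real parameters in [z]
    match the two real Euler-Lagrange equations. *)
Definition lowerG z : 'M[C]_3 :=
  mx3 [:: [:: 1; 0; 0]; [:: z; 1; 0]; [:: I * (z * conjc z / 2); I * conjc z; 1]].

(** Together with [diagG] and [centerG] this makes up the stabiliser of the line of e_1, so right
    multiplication by these factors keeps the line of the first column. *)
Definition upperG b : 'M[C]_3 :=
  mx3 [:: [:: 1; - (I * conjc b); - (I * (b * conjc b / 2))]; [:: 0; 1; b]; [:: 0; 0; 1]].

Definition diagG al : 'M[C]_3 :=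
  mx3 [:: [:: al; 0; 0]; [:: 0; conjc al / al; 0]; [:: 0; 0; (conjc al)^-1]].

Definition centerG c : 'M[C]_3 :=
  mx3 [:: [:: 1; 0; c]; [:: 0; 1; 0]; [:: 0; 0; 1]].

Lemma conjc_i : conjc I = - I.
Proof. by apply/eqP; rewrite eq_complex /= oppr0 !eqxx. Qed.

Lemma II : I * I = -1.
Proof. by rewrite -expr2 sqr_i. Qed.

Lemma conjcM z w : conjc (z * w) = conjc z * conjc w.
Proof. exact: rmorphM. Qed.

Lemma conjcD z w : conjc (z + w) = conjc z + conjc w.
Proof. exact: rmorphD. Qed.

Lemma conjcN z : conjc (- z) = - conjc z.
Proof. exact: rmorphN. Qed.

Definition conjE := (conjcM, conjcD, conjcN, @conjcK, conjc_i, @conjc_inv,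
  @conjc_nat, @conjc0, @conjc1, @conjc_real).

Lemma lowerG_G z : groupG (lowerG z).
Proof.
split; first by rewrite det3 !mx3E; mx3simp; ring.
by apply: eq_mx3; rewrite !mulmx3E !adjointE !mx3E; mx3simp;
  rewrite ?conjE; have hI := II; field: hI.
Qed.

Lemma upperG_G b : groupG (upperG b).
Proof.
split; first by rewrite det3 !mx3E; mx3simp; ring.
by apply: eq_mx3; rewrite !mulmx3E !adjointE !mx3E; mx3simp;
  rewrite ?conjE; have hI := II; field: hI.
Qed.

Lemma diagG_G al : al != 0 -> groupG (diagG al).
Proof.
move=> a0; have c0 : conjc al != 0 by rewrite conjc_eq0.
split; first by rewrite det3 !mx3E; mx3simp; field; rewrite a0 c0.
by apply: eq_mx3; rewrite !mulmx3E !adjointE !mx3E; mx3simp;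
  rewrite ?conjE; field; rewrite ?a0 ?c0.
Qed.

Lemma centerG_G c : conjc c = c -> groupG (centerG c).
Proof.
move=> cc; split; first by rewrite det3 !mx3E; mx3simp; ring.
by apply: eq_mx3; rewrite !mulmx3E !adjointE !mx3E; mx3simp;
  rewrite ?conjE ?cc; ring.
Qed.

(** Coordinates on the Lie algebra. Each relation is one entry of the hypothesis, conjugated in one
    case, times a unit; that unit is the constant handed to [lin]. *)
Lemma skew_form N : adjoint N *m h + h *m N = 0 ->
  [/\ conjc (N i2 i0) = N i2 i0, N i2 i1 = I * conjc (N i1 i0),
      N i2 i2 = - conjc (N i0 i0) & N i0 i1 = - (I * conjc (N i1 i2)) /\
      conjc (N i0 i2) = N i0 i2].
Proof.
move=> E; have e i j : (adjoint N *m h + h *m N) i j = 0 by rewrite E mxE.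
have hI := II.
move: (e i0 i0) (e i0 i1) (e i0 i2) (e i1 i2) (e i2 i2).
rewrite !mxE !sum3 !adjointE !mx3E; mx3simp => e00 e01 e02 e12 e22.
have lin c l x y : l = 0 -> x - y = c * l -> x = y.
  by move=> ->; rewrite mulr0 => /subr0_eq.
split; [| | |split].
- by apply: (lin I _ _ _ e00); ring: hI.
- by apply: (lin (- I) _ _ _ e01); ring: hI.
- by apply: (lin (- I) _ _ _ e02); ring: hI.
- have := congr1 (@conjc R) e12; rewrite conjc0 => e12'.
  by apply: (lin I _ _ _ e12'); rewrite !conjE; ring: hI.
- by apply: (lin (- I) _ _ _ e22); ring: hI.
Qed.

Lemma ginv_upperG b : ginv (upperG b) = upperG (- b).
Proof.
by apply: eq_mx3; rewrite !mulmx3E !adjointE !mx3E; mx3simp;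
  rewrite ?conjE; have hI := II; field: hI.
Qed.

Lemma ginv_diagG al : al != 0 -> ginv (diagG al) = diagG al^-1.
Proof.
move=> a0; have c0 : conjc al != 0 by rewrite conjc_eq0.
by apply: eq_mx3; rewrite !mulmx3E !adjointE !mx3E; mx3simp;
  rewrite ?conjE; have hI := II; field: hI; rewrite ?a0 ?c0.
Qed.

Lemma ginv_centerG c : conjc c = c -> ginv (centerG c) = centerG (- c).
Proof.
move=> cc; apply: eq_mx3; rewrite !mulmx3E !adjointE !mx3E; mx3simp;
  rewrite ?conjE ?cc; have hI := II; ring: hI.
Qed.

(** A dimension count: the Lie algebra has real dimension 8, and the conditions on the entries (1,
    0), (1, 2) and (0, 0) remove 2 + 2 + 1. What is left are the strain, the bending and the twist,
    read off from the entries (2, 0), (0, 0) and (0, 2). *)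
Lemma wilczynski_form N : adjoint N *m h + h *m N = 0 -> \tr N = 0 ->
  N i1 i0 = 0 -> N i1 i2 = N i2 i0 -> complex.Re (N i0 i0) = 0 ->
  complex.Re (N i2 i0) != 0 ->
  N = (complex.Re (N i2 i0))%:C *:
    wilczynski_mx (complex.Im (N i0 i0) / complex.Re (N i2 i0))
      (complex.Re (N i0 i2) / complex.Re (N i2 i0)).
Proof.
move=> /skew_form[r20 e21 e22 [e01 r02]]; rewrite /mxtrace sum3 => tr0 n10 n12 re0 a0.
have real z : conjc z = z -> z = (complex.Re z)%:C.
  case: z => a b [] /eqP; rewrite eq_sym -subr_eq0 opprK -mulr2n mulrn_eq0 /= => /eqP -> //.
have k00 : N i0 i0 = I * (complex.Im (N i0 i0))%:C.
  by rewrite [LHS]complexE re0 add0r.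
move: k00; set k := (complex.Im (N i0 i0))%:C => k00.
have aC : (complex.Re (N i2 i0))%:C != 0 by rewrite eq_complex /= eqxx andbT.
move: aC (real _ r20) (real _ r02) => aC a20 t02.
have k22 : N i2 i2 = N i0 i0 by rewrite e22 k00 /k !conjE; ring.
have k11 : N i1 i1 = - (2 * I * k).
  by apply: subr0_eq; rewrite -tr0 k22 k00; ring.
apply: eq_mx3; rewrite !mxE; mx3simp; rewrite ?rmorphM ?fmorphV /= -?complexiE -/k.
- by rewrite [LHS]k00; field.
- by rewrite e01 n12 r20 a20 /=; ring.
- by rewrite t02 /=; field.
- by rewrite n10 mulr0.
- by rewrite k11; field.
- by rewrite n12 mulr1.
- by rewrite mulr1.
- by rewrite e21 n10 conjc0 !mulr0.
- by rewrite k22 [LHS]k00; field.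
Qed.

End Gauge.

(** * Derivatives depend only on values along a line *)

Section Slices.
Context {R : realType} {V : normedModType R}.
Local Notation C := R[i].
Implicit Types (v p : V).

Lemma derive_slice (f g : V -> R) v p :
  (\forall s \near (0 : R), f (s *: v + p) = g (s *: v + p)) ->
  'D_v f p = 'D_v g p.
Proof.
have E (k : V -> R) : 'D_v k p = 'D_1 (fun s : R => k (s *: v + p)) 0.
  rewrite /derive (_ : (fun h : R => h^-1 *: ((k \o shift p) (h *: v) - k p)) =
    (fun h => h^-1 *: (((fun s : R => k (s *: v + p)) \o shift 0) (h *: 1) -
      k (0 *: v + p))))//.
  by apply/funext => s /=; rewrite addr0 [s *: 1]mulr1 scale0r add0r.
by move=> fg; rewrite !E; exact: near_eq_derive.
Qed.

Lemma DM_slice v p m n (A B : V -> 'M[C]_(m, n)) :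
  (\forall s \near (0 : R), A (s *: v + p) = B (s *: v + p)) -> DM v A p = DM v B p.
Proof.
move=> AB; apply/matrixP => i j; rewrite !mxE; congr (_ +i* _); apply: derive_slice;
  by apply: filterS AB => s ->.
Qed.

Lemma mc_slice v p (A B : V -> 'M[C]_3) :
  (\forall s \near (0 : R), A (s *: v + p) = B (s *: v + p)) -> mc v A p = mc v B p.
Proof.
move=> AB; have -> : mc v A p = ginv (B p) *m DM v A p; last by rewrite (DM_slice AB).
have E : A p = B p; last by rewrite /mc E.
by have := nbhs_singleton AB; rewrite scale0r add0r.
Qed.

End Slices.

(** * Reduction of a frame to Wilczynski form *)

Section Reduction.
Context {R : realType} {V : normedModType R} (v : V).
Local Notation C := R[i].
Implicit Types (U : set V) (p : V) (A : V -> 'M[C]_3).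

(* The three corrections bring A^-1 dA(v) to Wilczynski form: they make the entry
   (1, 0) vanish, the entries (2, 0) and (1, 2) equal and positive, and the entry
   (0, 0) purely imaginary. *)
Definition upper_step A p :=
  A p *m upperG (mc v A p i1 i0 / mc v A p i2 i0).

Definition diag_step A p :=
  A p *m diagG (conjc (cbrt (mc v A p i1 i2 / mc v A p i2 i0))).

Definition center_step A p :=
  A p *m centerG (complex.Re (mc v A p i0 i0) / complex.Re (mc v A p i2 i0))%:C.

Lemma smooth_upperG U (b : V -> C) : open U -> smoothC U b ->
  smooth_mx U (fun p => upperG (b p)).
Proof.
move=> oU sb; have s0 := @smoothC_cst R V U 0; have s1 := @smoothC_cst R V U 1.
have sc := smoothC_conj oU sb.
apply: smooth_mx3 => //.
  by apply: smoothCN => //; apply: smoothCM => //; exact: smoothC_cst.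
apply: smoothCN => //; apply: smoothCM => //; first exact: smoothC_cst.
by apply: smoothCM => //; [exact: smoothCM|exact: smoothC_cst].
Qed.

Lemma smooth_diagG U (al : V -> C) : open U -> smoothC U al ->
  (forall p, U p -> al p != 0) -> smooth_mx U (fun p => diagG (al p)).
Proof.
move=> oU sa a0; have s0 := @smoothC_cst R V U 0.
have sc := smoothC_conj oU sa.
apply: smooth_mx3 => //.
  by apply: smoothCM => //; exact: smoothC_inv.
by apply: smoothC_inv => // p Up; rewrite conjc_eq0 a0.
Qed.

Lemma smooth_centerG U (c : V -> C) : open U -> smoothC U c ->
  smooth_mx U (fun p => centerG (c p)).
Proof.
move=> oU sa; have s0 := @smoothC_cst R V U 0; have s1 := @smoothC_cst R V U 1.
exact: smooth_mx3.
Qed.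

Lemma addmx3E (X Y : 'M[C]_3) i j : (X + Y) i j = X i j + Y i j.
Proof. by rewrite mxE. Qed.

(** Here and in the next two lemmas [D] stands for the derivative of the gauge factor. It vanishes
    at the places that matter, because the gauge factor is constant there. *)
Lemma upperG_conj (N D : 'M[C]_3) b : D i1 i0 = 0 -> D i2 i0 = 0 ->
  (upperG (- b) *m (N *m upperG b + D)) i1 i0 = N i1 i0 - b * N i2 i0 /\
  (upperG (- b) *m (N *m upperG b + D)) i2 i0 = N i2 i0.
Proof.
move=> d10 d20; rewrite !mulmx3E !addmx3E !mulmx3E d10 d20 /upperG !mx3E; mx3simp.
by split; ring.
Qed.

(** Conjugation scales the entry (1, 2) by [al / conjc al ^+ 2] and the entry (2, 0) by
    [al * conjc al]. Making the two equal prescribes the cube of [conjc al], which is the origin of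
    the cube root. *)
Lemma diagG_conj (N D : 'M[C]_3) al : al != 0 -> D i1 i0 = 0 -> D i2 i0 = 0 ->
  D i1 i2 = 0 -> N i1 i0 = 0 -> N i1 i2 = N i2 i0 * conjc al ^+ 3 ->
  [/\ (diagG al^-1 *m (N *m diagG al + D)) i1 i0 = 0,
    (diagG al^-1 *m (N *m diagG al + D)) i2 i0 = N i2 i0 * (al * conjc al) &
    (diagG al^-1 *m (N *m diagG al + D)) i1 i2 = N i2 i0 * (al * conjc al)].
Proof.
move=> a0 d10 d20 d12 n10 n12; have c0 : conjc al != 0 by rewrite conjc_eq0.
rewrite !mulmx3E !addmx3E !mulmx3E d10 d20 d12 n10 n12 /diagG !mx3E; mx3simp.
by rewrite ?conjE; split; field; rewrite ?a0 ?c0.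
Qed.

(** For elements of G both [c] and the entry (2, 0) are real, so the shift can remove exactly the
    real part of the entry (0, 0). *)
Lemma centerG_conj (N D : 'M[C]_3) c : D i1 i0 = 0 -> D i2 i0 = 0 ->
  D i1 i2 = 0 -> D i0 i0 = 0 -> N i1 i0 = 0 -> N i1 i2 = N i2 i0 ->
  [/\ (centerG (- c) *m (N *m centerG c + D)) i1 i0 = 0,
    (centerG (- c) *m (N *m centerG c + D)) i2 i0 = N i2 i0,
    (centerG (- c) *m (N *m centerG c + D)) i1 i2 = N i2 i0 &
    (centerG (- c) *m (N *m centerG c + D)) i0 i0 = N i0 i0 - c * N i2 i0].
Proof.
move=> d10 d20 d12 d00 n10 n12.
rewrite !mulmx3E !addmx3E !mulmx3E d10 d20 d12 d00 n10 n12 /centerG !mx3E; mx3simp.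
by split; ring.
Qed.

Lemma DM_const_entry (B : V -> 'M[C]_3) p i j :
  (forall q, B q i j = B p i j) -> DM v B p i j = 0.
Proof.
move=> Bc; have -> : DM v B p i j = DC v (fun q => B q i j) p by rewrite mxE.
by under eq_fun do rewrite Bc; exact: DC_val (is_derC_cst _ _ _).
Qed.

Lemma mc_upperG U A (b : V -> C) p : open U -> smooth_mx U A -> groupG (A p) ->
  smoothC U b -> U p ->
  mc v (fun q => A q *m upperG (b q)) p i1 i0 = mc v A p i1 i0 - b p * mc v A p i2 i0 /\
  mc v (fun q => A q *m upperG (b q)) p i2 i0 = mc v A p i2 i0.
Proof.
move=> oU sA gA sb Up.
rewrite (mc_mul _ sA (smooth_upperG oU sb) Up gA (upperG_G _)) ginv_upperG.
by apply: upperG_conj; apply: DM_const_entry => q; rewrite !mx3E.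
Qed.

Lemma mc_diagG U A (al : V -> C) p : open U -> smooth_mx U A -> groupG (A p) ->
  smoothC U al -> (forall q, U q -> al q != 0) -> U p -> mc v A p i1 i0 = 0 ->
  mc v A p i1 i2 = mc v A p i2 i0 * conjc (al p) ^+ 3 ->
  [/\ mc v (fun q => A q *m diagG (al q)) p i1 i0 = 0,
    mc v (fun q => A q *m diagG (al q)) p i2 i0 = mc v A p i2 i0 * (al p * conjc (al p)) &
    mc v (fun q => A q *m diagG (al q)) p i1 i2 = mc v A p i2 i0 * (al p * conjc (al p))].
Proof.
move=> oU sA gA sa a0 Up n10 n12; have a1 := a0 p Up.
rewrite (mc_mul _ sA (smooth_diagG oU sa a0) Up gA (diagG_G a1)) ginv_diagG//.
by apply: diagG_conj => //; apply: DM_const_entry => q; rewrite !mx3E.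
Qed.

Lemma mc_centerG U A (c : V -> R) p : open U -> smooth_mx U A -> groupG (A p) ->
  smooth U c -> U p -> mc v A p i1 i0 = 0 -> mc v A p i1 i2 = mc v A p i2 i0 ->
  [/\ mc v (fun q => A q *m centerG (c q)%:C) p i1 i0 = 0,
    mc v (fun q => A q *m centerG (c q)%:C) p i2 i0 = mc v A p i2 i0,
    mc v (fun q => A q *m centerG (c q)%:C) p i1 i2 = mc v A p i2 i0 &
    mc v (fun q => A q *m centerG (c q)%:C) p i0 i0 =
      mc v A p i0 i0 - (c p)%:C * mc v A p i2 i0].
Proof.
move=> oU sA gA sc Up n10 n12; have cc := conjc_real (c p).
rewrite (mc_mul _ sA (smooth_centerG oU (smoothC_real sc)) Up gA (centerG_G cc)).
rewrite ginv_centerG//.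
by apply: centerG_conj => //; apply: DM_const_entry => q; rewrite !mx3E.
Qed.

Lemma upper_stepP U A : open U -> smooth_mx U A -> (forall p, U p -> groupG (A p)) ->
  (forall p, U p -> mc v A p i2 i0 != 0) ->
  [/\ smooth_mx U (upper_step A), forall p, U p -> groupG (upper_step A p),
      forall p, U p -> mc v (upper_step A) p i1 i0 = 0 &
      forall p, U p -> mc v (upper_step A) p i2 i0 = mc v A p i2 i0].
Proof.
move=> oU sA gA n0; have sN := smooth_mc v oU sA.
pose b p := mc v A p i1 i0 / mc v A p i2 i0.
have sb : smoothC U b.
  apply: (smoothCM oU (sN i1 i0)); exact: (smoothC_inv oU n0 (sN i2 i0)).
have E p : U p -> mc v (upper_step A) p i1 i0 = mc v A p i1 i0 - b p * mc v A p i2 i0 /\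
    mc v (upper_step A) p i2 i0 = mc v A p i2 i0.
  by move=> Up; exact: (mc_upperG oU sA (gA p Up) sb Up).
split.
- exact: (smooth_mx_mul oU sA (smooth_upperG oU sb)).
- by move=> p Up; exact: (groupG_mul (gA p Up) (upperG_G _)).
- by move=> p Up; have [-> _] := E p Up; rewrite /b divfK ?subrr// n0.
- by move=> p Up; have [_ ->] := E p Up.
Qed.

Lemma mc_real U A p : open U -> smooth_mx U A -> (forall p, U p -> groupG (A p)) ->
  U p -> mc v A p i2 i0 = (complex.Re (mc v A p i2 i0))%:C.
Proof.
move=> oU sA gA Up; have [+ _ _ _] := skew_form (mc_skew v oU sA gA Up).
case: (mc v A p i2 i0) => a b [] /eqP; rewrite eq_sym -subr_eq0 opprK -mulr2n mulrn_eq0 /=.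
by move=> /eqP ->.
Qed.

Lemma cbrt_neq0 (z : C) : 0 < complex.Re z -> cbrt z != 0.
Proof.
move=> z0; apply/negP => /eqP c0; move: (cbrt_cube z0); rewrite c0 expr0n /= => zE.
by move: z0; rewrite -zE ltxx.
Qed.

Lemma mulcJ_gt0 (x : R) (z : C) : 0 < x -> z != 0 ->
  0 < complex.Re (x%:C * (z * conjc z)).
Proof.
move=> x0; case: z => a b; rewrite eq_complex /= => ab.
rewrite !mul0r subr0 mulrN opprK mulr_gt0// -!expr2.
by rewrite lt_neqAle addr_ge0 ?sqr_ge0// andbT eq_sym paddr_eq0 ?sqr_ge0// !sqrf_eq0.
Qed.

Lemma diag_stepP U A : open U -> smooth_mx U A -> (forall p, U p -> groupG (A p)) ->
  (forall p, U p -> mc v A p i1 i0 = 0) ->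
  (forall p, U p -> 0 < complex.Re (mc v A p i2 i0)) ->
  (forall p, U p -> 0 < complex.Re (mc v A p i1 i2 / mc v A p i2 i0)) ->
  [/\ smooth_mx U (diag_step A), forall p, U p -> groupG (diag_step A p),
      forall p, U p -> mc v (diag_step A) p i1 i0 = 0,
      forall p, U p -> 0 < complex.Re (mc v (diag_step A) p i2 i0) &
      forall p, U p -> mc v (diag_step A) p i1 i2 = mc v (diag_step A) p i2 i0].
Proof.
move=> oU sA gA n10 a0 u0; have sN := smooth_mc v oU sA.
have n20 p : U p -> mc v A p i2 i0 != 0.
  by move=> Up; rewrite (mc_real oU sA gA Up) eq_complex /= eqxx andbT gt_eqF// a0.
pose al p := conjc (cbrt (mc v A p i1 i2 / mc v A p i2 i0)).
have al0 p : U p -> al p != 0 by move=> Up; rewrite conjc_eq0 cbrt_neq0// u0.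
have sal : smoothC U al.
  apply: (smoothC_conj oU); apply: (smoothC_cbrt oU u0).
  apply: (smoothCM oU (sN i1 i2)); exact: (smoothC_inv oU n20 (sN i2 i0)).
have E p : U p -> [/\ mc v (diag_step A) p i1 i0 = 0,
    mc v (diag_step A) p i2 i0 = mc v A p i2 i0 * (al p * conjc (al p)) &
    mc v (diag_step A) p i1 i2 = mc v A p i2 i0 * (al p * conjc (al p))].
  move=> Up; apply: (mc_diagG oU sA (gA p Up) sal al0 Up (n10 p Up)).
  by rewrite /al conjcK cbrt_cube ?u0// mulrC divfK// n20.
split.
- exact: (smooth_mx_mul oU sA (smooth_diagG oU sal al0)).
- by move=> p Up; exact: (groupG_mul (gA p Up) (diagG_G (al0 p Up))).
- by move=> p Up; have [-> _ _] := E p Up.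
- move=> p Up; have [_ -> _] := E p Up; rewrite (mc_real oU sA gA Up).
  exact: (mulcJ_gt0 (a0 p Up) (al0 p Up)).
- by move=> p Up; have [_ -> ->] := E p Up.
Qed.

Lemma center_stepP U A : open U -> smooth_mx U A -> (forall p, U p -> groupG (A p)) ->
  (forall p, U p -> mc v A p i1 i0 = 0) ->
  (forall p, U p -> 0 < complex.Re (mc v A p i2 i0)) ->
  (forall p, U p -> mc v A p i1 i2 = mc v A p i2 i0) ->
  [/\ smooth_mx U (center_step A), forall p, U p -> groupG (center_step A p),
      forall p, U p -> 0 < complex.Re (mc v (center_step A) p i2 i0) &
      forall p, U p -> mc v (center_step A) p =
        (complex.Re (mc v (center_step A) p i2 i0))%:C *:
        wilczynski_mx (complex.Im (mc v (center_step A) p i0 i0) /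
                       complex.Re (mc v (center_step A) p i2 i0))
                      (complex.Re (mc v (center_step A) p i0 i2) /
                       complex.Re (mc v (center_step A) p i2 i0))].
Proof.
move=> oU sA gA n10 a0 n12; have sN := smooth_mc v oU sA.
pose c p := complex.Re (mc v A p i0 i0) / complex.Re (mc v A p i2 i0).
have sc : smooth U c.
  apply: (smoothM oU); first by case: (sN i0 i0).
  apply: (smooth_comp oU _ smooth_inv); last by case: (sN i2 i0).
  by move=> p Up /=; rewrite gt_eqF// a0.
have E p : U p -> [/\ mc v (center_step A) p i1 i0 = 0,
    mc v (center_step A) p i2 i0 = mc v A p i2 i0,
    mc v (center_step A) p i1 i2 = mc v A p i2 i0 &
    mc v (center_step A) p i0 i0 = mc v A p i0 i0 - (c p)%:C * mc v A p i2 i0].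
  by move=> Up; exact: (mc_centerG oU sA (gA p Up) sc Up (n10 p Up) (n12 p Up)).
have s3 : smooth_mx U (center_step A).
  exact: (smooth_mx_mul oU sA (smooth_centerG oU (smoothC_real sc))).
have g3 p : U p -> groupG (center_step A p).
  by move=> Up; exact: (groupG_mul (gA p Up) (centerG_G (conjc_real (c p)))).
split; [exact: s3|exact: g3| |].
  by move=> p Up; have [_ -> _ _] := E p Up; exact: a0.
move=> p Up; have [E10 E20 E12 E00] := E p Up.
apply: wilczynski_form.
- exact: (mc_skew v oU s3 g3 Up).
- exact: (mc_tr v oU s3 g3 Up).
- exact: E10.
- by rewrite E12 -E20.
- rewrite E00 (mc_real oU sA gA Up) Re_add Re_opp Re_mul /= mul0r subr0 /c divfK ?subrr//.
  by rewrite gt_eqF// a0.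
- by rewrite E20 gt_eqF// a0.
Qed.

Definition reduce A := center_step (diag_step (upper_step A)).

(** Where the structure matrix is already that of the natural parameter, the three corrections have
    parameters 0, 1 and 0. The condition on [Z] allows the structure matrix to be recomputed after
    each of them, along lines that stay in [Z]. *)
Lemma reduce_slice (Z : set V) A (k t : V -> R) :
  (forall p, Z p -> \forall s \near (0 : R), Z (s *: v + p)) ->
  (forall p, Z p -> mc v A p = wilczynski_mx (k p) (t p)) ->
  (forall p, Z p -> reduce A p = A p).
Proof.
move=> sZ E.
(* A correction that is trivial on [Z] also leaves the structure matrix unchanged there, which is
   the hypothesis for the next correction. *)
have one (B : V -> 'M[C]_3) (step : (V -> 'M[C]_3) -> V -> 'M[C]_3) :
    (forall p, Z p -> mc v B p = wilczynski_mx (k p) (t p) -> step B p = B p) ->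
    (forall p, Z p -> mc v B p = wilczynski_mx (k p) (t p)) ->
    (forall p, Z p -> step B p = B p) /\
    (forall p, Z p -> mc v (step B) p = wilczynski_mx (k p) (t p)).
  move=> H HB; have H' p : Z p -> step B p = B p by move=> Zp; apply: H => //; exact: HB.
  split=> // p Zp; rewrite -HB//; apply: mc_slice.
  by apply: filterS (sZ p Zp) => s; exact: H'.
have [u1 u2] : (forall p, Z p -> upper_step A p = A p) /\
    (forall p, Z p -> mc v (upper_step A) p = wilczynski_mx (k p) (t p)).
  apply: (one A upper_step) => // p Zp Ep.
  rewrite /upper_step Ep !mx3E; mx3simp; rewrite mul0r.
  rewrite (_ : upperG 0 = 1%:M) ?mulmx1//.
  by apply: eq_mx3; rewrite !mxE /= ?conjc0 ?(mul0r, mulr0, oppr0).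
have [d1 d2] : (forall p, Z p -> diag_step (upper_step A) p = upper_step A p) /\
    (forall p, Z p -> mc v (diag_step (upper_step A)) p = wilczynski_mx (k p) (t p)).
  apply: (one (upper_step A) diag_step) => // p Zp Ep.
  rewrite /diag_step Ep !mx3E; mx3simp; rewrite divr1 cbrt1 conjc1.
  rewrite (_ : diagG 1 = 1%:M) ?mulmx1//.
  by apply: eq_mx3; rewrite !mx3E [RHS]mxE; mx3simp; rewrite ?conjc1 ?invr1 ?divr1 ?mulr1.
move=> p Zp; rewrite -[RHS]u1// -[RHS]d1// /reduce {1}/center_step d2// !mx3E; mx3simp.
rewrite Re_mul /= mul0r mul1r subrr mul0r.
rewrite (_ : centerG 0 = 1%:M) ?mulmx1//.
by apply: eq_mx3; rewrite !mxE.
Qed.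

End Reduction.

(** * The plane of the variation parameter e and the curve parameter t *)

Section Plane.
Context {R : realType}.
Local Notation C := R[i].
Local Notation vt := ((0, 1) : R * R).

Lemma smooth_snd (J : set R) (f : R -> R) : smooth J f ->
  smooth [set p : R * R | J p.2] (fun p => f p.2).
Proof.
move=> sf k; apply: (Ck_affine (A := snd) (A0 := snd) (U := J)) (sf k) => //.
by move=> p; exact: cvg_snd.
Qed.

Lemma smooth_fst (U : set (R * R)) : smooth U (fun p => p.1).
Proof.
move=> k; apply: (@Ck_subset _ _ _ (fst @^-1` setT)) => //.
apply: (Ck_affine (A := fst) (A0 := fst) (U := setT) (f := id)) => //.
  by move=> p; exact: cvg_fst.
exact: smooth_id.
Qed.

Lemma pair_continuous (e : R) : continuous (fun t : R => (e, t)).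
Proof.
move=> t A [[P Q] /= [Pe Qt] PQ]; apply: filterS Qt => t' Qt'.
by apply: (PQ (e, t')); split=> //=; exact: nbhs_singleton.
Qed.

Lemma slice_affine (e p v s : R) :
  (e, s *: v + p) = s *: ((0, v) : R * R) + (e, p).
Proof. by congr pair; rewrite /= scaler0 add0r. Qed.

Lemma smooth_slice (U : set (R * R)) e (f : R * R -> R) : smooth U f ->
  smooth [set t | U (e, t)] (fun t => f (e, t)).
Proof.
move=> sf k; apply: (Ck_affine (A := fun t => (e, t)) (A0 := fun v => (0, v)) (U := U)) (sf k).
  exact: pair_continuous.
by move=> p v s; exact: slice_affine.
Qed.

Lemma smooth_mx_snd (J : set R) m n (A : R -> 'M[C]_(m, n)) : smooth_mx J A ->
  smooth_mx [set p : R * R | J p.2] (fun p => A p.2).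
Proof.
move=> sA i j; have [sr si] := sA i j.
by split; [exact: (smooth_snd sr)|exact: (smooth_snd si)].
Qed.

Lemma smooth_mx_slice (U : set (R * R)) e m n (A : R * R -> 'M[C]_(m, n)) :
  smooth_mx U A -> smooth_mx [set t | U (e, t)] (fun t => A (e, t)).
Proof.
move=> sA i j; have [sr si] := sA i j.
by split; [exact: (smooth_slice e sr)|exact: (smooth_slice e si)].
Qed.

Lemma DM_snd m n (A : R -> 'M[C]_(m, n)) (v p : R * R) :
  DM v (fun p => A p.2) p = DM v.2 A p.2.
Proof.
by apply/matrixP => i j; rewrite !mxE; congr (_ +i* _);
  exact: (derive_affine (A := snd) (A0 := snd)).
Qed.

Lemma DM_slice_eq e m n (A : R * R -> 'M[C]_(m, n)) (t : R) :
  DM (1 : R) (fun t => A (e, t)) t = DM vt A (e, t).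
Proof.
apply/matrixP => i j; rewrite !mxE; congr (_ +i* _).
  apply: (derive_affine (A := fun t => (e, t)) (A0 := fun v => (0, v))
    (fun p => complex.Re (A p i j))).
  by move=> p v s; exact: slice_affine.
apply: (derive_affine (A := fun t => (e, t)) (A0 := fun v => (0, v))
  (fun p => complex.Im (A p i j))).
by move=> p v s; exact: slice_affine.
Qed.

Lemma open_strip (J : set R) d : open J ->
  open [set p : R * R | - d < p.1 < d /\ J p.2].
Proof.
move=> oJ.
have -> : [set p : R * R | - d < p.1 < d /\ J p.2] =
    (fst @^-1` [set e | - d < e < d]) `&` (snd @^-1` J) by [].
apply: openI.
  apply: open_comp; first by move=> p _; exact: cvg_fst.
  have -> : [set e : R | - d < e < d] = [set e | - d < e] `&` [set e | e < d].
    by apply/seteqP; split=> e /= => [/andP[]|[-> ->]].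
  by apply: openI; [exact: open_gt|exact: open_lt].
by apply: open_comp => // p _; exact: cvg_snd.
Qed.

Lemma open_snd (J : set R) : open J -> open [set p : R * R | J p.2].
Proof. by move=> oJ; apply: open_comp => // p _; exact: cvg_snd. Qed.

End Plane.

(** * From a frame in G to a Wilczynski lift *)

Section Frames.
Context {R : realType}.
Local Notation C := R[i].
Local Notation I := ('i%C : C).

Lemma ord3_0 : (0 : 'I_3) = i0.
Proof. exact: val_inj. Qed.

Lemma columns3_mul (A : 'M[C]_3) (u v w : 'cV[C]_3) :
  columns3 (A *m u) (A *m v) (A *m w) = A *m columns3 u v w.
Proof.
by apply/matrixP; apply: ord3P; apply: ord3P; rewrite mulmx3E !mxE !sum3; mx3simp; ring.
Qed.

Lemma col3E (x y z : C) : [/\ col3 x y z i0 0 = x, col3 x y z i1 0 = y & col3 x y z i2 0 = z].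
Proof. by rewrite /col3 !mxE. Qed.

Lemma smooth_col3 (V : normedModType R) (U : set V) (f g k : V -> C) :
  smoothC U f -> smoothC U g -> smoothC U k -> smooth_mx U (fun p => col3 (f p) (g p) (k p)).
Proof.
move=> sf sg sk; suff H i j : smoothC U (fun p => col3 (f p) (g p) (k p) i j) by exact: H.
by under eq_fun do rewrite mxE; move: i; apply: ord3P.
Qed.

Lemma is_derM_col3 (V : normedModType R) (x v : V) (f g k : V -> C) df dg dk :
  is_derC x v f df -> is_derC x v g dg -> is_derC x v k dk ->
  is_derM x v (fun p => col3 (f p) (g p) (k p)) (col3 df dg dk).
Proof.
move=> sf sg sk i j; under eq_fun do rewrite mxE; rewrite mxE.
by move: i; apply: ord3P.
Qed.

Lemma zeta_gt0 (z w : 'cV[C]_3) (a : R) : 0 < a -> z != 0 -> herm z w = I * (a^-1)%:C ->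
  0 < zeta z w.
Proof.
move=> a0 z0 hE; rewrite /zeta hE.
have -> : - 'i * (I * (a^-1)%:C) = (a^-1)%:C.
  by rewrite -complexiE; have hI := II (R := R); ring: hI.
have sq (x : C) : conjc x * x = (complex.Re x ^+ 2 + complex.Im x ^+ 2)%:C.
  by case: x => c d; apply/eqP; rewrite eq_complex /=; apply/andP; split; apply/eqP; ring.
rewrite mulmx3E !adjointE !sq -!rmorphD /= -fmorphV -rmorphM /= ltcR.
rewrite mulr_gt0 ?invr_gt0//.
rewrite lt_neqAle !addr_ge0 ?sqr_ge0// andbT eq_sym; apply: contra z0.
rewrite !paddr_eq0 ?addr_ge0 ?sqr_ge0// !sqrf_eq0.
move=> /andP[/andP[/andP[a1 a2] /andP[b1 b2]] /andP[c1 c2]].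
have e0 (x : C) : complex.Re x == 0 -> complex.Im x == 0 -> x = 0.
  by case: x => c d /= /eqP -> /eqP ->.
apply/eqP/matrixP => i j; rewrite !ord1 mxE; move: i; apply: ord3P; exact: e0.
Qed.

(** Computed in the coordinates of the moving frame: differentiating [Fr *m u] acts on [u] as the
    structure matrix plus the derivative. Elements of G preserve [herm] and have determinant 1, so
    the frame drops out of every claim. *)
Lemma frame_lift (J : set R) (Fr : R -> 'M[C]_3) (a k t : R -> R) : open J ->
  smooth_mx J Fr -> (forall s, J s -> groupG (Fr s)) -> smooth J a -> smooth J k ->
  (forall s, J s -> 0 < a s) ->
  (forall s, J s -> mc (1 : R) Fr s = (a s)%:C *: wilczynski_mx (k s) (t s)) ->
  let Gam s : 'cV[C]_3 := ((a s)^-1)%:C *: col 0 (Fr s) in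
  [/\ smooth_mx J Gam, forall s, J s -> Gam s != 0,
    forall s, J s -> herm (Gam s) (Gam s) = 0,
    forall s, J s -> herm (Gam s) (entrywise_deriv Gam s) = I * ((a s)^-1)%:C &
    forall s, J s -> det_jet Gam s = -1].
Proof.
move=> oJ sF gF sa sk a0 EF Gam.
have sa1 : smooth J (fun s => (a s)^-1).
  by apply: (smooth_comp oJ _ smooth_inv sa) => s Js /=; rewrite gt_eqF// a0.
pose u s : 'cV[C]_3 := col3 ((a s)^-1)%:C 0 0.
have GE s : Gam s = Fr s *m u s.
  apply/matrixP => i j; rewrite ord1 /Gam mulmx3E; have [-> -> ->] := col3E ((a s)^-1)%:C 0 0.
  by rewrite !mxE ord3_0; ring.
have su : smooth_mx J u.
  by apply: smooth_col3; [exact: smoothC_real|exact: smoothC_cst|exact: smoothC_cst].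
have aC s : J s -> (a s)%:C != 0 by move=> Js; rewrite eq_complex /= eqxx andbT gt_eqF// a0.
have sG : smooth_mx J Gam.
  apply: (eq_smooth_mx (A := fun s => Fr s *m u s)) => //.
  exact: (smooth_mx_mul oJ sF su).
(* Coordinates of the derivative: the structure matrix sends [u] to (i k, 0, 1), and [u] itself
   contributes the derivative of 1/a. *)
pose u1 s : 'cV[C]_3 := col3 (I * (k s)%:C + ('D_1 (fun s => (a s)^-1) s)%:C) 0 1.
have d1 s : J s -> is_derM s (1 : R) Gam (Fr s *m u1 s).
  move=> Js; rewrite (_ : Gam = (fun s => Fr s *m u s)); last exact/funext.
  have du : is_derM s (1 : R) u (col3 ('D_1 (fun s => (a s)^-1) s)%:C 0 0).
    apply: is_derM_col3; try exact: is_derC_cst.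
    by apply: is_derC_real; apply: derivableP; exact: (smooth_derivable sa1).
  have := is_derM_mul (is_derM_mc (1 : R) sF Js (gF s Js)) du.
  rewrite -mulmxA -mulmxDr EF//; congr is_derM; congr (_ *m _).
  apply/matrixP => i j; rewrite ord1 mxE mulmx3E /u /u1.
  rewrite !mxE fmorphV; move: i; apply: ord3P; mx3simp; field; exact: aC.
have e1 s : J s -> entrywise_deriv Gam s = Fr s *m u1 s.
  by move=> Js; rewrite entrywise_derivE; exact: DM_val (d1 s Js).
split.
- exact: sG.
- move=> s Js; apply/negP => /eqP G0; have := a0 s Js.
  have /(congr1 (fun m => ginv (Fr s) *m m)) := G0.
  rewrite GE mulmxA (groupG_ginv (gF s Js)).1 mul1mx mulmx0 => /matrixP/(_ i0 0).
  by rewrite !mxE /= => -[/eqP]; rewrite invr_eq0 => /eqP ->; rewrite ltxx.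
- move=> s Js; rewrite GE herm_mul; last by case: (gF s Js).
  by rewrite hermE; have [-> -> ->] := col3E ((a s)^-1)%:C 0 0; rewrite conjc0; ring.
- move=> s Js; rewrite e1// GE herm_mul; last by case: (gF s Js).
  rewrite hermE /u /u1; have [-> -> ->] := col3E ((a s)^-1)%:C 0 0.
  have [-> -> ->] := col3E (I * (k s)%:C + ('D_1 (fun s => (a s)^-1) s)%:C) 0 1.
  by rewrite conjc_real conjc0; ring.
move=> s Js; rewrite /det_jet e1//.
have -> : entrywise_deriv (entrywise_deriv Gam) s =
    Fr s *m (mc (1 : R) Fr s *m u1 s + DM (1 : R) u1 s).
  rewrite entrywise_derivE; apply: DM_val.
  have su1 : smooth_mx J u1.
    apply: smooth_col3; [|exact: smoothC_cst|exact: smoothC_cst].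
    apply: (smoothCD oJ); last by apply: smoothC_real; exact: smooth_derive.
    by apply: (smoothCM oJ); [exact: smoothC_cst|exact: smoothC_real].
  have E : \near s, Fr s *m u1 s = entrywise_deriv Gam s.
    by apply: filterS (open_nbhs_nbhs (conj oJ Js)) => r Jr; rewrite e1.
  apply: near_is_derM E _; rewrite mulmxDr mulmxA.
  exact: (is_derM_mul (is_derM_mc (1 : R) sF Js (gF s Js)) (smooth_mx_is_derM (1 : R) su1 Js)).
rewrite GE columns3_mul det_mulmx; have [-> _] := gF s Js; rewrite mul1r EF//.
(* Since [u] has only a first entry and the middle entry of [u1] is 0, the determinant involves just
   the middle entry of the second derivative. That entry is [a s], because [u1] contributes no
   derivative there. *)
have y0 : DM (1 : R) u1 s i1 0 = 0.
  have -> : DM (1 : R) u1 s i1 0 = DC (1 : R) (fun s => u1 s i1 0) s by rewrite mxE.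
  by under eq_fun do rewrite mxE; exact: DC_val (is_derC_cst _ _ _).
set X := DM _ u1 s in y0 *.
have E12 : ((a s)%:C *: wilczynski_mx (k s) (t s) *m u1 s + X) i1 0 = (a s)%:C.
  by rewrite [LHS]mxE y0 mulmx3E /u1 !mxE; mx3simp; ring.
rewrite det3 ![columns3 _ _ _ _ _]mxE; mx3simp.
rewrite -/i1 E12 /u /u1 !mxE; mx3simp.
by rewrite fmorphV; field; exact: aC.
Qed.

End Frames.

(** * Algebra of the momentum matrix *)

Section MomentumAlgebra.
Context {R : realType}.
Local Notation C := R[i].
Local Notation I := ('i%C : C).

(** The derivative of [momentum_mx] along a curve: [t1], [k1] and [t2] stand for the values of tau',
    kappa' and tau''. *)
Definition momentum_mx' (k t t1 k1 t2 : R) : 'M[C]_3 :=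
  let u1 := - 3 * (t1 * k + t * k1) in
  mx3 [:: [:: 0; u1 +i* t2; 2 * I * t1%:C];
          [:: t1%:C; 0; t2 +i* u1];
          [:: 0; - (I * t1%:C); 0]].

(* The two Euler-Lagrange expressions, up to the factor -3 in the first one. *)
Definition EL (k t t1 k1 t2 : R) : C :=
  (- 3 * (2 * k * t1 + t * k1)) +i* (t2 + 9 * k * (1 - t * k) - t ^+ 2).

Lemma momentum_defect (k t t1 k1 t2 : R) :
  momentum_mx' k t t1 k1 t2 + wilczynski_mx k t *m momentum_mx k t t1
    - momentum_mx k t t1 *m wilczynski_mx k t =
  mx3 [:: [:: 0; EL k t t1 k1 t2; 0]; [:: 0; 0; I * conjc (EL k t t1 k1 t2)]; [:: 0; 0; 0]].
Proof.
have sub (X Y Z : 'M[C]_3) i j : (X + Y - Z) i j = X i j + Y i j - Z i j by rewrite !mxE.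
apply: eq_mx3; rewrite sub !mulmx3E !mx3E; mx3simp; apply/eqP; rewrite eq_complex /=;
  by apply/andP; split; apply/eqP; ring.
Qed.

(** The terms carrying [a] have coefficients 2it, -it and -it and cancel; the bending sits on the
    diagonal, where L is 0; the corner entry 3i of L picks out the twist density. *)
Lemma tr_momentum_wilczynski (k t t1 a k' T' : R) : a != 0 ->
  \tr (momentum_mx k t t1 *m (a%:C *: wilczynski_mx (k' / a) (T' / a))) = 3 * I * T'%:C.
Proof.
move=> a0; have aC : a%:C != 0 by rewrite eq_complex /= eqxx andbT.
rewrite /mxtrace sum3 !mulmx3E.
have sc (X : 'M[C]_3) i j : (a%:C *: X) i j = a%:C * X i j by rewrite mxE.
rewrite !sc !mx3E; mx3simp; rewrite ?rmorphM ?fmorphV /= -?complexiE.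
have -> : t1 +i* (3 * (1 - t * k)) = I * ((3 * (1 - t * k)) +i* (- t1)).
  by apply/eqP; rewrite eq_complex /=; apply/andP; split; apply/eqP; ring.
have -> : (3 * (1 - t * k)) +i* t1 = (3 * (1 - t * k)) +i* (- t1) + 2 * I * t1%:C.
  by apply/eqP; rewrite eq_complex /=; apply/andP; split; apply/eqP; ring.
have hI := II (R := R); field: hI.
exact: aC.
Qed.

Lemma tr_momentum0 (k t t1 : R) : \tr (momentum_mx k t t1) = 0.
Proof. by rewrite /mxtrace sum3 !mx3E; mx3simp; rewrite !addr0. Qed.

Lemma is_derM_momentum (J : set R) (kappa tau : R -> R) s : open J -> smooth J kappa ->
  smooth J tau -> J s ->
  is_derM s (1 : R) (fun r => momentum_mx (kappa r) (tau r) (derive1 tau r))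
    (momentum_mx' (kappa s) (tau s) (derive1 tau s) (derive1 kappa s)
       (derive1 (derive1 tau) s)).
Proof.
move=> oJ sk st Js.
have dk : is_derive s (1 : R) kappa (derive1 kappa s).
  by rewrite derive1E; apply: derivableP; exact: (smooth_derivable sk).
have dt : is_derive s (1 : R) tau (derive1 tau s).
  by rewrite derive1E; apply: derivableP; exact: (smooth_derivable st).
have dt1 : is_derive s (1 : R) (derive1 tau) (derive1 (derive1 tau) s).
  rewrite derive1E; apply: derivableP.
  have -> : derive1 tau = 'D_1 tau by apply/funext => r; rewrite derive1E.
  exact: (smooth_derivable (smooth_derive (1 : R) st)).
have du : is_derive s (1 : R) (fun r => 3 * (1 - tau r * kappa r))
    (- 3 * (derive1 tau s * kappa s + tau s * derive1 kappa s)).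
  by apply: is_derive_eq; rewrite /GRing.scale /=; ring.
have c0 : is_derC s (1 : R) (fun=> 0 : C) 0 by exact: is_derC_cst.
have dT := is_derC_real dt.
have d2T : is_derC s (1 : R) (fun r => 2 * 'i * (tau r)%:C) (2 * I * (derive1 tau s)%:C).
  apply: is_derC_eq; first by apply: is_derCM; [exact: is_derC_cst|exact: dT].
  by rewrite -complexiE; ring.
have d3T : is_derC s (1 : R) (fun r => - 'i * (tau r)%:C) (- (I * (derive1 tau s)%:C)).
  apply: is_derC_eq; first by apply: is_derCM; [exact: is_derC_cst|exact: dT].
  by rewrite -complexiE; ring.
move=> i j; under eq_fun do rewrite mx3E; rewrite mx3E.
by move: i j; apply: ord3P; apply: ord3P => /=; try exact: c0; try exact: is_derC_cst;
  try exact: dT; try exact: d2T; try exact: d3T; split.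
Qed.

End MomentumAlgebra.

(** * The first variation *)

Section Variation.
Context {R : realType}.
Local Notation C := R[i].
Local Notation vt := ((0, 1) : R * R).

Lemma reduceE (V : normedModType R) (v : V) (A : V -> 'M[C]_3) p : exists b c,
  reduce v A p = A p *m (upperG b *m diagG (conjc (cbrt (mc v (upper_step v A) p i1 i2 /
    mc v (upper_step v A) p i2 i0))) *m centerG c).
Proof.
exists (mc v A p i1 i0 / mc v A p i2 i0).
exists (complex.Re (mc v (diag_step v (upper_step v A)) p i0 i0) /
  complex.Re (mc v (diag_step v (upper_step v A)) p i2 i0))%:C.
by rewrite !mulmxA.
Qed.

Lemma upper_entries (b al c : C) : let T := upperG b *m diagG al *m centerG c in
  [/\ T i0 i0 = al, T i1 i0 = 0, T i2 i0 = 0 & T i2 i1 = 0].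
Proof. by rewrite /= !mulmx3E !mx3E; mx3simp; split; ring. Qed.

Variables (J : set R) (F : R -> 'M[C]_3) (kappa tau : R -> R) (w : R -> C) (x1 y1 : R).
Hypotheses (oJ : open J) (sF : smooth_mx J F) (gF : forall s, J s -> groupG (F s))
  (mF : forall s, J s -> mc (1 : R) F s = wilczynski_mx (kappa s) (tau s))
  (sw : smoothC J w) (Jxy : forall s, x1 <= s <= y1 -> J s)
  (w0 : forall s, ~~ (x1 <= s <= y1) -> w s = 0).

Definition lowered (p : R * R) : 'M[C]_3 := F p.2 *m lowerG (p.1%:C * w p.2).

(* On this set, which has open slices in the direction of t, the variation is trivial. *)
Definition fixed_set : set (R * R) :=
  [set p | J p.2 /\ (p.1 = 0 \/ ~~ (x1 <= p.2 <= y1))].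

Lemma fixed_set_slice p : fixed_set p -> \forall s \near (0 : R), fixed_set (s *: vt + p).
Proof.
case: p => e t [/= Jt et].
have E s : s *: vt + (e, t) = (e, s + t) by congr pair; rewrite /= ?scaler0 ?add0r// [_ *: _]mulr1.
have cs : (fun s : R => s + t) @ (0 : R) --> t.
  by rewrite -[X in _ --> X]add0r; apply: cvgD; [exact: cvg_id|exact: cvg_cst].
have JN : \forall s \near (0 : R), J (s + t) by apply: cs; exact: open_nbhs_nbhs.
case: et => [e0|te].
  by apply: filterS JN => s Js; rewrite E; split=> //=; left.
have tN : \forall s \near (0 : R), ~~ (x1 <= s + t <= y1).
  move: te; rewrite negb_and -!ltNge => /orP[tx|ty].
    have h : \forall s \near (0 : R), s + t < x1 by exact: (cs _ (lt_nbhsl tx)).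
    by apply: filterS h => s h; rewrite negb_and -!ltNge h.
  have h : \forall s \near (0 : R), y1 < s + t by exact: (cs _ (lt_nbhsr ty)).
  by apply: filterS h => s h; rewrite negb_and -!ltNge h orbT.
by move: JN tN; apply: filterS2 => s Js ts; rewrite E; split=> //=; right.
Qed.

Lemma lowered_fixed p : fixed_set p -> lowered p = F p.2.
Proof.
move=> [_ h]; rewrite /lowered.
have -> : p.1%:C * w p.2 = 0 by case: h => [->|/w0 ->]; rewrite ?mul0r ?mulr0.
rewrite (_ : lowerG 0 = 1%:M) ?mulmx1//.
by apply: eq_mx3; rewrite !mx3E [RHS]mxE; mx3simp; rewrite ?conjc0 ?(mul0r, mulr0).
Qed.

Lemma mc_lowered_fixed p : fixed_set p ->
  mc vt lowered p = wilczynski_mx (kappa p.2) (tau p.2).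
Proof.
move=> Zp; rewrite -mF; last by case: Zp.
have -> : mc vt lowered p = mc vt (fun p => F p.2) p.
  apply: mc_slice; apply: filterS (fixed_set_slice Zp) => s; exact: lowered_fixed.
by rewrite /mc DM_snd.
Qed.

Lemma smooth_lowerG (V : normedModType R) (U : set V) (z : V -> C) : open U ->
  smoothC U z -> smooth_mx U (fun p => lowerG (z p)).
Proof.
move=> oU sz; have s0 := @smoothC_cst R V U 0; have s1 := @smoothC_cst R V U 1.
have sc := smoothC_conj oU sz.
apply: smooth_mx3 => //; apply: (smoothCM oU (smoothC_cst _ _)) => //.
by apply: (smoothCM oU); [exact: (smoothCM oU sz sc)|exact: smoothC_cst].
Qed.

Lemma smooth_lowered : smooth_mx [set p : R * R | J p.2] lowered.
Proof.
have oU := open_snd oJ.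
apply: (smooth_mx_mul oU (smooth_mx_snd sF)); apply: (smooth_lowerG oU).
apply: (smoothCM oU); first by apply: smoothC_real; exact: smooth_fst.
by case: sw => sr si; split; [exact: (smooth_snd sr)|exact: (smooth_snd si)].
Qed.

Lemma lowered_G p : J p.2 -> groupG (lowered p).
Proof. by move=> Jp; apply: groupG_mul; [exact: gF|exact: lowerG_G]. Qed.

(** Positivity at e = 0 spreads over the compact interval by the tube lemma, and off that interval
    the function equals 1. This is how the width becomes uniform over all of J. *)
Lemma strip_gt0 (U : set (R * R)) d (f : R * R -> R) : 0 < d ->
  U = [set p : R * R | - d < p.1 < d /\ J p.2] -> smooth U f ->
  (forall p, U p -> fixed_set p -> f p = 1) ->
  exists2 d', 0 < d' <= d & forall p, - d' < p.1 < d' -> J p.2 -> 0 < f p.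
Proof.
move=> d0 -> sf f1.
have [t ht|d1 d10 hd1] := @tube_gt0 _ f x1 y1.
  have Jt := Jxy ht; have Up : [set p : R * R | - d < p.1 < d /\ J p.2] (0, t).
    by split=> //=; rewrite oppr_lt0 d0.
  by split; [exact: (smooth_continuous sf Up)|rewrite f1//; split=> //; left].
exists (Num.min d d1); first by rewrite lt_min d0 d10 ge_min lexx.
move=> [e t] /= /andP[e1 e2] Jt; rewrite lt_min in e2; move/andP: e2 => [ed ed1].
move: e1; rewrite oppr_min gt_max => /andP[ed' ed1'].
have [ht|ht] := boolP (x1 <= t <= y1); first by apply: hd1 => //; rewrite ed1 ed1'.
rewrite f1//; first by split=> //=; rewrite ed ed'.
by split=> //; right.
Qed.

Local Notation A3 := (reduce vt lowered).

Lemma variation_frame : exists2 d, 0 < d &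
  let U := [set p : R * R | - d < p.1 < d /\ J p.2] in
  [/\ smooth_mx U A3, forall p, U p -> groupG (A3 p),
    forall p, U p -> 0 < complex.Re (mc vt A3 p i2 i0),
    forall p, U p -> mc vt A3 p = (complex.Re (mc vt A3 p i2 i0))%:C *:
        wilczynski_mx (complex.Im (mc vt A3 p i0 i0) / complex.Re (mc vt A3 p i2 i0))
                      (complex.Re (mc vt A3 p i0 i2) / complex.Re (mc vt A3 p i2 i0)) &
    forall p, U p -> exists b al c, al != 0 /\
      A3 p = lowered p *m (upperG b *m diagG al *m centerG c)].
Proof.
have oU0 := open_snd oJ.
have sub0 d : [set p : R * R | - d < p.1 < d /\ J p.2] `<=` [set p : R * R | J p.2].
  by move=> p [].
have sN0 := smooth_mc vt oU0 smooth_lowered.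
(* First shrinking of the strip, for the positivity of the entry (2, 0). The initial width 1 is
   arbitrary, as [lowered] is smooth for every e. *)
have [] := @strip_gt0 _ 1 (fun p => complex.Re (mc vt lowered p i2 i0)) ltr01 erefl.
- by apply: (smooth_subset (sub0 1)); case: (sN0 i2 i0).
- by move=> p _ Zp; rewrite mc_lowered_fixed// !mx3E.
move=> d1 /andP[d10 _] H1.
pose U1 := [set p : R * R | - d1 < p.1 < d1 /\ J p.2].
have oU1 : open U1 by exact: open_strip.
have sA1 : smooth_mx U1 lowered := smooth_mx_subset (sub0 d1) smooth_lowered.
have gA1 p : U1 p -> groupG (lowered p) by move=> [_ /lowered_G].
have n1 p : U1 p -> mc vt lowered p i2 i0 != 0.
  move=> [pd Jp]; have h := H1 p pd Jp; apply/negP => /eqP E.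
  by move: h; rewrite E ltxx.
have [sB gB B10 B20] := upper_stepP oU1 sA1 gA1 n1.
have sN1 := smooth_mc vt oU1 sB.
have B20' p : U1 p -> mc vt (upper_step vt lowered) p i2 i0 != 0.
  by move=> Up; rewrite B20// n1.
have B1 p : fixed_set p -> mc vt (upper_step vt lowered) p =
    wilczynski_mx (kappa p.2) (tau p.2).
  have U0 q : fixed_set q -> upper_step vt lowered q = lowered q.
    move=> Zq; rewrite /upper_step mc_lowered_fixed// !mx3E; mx3simp; rewrite mul0r.
    rewrite (_ : upperG 0 = 1%:M) ?mulmx1//.
    by apply: eq_mx3; rewrite !mxE /= ?conjc0 ?(mul0r, mulr0, oppr0).
  move=> Zp; rewrite -(mc_lowered_fixed Zp).
  have E : \forall s \near (0 : R), upper_step vt lowered (s *: vt + p) = lowered (s *: vt + p).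
    by apply: filterS (fixed_set_slice Zp) => s; exact: U0.
  exact: (mc_slice E).
(* Second shrinking, to bring the radicand of the cube root into the right half plane. The last
   correction needs no further restriction. *)
have [] := @strip_gt0 U1 d1 (fun p => complex.Re (mc vt (upper_step vt lowered) p i1 i2 /
    mc vt (upper_step vt lowered) p i2 i0)) d10 erefl.
- have : smoothC U1 (fun p => mc vt (upper_step vt lowered) p i1 i2 /
    mc vt (upper_step vt lowered) p i2 i0).
    apply: (smoothCM oU1 (sN1 i1 i2)); exact: (smoothC_inv oU1 B20' (sN1 i2 i0)).
  by case.
- by move=> p _ Zp; rewrite B1// !mx3E; mx3simp; rewrite divr1.
move=> d /andP[d0 dd1] H2; exists d => // U.
have sub1 : U `<=` U1.
  by move=> p [/andP[a b] Jp]; split=> //; rewrite (lt_le_trans b dd1) (le_lt_trans _ a)// lerN2.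
have oU : open U by exact: open_strip.
have [] := @diag_stepP _ _ vt U (upper_step vt lowered) oU.
- exact: smooth_mx_subset sub1 sB.
- by move=> p /sub1; exact: gB.
- by move=> p /sub1; exact: B10.
- by move=> p Up; rewrite B20; [case: (sub1 p Up) => a b; exact: H1|exact: sub1].
- by move=> p [a b]; exact: H2.
move=> sD gD D10 D20 D12.
have [s3 g3 p3 m3] := center_stepP oU sD gD D10 D20 D12.
split=> //.
move=> p [pd Jp]; have [b [c E]] := reduceE vt lowered p.
by eexists; eexists; eexists; split; last exact: E; rewrite conjc_eq0 cbrt_neq0// H2.
Qed.

Lemma variation_fixed p : fixed_set p -> A3 p = F p.2.
Proof.
move=> Zp; rewrite -lowered_fixed//.
apply: (reduce_slice (v := vt) (Z := fixed_set) (k := fun p => kappa p.2)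
  (t := fun p => tau p.2)) => //; [exact: fixed_set_slice|exact: mc_lowered_fixed].
Qed.

Lemma mc_variation_fixed p : fixed_set p ->
  mc vt A3 p = wilczynski_mx (kappa p.2) (tau p.2).
Proof.
move=> Zp; rewrite -(mc_lowered_fixed Zp).
have E : \forall s \near (0 : R), A3 (s *: vt + p) = lowered (s *: vt + p).
  apply: filterS (fixed_set_slice Zp) => s Zs.
  by rewrite (variation_fixed Zs) (lowered_fixed Zs).
exact: (mc_slice E).
Qed.

End Variation.

(** * Admissible competitors and the Euler-Lagrange expression *)

Section EulerLagrange.
Context {R : realType}.
Local Notation C := R[i].

Lemma vline_scale (c : C) (z : 'cV[C]_3) : c != 0 -> (<[c *: z]> = <[z]>)%VS.
Proof.
move=> c0; apply/eqP; rewrite eqEsubv -!memvE; apply/andP; split; apply/vlineP.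
  by exists c.
by exists c^-1; rewrite scalerA mulVf// scale1r.
Qed.

Lemma frame_wilczynski (J : set R) (gam : R -> {vspace 'cV[C]_3}) (Fr : R -> 'M[C]_3)
    (a k t : R -> R) : open J ->
  smooth_mx J Fr -> (forall s, J s -> groupG (Fr s)) ->
  smooth J a -> smooth J k -> smooth J t -> (forall s, J s -> 0 < a s) ->
  (forall s, J s -> mc (1 : R) Fr s = (a s)%:C *: wilczynski_mx (k s) (t s)) ->
  (forall s, J s -> gam s = <[col 0%R (Fr s)]>%VS) ->
  wilczynski_frame J gam a k t Fr /\ generic_transversal J gam.
Proof.
move=> oJ sF gF sa sk st a0 mF gE.
have [sG G0 Gn Gh Gd] := frame_lift oJ sF gF sa sk a0 mF.
set Gam := (fun s => _) in sG G0 Gn Gh Gd.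
have lG : is_lift J gam Gam.
  split=> // s Js; split; [exact: G0|exact: Gn|].
  by rewrite gE// /Gam vline_scale// eq_complex /= eqxx andbT invr_eq0 gt_eqF// a0.
split.
  split=> //.
  - move=> s Js; split; first exact: a0.
    rewrite -/Gam Gh// -complexiE invfM fmorphV invrK mulrA mulfV ?mul1r//.
    by rewrite eq_complex /= oner_eq0 andbF.
  - move=> s Js; rewrite entrywise_derivE groupG_invmx; last exact: gF.
    exact: mF.
exists Gam; split=> //.
  by move=> s Js; apply: (zeta_gt0 (a0 s Js)); [exact: G0|exact: Gh].
by move=> s Js; rewrite Gd// oppr_eq0 oner_eq0.
Qed.

Lemma smoothC_EL (J : set R) (kappa tau : R -> R) : open J -> smooth J kappa ->
  smooth J tau -> smoothC J (fun s => EL (kappa s) (tau s) (derive1 tau s)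
    (derive1 kappa s) (derive1 (derive1 tau) s)).
Proof.
move=> oJ sk st.
have d1 (f : R -> R) : derive1 f = 'D_1 f by apply/funext => r; rewrite derive1E.
have st1 : smooth J (derive1 tau) by rewrite d1; exact: smooth_derive.
have sk1 : smooth J (derive1 kappa) by rewrite d1; exact: smooth_derive.
have st2 : smooth J (derive1 (derive1 tau)).
  by rewrite [derive1 (derive1 _)]d1; exact: smooth_derive.
have c (r : R) : smooth J (fun=> r) by exact: smooth_cst.
split; rewrite /EL /=.
  apply: (smoothM oJ) => //; apply: (smoothD oJ); last exact: (smoothM oJ).
  by apply: (smoothM oJ) => //; exact: (smoothM oJ).
apply: (smoothB oJ); last by under eq_fun do rewrite expr2; exact: (smoothM oJ).
apply: (smoothD oJ) => //; apply: (smoothM oJ); first exact: (smoothM oJ).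
by apply: (smoothB oJ) => //; exact: (smoothM oJ).
Qed.

(** The variation will live on [x1, y1] and be integrated over [x, y]; the gaps between them make it
    trivial at the ends of integration. *)
Lemma interval_margins (J : set R) s : open J -> J s -> exists x x1 y1 y,
  [/\ x < x1, x1 < s < y1, y1 < y, J x & J y].
Proof.
move=> oJ Js; have /nbhs_ballP[e /= e0 be] : nbhs s J by exact: open_nbhs_nbhs.
exists (s - e / 2), (s - e / 4), (s + e / 4), (s + e / 2).
split; try lra.
- by apply: be; rewrite /ball /= ltr_norml; apply/andP; split; lra.
- by apply: be; rewrite /ball /= ltr_norml; apply/andP; split; lra.
Qed.

End EulerLagrange.

(** * The first variation formula for an abstract family of frames *)

Section FirstVariation.
Context {R : realType}.
Local Notation C := R[i].
Local Notation I := ('i%C : C).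
Local Notation h := (@hform R).
Local Notation vt := ((0, 1) : R * R).
Local Notation ve := ((1, 0) : R * R).

Lemma is_derC_tr (V : normedModType R) (p v : V) (A : V -> 'M[C]_3) dA :
  is_derM p v A dA -> is_derC p v (fun q => \tr (A q)) (\tr dA).
Proof. by move=> hA; apply: is_derC_sum => k; exact: hA. Qed.

(** Differentiates the explicit formula of [ginv]; skewness of K moves it across the form with a
    change of sign. *)
Lemma is_derM_ginv (V : normedModType R) (p v : V) (A : V -> 'M[C]_3) K :
  is_derM p v A (A p *m K) -> adjoint K *m h + h *m K = 0 ->
  is_derM p v (fun q => ginv (A q)) (- (K *m ginv (A p))).
Proof.
move=> hA /eqP; rewrite addr_eq0 => /eqP Kh.
have := is_derM_mul (is_derM_mul (is_derM_cst p v h) (is_derM_adjoint hA)) (is_derM_cst p v h).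
congr is_derM; rewrite mul0mx add0r mulmx0 addr0 adjoint_mul /ginv !mulmxA.
have -> : h *m adjoint K = - (K *m h).
  rewrite -[LHS]mulmx1 -hformK mulmxA -(mulmxA _ (adjoint K)) Kh mulmxN mulmxA hformK mul1mx.
  by rewrite mulNmx.
by rewrite !mulNmx.
Qed.

Lemma is_derM_snd_ve m n (A : R -> 'M[C]_(m, n)) (p : R * R) :
  is_derM p ve (fun p => A p.2) 0.
Proof.
have H : \forall s \near (0 : R), A (s *: ve + p).2 = A p.2.
  by apply: filterE => s; rewrite /= scaler0 add0r.
exact: (is_derM_slice H).
Qed.

Lemma is_derive_fst_ve (p : R * R) : is_derive p ve (fun p => p.1) 1.
Proof.
apply/is_derive_dir.
have -> : (fun s : R => (s *: ve + p).1) = (fun s => s + p.1).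
  by apply/funext => s; rewrite /= [_ *: _]mulr1.
by apply: is_derive_eq; rewrite addr0.
Qed.

(** The term K L B that completes the commutator is compensated by its cyclic permutation L B K,
    which at e = 0 cancels L B N because N = K there. *)
Lemma mxtrace_identity (L L' K B N : 'M[C]_3) :
  \tr (L' *m B + L *m (B *m N - K *m B)) =
  \tr ((L' + K *m L - L *m K) *m B) + \tr (L *m B *m N) - \tr (L *m B *m K).
Proof.
rewrite !(mulmxDl, mulmxDr, mulNmx, mulmxN) !(raddfD, raddfN) /= !mulmxA.
rewrite (mxtrace_mulC (L *m B) K) !mulmxA; ring.
Qed.

Lemma tr_defect (el z1 z2 : C) (X : 'M[C]_3) : X i1 i0 = z1 -> X i2 i1 = z2 ->
  \tr (mx3 [:: [:: 0; el; 0]; [:: 0; 0; I * conjc el]; [:: 0; 0; 0]] *m X) =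
  el * z1 + I * conjc el * z2.
Proof. by move=> <- <-; rewrite /mxtrace sum3 !mulmx3E !mx3E; mx3simp; ring. Qed.

(** The upper triangular factor is only known to exist at each point, so it cannot be
    differentiated. It is eliminated here in favour of entries of [B], which is smooth. *)
Lemma lowered_entries (B : 'M[C]_3) z (T : 'M[C]_3) : B = lowerG z *m T ->
  T i1 i0 = 0 -> T i2 i0 = 0 -> T i2 i1 = 0 ->
  B i1 i0 = z * B i0 i0 /\
  B i2 i1 = I * (z * conjc z / 2) * B i0 i1 + I * conjc z * (B i1 i1 - z * B i0 i1).
Proof.
by move=> -> T10 T20 T21; rewrite !mulmx3E T10 T20 T21 !mx3E; mx3simp; split; ring.
Qed.

Lemma conjugate_derivative (K X Y N : 'M[C]_3) :
  - (K *m X) *m Y + X *m (Y *m N) = X *m Y *m N - K *m (X *m Y).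
Proof. by rewrite mulNmx addrC !mulmxA. Qed.

Variables (J : set R) (F : R -> 'M[C]_3) (kappa tau : R -> R) (w : R -> C)
  (x x1 y1 y d : R) (A N : R * R -> 'M[C]_3).
Hypotheses (oJ : open J) (sF : smooth_mx J F) (gF : forall s, J s -> groupG (F s))
  (mF : forall s, J s -> mc (1 : R) F s = wilczynski_mx (kappa s) (tau s))
  (sk : smooth J kappa) (st : smooth J tau) (sw : smoothC J w)
  (xx : x < x1) (xy1 : x1 <= y1) (yy : y1 < y) (Jxy : forall s, x <= s <= y -> J s)
  (d0 : 0 < d).
Local Notation U := [set p : R * R | - d < p.1 < d /\ J p.2].
Local Notation a p := (complex.Re (N p i2 i0)).
Local Notation T p := (complex.Re (N p i0 i2)).
Hypotheses (sA : smooth_mx U A) (sN : smooth_mx U N)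
  (dA : forall p, U p -> is_derM p vt A (A p *m N p))
  (pA : forall p, U p -> 0 < a p)
  (wN : forall p, U p -> N p = (a p)%:C *:
     wilczynski_mx (complex.Im (N p i0 i0) / a p) (T p / a p))
  (fixed : forall p, J p.2 -> p.1 = 0 \/ ~~ (x1 <= p.2 <= y1) ->
     A p = F p.2 /\ N p = wilczynski_mx (kappa p.2) (tau p.2))
  (tA : forall p, U p -> exists Tt : 'M[C]_3, [/\ Tt i1 i0 = 0, Tt i2 i0 = 0, Tt i2 i1 = 0 &
      A p = F p.2 *m lowerG (p.1%:C * w p.2) *m Tt]).

Definition EL_at s := EL (kappa s) (tau s) (derive1 tau s) (derive1 kappa s)
  (derive1 (derive1 tau) s).

Definition L_at (p : R * R) := momentum_mx (kappa p.2) (tau p.2) (derive1 tau p.2).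

Definition L'_at (p : R * R) := momentum_mx' (kappa p.2) (tau p.2) (derive1 tau p.2)
  (derive1 kappa p.2) (derive1 (derive1 tau) p.2).

Definition K_at (p : R * R) := wilczynski_mx (kappa p.2) (tau p.2).

Definition D_at (p : R * R) : 'M[C]_3 := mx3 [:: [:: 0; EL_at p.2; 0];
  [:: 0; 0; I * conjc (EL_at p.2)]; [:: 0; 0; 0]].

Definition B_at (p : R * R) := ginv (F p.2) *m A p.

Definition pairing p := \tr (L_at p *m B_at p).

Lemma open_domain : open U.
Proof. exact: open_strip. Qed.

Lemma defect_at p : L'_at p + K_at p *m L_at p - L_at p *m K_at p = D_at p.
Proof. exact: momentum_defect. Qed.

Lemma smooth_B_at : smooth_mx U B_at.
Proof.
apply: (smooth_mx_mul open_domain _ sA).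
have : smooth_mx [set p : R * R | J p.2] (fun p => ginv (F p.2)).
  exact: (smooth_mx_snd (smooth_mx_ginv oJ sF)).
by apply: smooth_mx_subset => p [].
Qed.

Lemma smooth_L_at : smooth_mx U L_at.
Proof.
have : smooth_mx J (fun s => momentum_mx (kappa s) (tau s) (derive1 tau s)).
  have d1 (f : R -> R) : derive1 f = 'D_1 f by apply/funext => r; rewrite derive1E.
  have st1 : smooth J (derive1 tau) by rewrite d1; exact: smooth_derive.
  have su : smooth J (fun s => 3 * (1 - tau s * kappa s)).
    apply: (smoothM oJ); first exact: smooth_cst.
    by apply: (smoothB oJ); [exact: smooth_cst|exact: (smoothM oJ)].
  have z : smoothC J (fun=> 0 : C) by exact: smoothC_cst.
  apply: smooth_mx3 => //; try exact: smoothC_cst; try (by split);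
    try exact: smoothC_real; apply: (smoothCM oJ (smoothC_cst _ _)); exact: smoothC_real.
by move=> /smooth_mx_snd; apply: smooth_mx_subset => p [].
Qed.

Lemma derivative_B_at p : U p -> is_derM p vt B_at (B_at p *m N p - K_at p *m B_at p).
Proof.
move=> Up; have [_ Jp] := Up.
have dF : is_derM p vt (fun q => F q.2) (F p.2 *m K_at p).
  have := smooth_mx_is_derM vt (smooth_mx_snd sF) Jp.
  by rewrite DM_snd DM_mc ?mF//; exact: gF.
have Kh : adjoint (K_at p) *m h + h *m K_at p = 0.
  by rewrite /K_at -mF//; exact: (mc_skew (1 : R) oJ sF gF Jp).
have := is_derM_mul (is_derM_ginv dF Kh) (dA Up).
rewrite conjugate_derivative; exact.
Qed.

Lemma derivative_pairing p : U p -> is_derC p vt pairing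
  (\tr (D_at p *m B_at p) + \tr (L_at p *m B_at p *m N p) - \tr (L_at p *m B_at p *m K_at p)).
Proof.
move=> Up; have [_ Jp] := Up.
have dL : is_derM p vt L_at (L'_at p).
  have := smooth_mx_is_derM vt smooth_L_at Up.
  rewrite (DM_snd (fun s => momentum_mx (kappa s) (tau s) (derive1 tau s))).
  by rewrite (DM_val (is_derM_momentum oJ sk st Jp)).
have := is_derC_tr (is_derM_mul dL (derivative_B_at Up)).
by rewrite mxtrace_identity defect_at.
Qed.

Lemma smooth_pairing : smoothC U pairing.
Proof.
apply: (smoothC_sum open_domain) => k.
exact: (smooth_mx_mul open_domain smooth_L_at smooth_B_at k k).
Qed.

Lemma B_fixed p : J p.2 -> p.1 = 0 \/ ~~ (x1 <= p.2 <= y1) -> B_at p = 1%:M.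
Proof.
move=> Jp h; have [E _] := fixed Jp h.
by rewrite /B_at E (groupG_ginv (gF Jp)).1.
Qed.

(** The imaginary part is taken because L pairs with N to 3 i T, with T real. *)
Definition pairing' p := 'D_vt (fun q => complex.Im (pairing q)) p.

Lemma smooth_pairing' : smooth U pairing'.
Proof. by apply: smooth_derive; case: smooth_pairing. Qed.

Lemma lt_endpoints : x < y.
Proof. by rewrite (lt_le_trans xx)// (le_trans xy1)// ltW. Qed.

(** At both ends B is the identity and L has trace 0, so the primitive vanishes there whatever e
    is. *)
Lemma integral_pairing' e : - d < e < d ->
  \int[lebesgue_measure]_(t in `[x, y]) pairing' (e, t) = 0.
Proof.
move=> ed; have U_ t : x <= t <= y -> U (e, t) by move=> /Jxy.
have xy := lt_endpoints; set f := fun t => complex.Im (pairing (e, t)).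
have df t : x <= t <= y -> is_derive t (1 : R) f (pairing' (e, t)).
  move=> ht; have -> : pairing' (e, t) = 'D_1 f t.
    rewrite /pairing'; symmetry.
    apply: (derive_affine (A := fun t => (e, t)) (A0 := fun v => (0, v))
      (fun p => complex.Im (pairing p))).
    by move=> p v s; exact: slice_affine.
  apply: derivableP; apply: (smooth_derivable (U := [set t | U (e, t)])); last exact: U_.
  by apply: (smooth_slice e (f := fun p => complex.Im (pairing p))); case: smooth_pairing.
have cf t : x <= t <= y -> {for t, continuous (fun t => pairing' (e, t))}.
  by move=> ht; apply: (smooth_continuous (smooth_slice e smooth_pairing')); exact: U_.
have end_ t : x <= t <= y -> ~~ (x1 <= t <= y1) -> pairing (e, t) = 0.
  move=> ht h1; rewrite /pairing B_fixed ?mulmx1; [exact: tr_momentum0|exact: Jxy|].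
  by right.
rewrite (Rintegral_derive xy df cf) /f !end_ ?subrr// ?lexx ?(ltW xy)//.
  by rewrite negb_and -!ltNge xx.
by rewrite negb_and -!ltNge yy orbT.
Qed.

Lemma axis_domain t : x <= t <= y -> U (0, t).
Proof. by move=> /Jxy Jt; split=> //=; rewrite oppr_lt0 d0. Qed.

(** B is the identity at e = 0, so in the relations of [lowered_entries] only the terms linear in z,
    multiplied by diagonal entries of B, contribute. *)
Lemma derivative_ve_B t : x <= t <= y -> DM ve B_at (0, t) i1 i0 = w t /\
  DM ve B_at (0, t) i2 i1 = I * conjc (w t).
Proof.
move=> /axis_domain Ut; have [_ Jt] := Ut.
have dB := smooth_mx_is_derM ve smooth_B_at Ut.
have B1 : B_at (0, t) = 1%:M by apply: B_fixed => //; left.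
have Ent p : U p -> let z := p.1%:C * w p.2 in
    B_at p i1 i0 = z * B_at p i0 i0 /\ B_at p i2 i1 =
    I * (z * conjc z / 2) * B_at p i0 i1 + I * conjc z * (B_at p i1 i1 - z * B_at p i0 i1).
  move=> Up; have [Tt [t1 t2 t3 AE]] := tA Up; apply: lowered_entries t1 t2 t3.
  by rewrite /B_at AE !mulmxA (groupG_ginv (gF _)).1 ?mul1mx//; case: Up.
have dz : is_derC ((0, t) : R * R) ve (fun p => p.1%:C * w p.2) (w t).
  have dw : is_derC ((0, t) : R * R) ve (fun p => w p.2) 0.
    have := is_derM_snd_ve (fun s => const_mx (w s) : 'M[C]_1) ((0, t) : R * R).
    by move=> /(_ ord0 ord0); under eq_fun do rewrite mxE; rewrite mxE.
  apply: is_derC_eq (is_derCM (is_derC_real (is_derive_fst_ve _)) dw) _.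
  by rewrite /= mul1r mulr0 addr0.
have dzc := is_derC_conj dz.
have z0 : ((0, t) : R * R).1%:C * w ((0, t) : R * R).2 = 0 by rewrite mul0r.
have B00 : B_at (0, t) i0 i0 = 1 by rewrite B1 mxE.
have B11 : B_at (0, t) i1 i1 = 1 by rewrite B1 mxE.
have B01 : B_at (0, t) i0 i1 = 0 by rewrite B1 mxE.
have DE i j f df : (forall p, U p -> f p = B_at p i j) -> is_derC ((0, t) : R * R) ve f df ->
    DM ve B_at (0, t) i j = df.
  move=> fB hf; rewrite mxE; apply: DC_val.
  exact: near_is_derC (open_near_eq open_domain fB Ut) hf.
split.
  apply: DE (is_derC_eq (is_derCM dz (dB i0 i0)) _).
    by move=> p Up; have [-> _] := Ent p Up.
  by rewrite B00 z0 mul0r addr0 mulr1.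
apply: DE (is_derC_eq (is_derCD (is_derCM (is_derCM (is_derC_cst _ _ I)
  (is_derCM (is_derCM dz dzc) (is_derC_cst _ _ 2^-1))) (dB i0 i1))
  (is_derCM (is_derCM (is_derC_cst _ _ I) dzc)
  (is_derCB (dB i1 i1) (is_derCM dz (dB i0 i1))))) _).
  by move=> p Up; have [_ ->] := Ent p Up.
by rewrite B01 B11 z0 conjc0; ring.
Qed.

Lemma tr_LN p : U p -> \tr (L_at p *m N p) = 3 * I * (T p)%:C.
Proof.
by move=> Up; rewrite {1}(wN Up); apply: tr_momentum_wilczynski; rewrite gt_eqF// pA.
Qed.

Lemma derivative_ve_pairing' t : x <= t <= y -> 'D_ve pairing' (0, t) =
  2 * complex.Im (EL_at t * w t) + 3 * 'D_ve (fun p => T p) (0, t).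
Proof.
move=> ht; have Ut := axis_domain ht; have [_ Jt] := Ut.
have dB := smooth_mx_is_derM ve smooth_B_at Ut.
have dN := smooth_mx_is_derM ve sN Ut.
have dL : is_derM ((0, t) : R * R) ve L_at 0.
  exact: is_derM_snd_ve (fun s => momentum_mx (kappa s) (tau s) (derive1 tau s)) _.
have dK : is_derM ((0, t) : R * R) ve K_at 0.
  exact: is_derM_snd_ve (fun s => wilczynski_mx (kappa s) (tau s)) _.
have dD : is_derM ((0, t) : R * R) ve D_at 0.
  exact: is_derM_snd_ve (fun s => mx3 [:: [:: 0; EL_at s; 0];
    [:: 0; 0; I * conjc (EL_at s)]; [:: 0; 0; 0]]) _.
have [_ NK] : A (0, t) = F t /\ N (0, t) = K_at (0, t) by apply: fixed => //; left.
have B1 : B_at (0, t) = 1%:M by apply: B_fixed => //; left.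
have [w10 w21] := derivative_ve_B ht.
set X := DM ve B_at (0, t) in dB w10 w21; set M := DM ve N (0, t) in dN.
have dT : is_derive ((0, t) : R * R) ve (fun p => T p) ('D_ve (fun p => T p) (0, t)).
  by apply: derivableP; apply: (smooth_derivable (U := U)) => //; case: (sN i0 i2).
(* The trace identity holds on the whole strip and may be differentiated in e, while L does not
   depend on e. *)
have trLM : \tr (L_at (0, t) *m M) = 3 * I * ('D_ve (fun p => T p) (0, t))%:C.
  have h1 := is_derC_tr (is_derM_mul dL dN).
  have h2 := is_derCM (is_derC_cst ((0, t) : R * R) ve (3 * I)) (is_derC_real dT).
  have := DC_val (near_is_derC (open_near_eq open_domain tr_LN Ut) h1).
  by rewrite (DC_val h2) mul0mx add0r mul0r add0r => ->.
have h1 := is_derC_tr (is_derM_mul dD dB).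
have h2 := is_derC_tr (is_derM_mul (is_derM_mul dL dB) dN).
have h3 := is_derC_tr (is_derM_mul (is_derM_mul dL dB) dK).
have [_] := is_derCB (is_derCD h1 h2) h3.
rewrite B1 NK !(mul0mx, mulmx0, add0r, addr0, mulmx1) [\tr (_ + L_at _ *m M)]raddfD.
(* The two traces containing [K_at] cancel, and the defect only meets the entries (1, 0) and (2, 1)
   of [X], which are known; the other entries of [X] are irrelevant. *)
have -> : \tr (D_at (0, t) *m X) + (\tr (L_at (0, t) *m X *m K_at (0, t)) +
    \tr (L_at (0, t) *m M)) - \tr (L_at (0, t) *m X *m K_at (0, t)) =
    EL_at t * w t + I * conjc (EL_at t) * (I * conjc (w t)) +
    3 * I * ('D_ve (fun p => T p) (0, t))%:C.
  by rewrite -(tr_defect _ w10 w21) -trLM; ring.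
move=> h4.
have E p : U p -> complex.Im (\tr (D_at p *m B_at p) + \tr (L_at p *m B_at p *m N p) -
    \tr (L_at p *m B_at p *m K_at p)) = pairing' p.
  by move=> Up; have [_ [_ <-]] := derivative_pairing Up.
have [_ ->] := near_eq_is_derive (open_near_eq open_domain E Ut) h4.
rewrite !Im_add; congr (_ + _); last by rewrite !Im_mul /=; ring.
(* The second entry of the defect contributes minus the conjugate of the first, so that their sum is
   twice an imaginary part. *)
have -> : I * conjc (EL_at t) * (I * conjc (w t)) = - conjc (EL_at t * w t).
  by rewrite rmorphM /=; have hI := II (R := R); ring: hI.
by rewrite Im_opp Im_conj; ring.
Qed.

Lemma derivative_under_integral (f : R * R -> R) : smooth U f ->
  is_derive (0 : R) (1 : R) (fun e => \int[lebesgue_measure]_(t in `[x, y]) f (e, t))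
    (\int[lebesgue_measure]_(t in `[x, y]) 'D_ve f (0, t)).
Proof.
move=> sf; apply: (is_derive_Rintegral (g := 'D_ve f) d0) => e t ed ht.
have Ut : U (e, t) by split=> //; exact: Jxy.
split; [exact: smooth_continuous sf Ut|exact: smooth_continuous (smooth_derive ve sf) Ut|].
have /is_derive_dir h1 : is_derive ((e, t) : R * R) ve f ('D_ve f (e, t)).
  by apply: derivableP; exact: smooth_derivable sf Ut.
apply/is_derive_dir; move: h1; congr is_derive; apply/funext => s; congr f.
by congr pair; rewrite /= scaler0 add0r.
Qed.

Lemma first_variation : is_derive (0 : R) (1 : R)
    (fun e => \int[lebesgue_measure]_(t in `[x, y]) T (e, t)) 0 ->
  \int[lebesgue_measure]_(t in `[x, y]) complex.Im (EL_at t * w t) = 0.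
Proof.
have sT : smooth U (fun p => T p) by case: (sN i0 i2).
have dT := derivative_under_integral sT.
move=> [_ h0].
have {dT h0} iT : \int[lebesgue_measure]_(t in `[x, y]) 'D_ve (fun p => T p) (0, t) = 0.
  by case: dT => _ <-.
have [_ dP] := derivative_under_integral smooth_pairing'.
have ip : \int[lebesgue_measure]_(t in `[x, y]) 'D_ve pairing' (0, t) = 0.
  rewrite -dP.
  have nE : \forall e \near (0 : R), (cst 0 : R -> R) e =
      \int[lebesgue_measure]_(t in `[x, y]) pairing' (e, t).
    have d0' : - d < 0 < d by rewrite oppr_lt0 d0.
    have : \forall e \near (0 : R), - d < e < d.
      have := near_in_itvoo (a := - d) (b := d) (x := 0); rewrite in_itv /= => /(_ d0').
      by apply: filterS => e; rewrite in_itv.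
    by apply: filterS => e /integral_pairing' ->.
  have c0 : is_derive (0 : R) (1 : R) (cst 0 : R -> R) 0 by exact: is_derive_cst.
  by have [_ ->] := near_eq_is_derive nE c0.
have cE t : x <= t <= y -> {for t, continuous (fun t => complex.Im (EL_at t * w t))}.
  move=> /Jxy Jt; have [_ sE] := smoothCM oJ (smoothC_EL oJ sk st) sw.
  exact: smooth_continuous sE Jt.
have cT t : x <= t <= y -> {for t, continuous (fun t => 'D_ve (fun p => T p) (0, t))}.
  move=> ht; apply: (smooth_continuous (smooth_slice 0 (smooth_derive ve sT))).
  exact: axis_domain.
have intE := segment_integrable cE; have intT := segment_integrable cT.
have : \int[lebesgue_measure]_(t in `[x, y]) 'D_ve pairing' (0, t) =
    2 * (\int[lebesgue_measure]_(t in `[x, y]) complex.Im (EL_at t * w t)) +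
    3 * (\int[lebesgue_measure]_(t in `[x, y]) 'D_ve (fun p => T p) (0, t)).
  rewrite -!RintegralZl// -RintegralD//; last 2 first.
  - by apply: segment_integrable => t ht; apply: cvgM; [exact: cvg_cst|exact: cE].
  - by apply: segment_integrable => t ht; apply: cvgM; [exact: cvg_cst|exact: cT].
  apply: eq_Rintegral => t; rewrite inE /= in_itv /= => ht.
  by rewrite derivative_ve_pairing'.
rewrite ip iT mulr0 addr0 => /esym/eqP; rewrite mulf_eq0 pnatr_eq0 /=; exact/eqP.
Qed.

End FirstVariation.

(** * Criticality implies the Euler-Lagrange equations *)

Section CriticalEulerLagrange.
Context {R : realType}.
Local Notation C := R[i].
Local Notation I := ('i%C : C).
Local Notation vt := ((0, 1) : R * R).
Local Notation strip J d := [set p : R * R | - d < p.1 < d /\ J p.2].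

Lemma variation_exists (J : set R) (F : R -> 'M[C]_3) (kappa tau : R -> R) (w : R -> C)
    (x1 y1 : R) : open J -> smooth_mx J F -> (forall s, J s -> groupG (F s)) ->
  (forall s, J s -> mc (1 : R) F s = wilczynski_mx (kappa s) (tau s)) ->
  smoothC J w -> (forall s, x1 <= s <= y1 -> J s) ->
  (forall s, ~~ (x1 <= s <= y1) -> w s = 0) ->
  exists (d : R) (A N : R * R -> 'M[C]_3), [/\ 0 < d,
    [/\ smooth_mx (strip J d) A, smooth_mx (strip J d) N &
        forall p, strip J d p -> groupG (A p)],
    [/\ forall p, strip J d p -> is_derM p vt A (A p *m N p),
        forall p, strip J d p -> mc (1 : R) (fun t => A (p.1, t)) p.2 = N p,
        forall p, strip J d p -> 0 < complex.Re (N p i2 i0) &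
        forall p, strip J d p -> N p = (complex.Re (N p i2 i0))%:C *:
          wilczynski_mx (complex.Im (N p i0 i0) / complex.Re (N p i2 i0))
                        (complex.Re (N p i0 i2) / complex.Re (N p i2 i0))],
    forall p, J p.2 -> p.1 = 0 \/ ~~ (x1 <= p.2 <= y1) ->
      A p = F p.2 /\ N p = wilczynski_mx (kappa p.2) (tau p.2) &
    forall p, strip J d p -> exists Tt : 'M[C]_3,
      [/\ Tt i0 i0 != 0, Tt i1 i0 = 0, Tt i2 i0 = 0, Tt i2 i1 = 0 &
          A p = lowered F w p *m Tt]].
Proof.
move=> oJ sF gF mF sw Jxy w0.
have [d d0 [sA gA pA NA tA]] := variation_frame oJ sF gF mF sw Jxy w0.
have sN : smooth_mx (strip J d) (mc vt (reduce vt (lowered F w))).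
  by apply: smooth_mc sA; exact: open_strip.
have dA p : strip J d p -> is_derM p vt (reduce vt (lowered F w))
    (reduce vt (lowered F w) p *m mc vt (reduce vt (lowered F w)) p).
  by move=> Up; exact: (is_derM_mc vt sA Up (gA p Up)).
(* A Wilczynski frame of a single curve is differentiated in t at fixed e; this agrees with the
   derivative of the plane map in direction (0, 1). *)
have slice p : mc (1 : R) (fun t => reduce vt (lowered F w) (p.1, t)) p.2 =
    mc vt (reduce vt (lowered F w)) p.
  by case: p => e t; rewrite /mc DM_slice_eq.
have fixed p : J p.2 -> p.1 = 0 \/ ~~ (x1 <= p.2 <= y1) ->
    reduce vt (lowered F w) p = F p.2 /\
    mc vt (reduce vt (lowered F w)) p = wilczynski_mx (kappa p.2) (tau p.2).
  move=> Jp h; have Zp : fixed_set J x1 y1 p by [].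
  by split; [exact: (variation_fixed oJ mF w0 Zp)|exact: (mc_variation_fixed oJ mF w0 Zp)].
have tri p : strip J d p -> exists Tt : 'M[C]_3,
    [/\ Tt i0 i0 != 0, Tt i1 i0 = 0, Tt i2 i0 = 0, Tt i2 i1 = 0 &
        reduce vt (lowered F w) p = lowered F w p *m Tt].
  move=> Up; have [b [al [c [al0 E]]]] := tA p Up.
  exists (upperG b *m diagG al *m centerG c).
  by have [-> -> -> ->] := upper_entries b al c; rewrite E.
(* From here on only the listed properties of the family are kept; its construction is forgotten. *)
move: (reduce vt (lowered F w)) (mc vt (reduce vt (lowered F w))) sN dA slice fixed tri
  sA gA pA NA {tA} => A N sN dA slice fixed tri sA gA pA NA.
by exists d, A, N.
Qed.

Lemma smooth_mx_col (V : normedModType R) (U : set V) m n (A : V -> 'M[C]_(m, n)) j :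
  smooth_mx U A -> smooth_mx U (fun p => col j (A p)).
Proof.
move=> sA i k; change (smoothC U (fun p => col j (A p) i k)).
by under eq_fun do rewrite mxE; exact: sA.
Qed.

Lemma groupG_col0 (A : 'M[C]_3) : groupG A ->
  col 0 A != 0 /\ herm (col 0 A) (col 0 A) = 0.
Proof.
move=> gA; rewrite colE; split.
  apply/eqP => E; have /(congr1 (mulmx (ginv A))) := E.
  rewrite mulmxA (groupG_ginv gA).1 mul1mx mulmx0 => /matrixP/(_ 0 0).
  by rewrite !mxE /= => /eqP; rewrite oner_eq0.
rewrite herm_mul; last by case: gA.
rewrite hermE !mxE /=; apply/eqP.
by rewrite eq_complex /=; apply/andP; split; apply/eqP; ring.
Qed.

Lemma critical_first_variation (J : set R) (gamma : R -> {vspace 'cV[C]_3})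
    (F : R -> 'M[C]_3) (kappa tau : R -> R) (w : R -> C) (x x1 y1 y : R) :
  open J -> critical J gamma -> wilczynski_frame J gamma (fun=> 1) kappa tau F ->
  smoothC J w -> (forall s, ~~ (x1 <= s <= y1) -> w s = 0) ->
  x < x1 -> x1 <= y1 -> y1 < y -> (forall s, x <= s <= y -> J s) ->
  \int[lebesgue_measure]_(t in `[x, y]) complex.Im (EL_at kappa tau t * w t) = 0.
Proof.
move=> oJ [_ crit] [[_ sk st sF] [[_ lift] _] _ gF mF'] sw w0 xx xy1 yy Jxy.
have mF s : J s -> mc (1 : R) F s = wilczynski_mx (kappa s) (tau s).
  by move=> Js; have := mF' s Js; rewrite groupG_invmx ?entrywise_derivE ?scale1r//; exact: gF.
have Jxy1 s : x1 <= s <= y1 -> J s.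
  by move=> /andP[a b]; apply: Jxy; rewrite (le_trans (ltW xx) a) (le_trans b (ltW yy)).
have off s : ~~ (x <= s <= y) -> ~~ (x1 <= s <= y1).
  apply: contra => /andP[a b]; by rewrite (le_trans (ltW xx) a) (le_trans b (ltW yy)).
have [d [A [N [d0 [sA sN gA] [dA mA pA wN] fixed tA]]]] := variation_exists oJ sF gF mF sw Jxy1 w0.
(* The varied curve is spanned by the first column of [lowered]. The upper triangular correction
   only rescales that column, so the first column of [A] spans the same line. *)
have gE e t : - d < e < d -> J t ->
    <[col 0%R (lowered F w (e, t))]>%VS = <[col 0%R (A (e, t))]>%VS.
  move=> ed Jt; have [Tt [T0 T1 T2 _ ->]] := tA (e, t) (conj ed Jt).
  have -> : col 0 (lowered F w (e, t) *m Tt) = Tt i0 i0 *: col 0 (lowered F w (e, t)).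
    apply/matrixP => i j; rewrite [LHS]mxE [RHS]mxE [X in _ * X]mxE mulmx3E ord3_0 T1 T2.
    by rewrite !mulr0 !addr0 mulrC.
  by rewrite vline_scale.
have gammaE t : J t -> gamma t = <[col 0%R (F t)]>%VS.
  by move=> Jt; have [_ _ ->] := lift t Jt; rewrite invr1 scale1r.
have low p : J p.2 -> p.1 = 0 \/ ~~ (x1 <= p.2 <= y1) -> lowered F w p = F p.2.
  move=> Jp h; have Zp : fixed_set J x1 y1 p by [].
  exact: (lowered_fixed F w0 Zp).
pose a e t := complex.Re (N (e, t) i2 i0).
pose k e t := complex.Im (N (e, t) i0 i0) / a e t.
pose tt e t := complex.Re (N (e, t) i0 i2) / a e t.
have frame e : - d < e < d ->
    wilczynski_frame J (fun t => <[col 0%R (lowered F w (e, t))]>%VS) (a e) (k e) (tt e)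
      (fun t => A (e, t)) /\
    generic_transversal J (fun t => <[col 0%R (lowered F w (e, t))]>%VS).
  move=> ed; have sub : J `<=` [set t | strip J d (e, t)] by move=> t Jt; split.
  have sNe := smooth_mx_subset sub (smooth_mx_slice e sN).
  have sa : smooth J (a e) by case: (sNe i2 i0).
  have a0 s : J s -> a e s != 0 by move=> Js; rewrite gt_eqF//; exact: (pA (e, s) (conj ed Js)).
  have si : smooth J (fun t => (a e t)^-1) by exact: (smooth_comp oJ a0 smooth_inv sa).
  apply: frame_wilczynski => //.
  - exact: smooth_mx_subset sub (smooth_mx_slice e sA).
  - by move=> s Js; exact: (gA (e, s)).
  - by apply: (smoothM oJ) => //; case: (sNe i0 i0).
  - by apply: (smoothM oJ) => //; case: (sNe i0 i2).
  - by move=> s Js; exact: (pA (e, s)).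
  - by move=> s Js; rewrite (mA (e, s))//; exact: (wN (e, s)).
  - by move=> s Js; exact: gE.
have tA' p : strip J d p -> exists Tt : 'M[C]_3, [/\ Tt i1 i0 = 0, Tt i2 i0 = 0, Tt i2 i1 = 0 &
    A p = F p.2 *m lowerG (p.1%:C * w p.2) *m Tt].
  by move=> Up; have [Tt [_ T1 T2 T3 E]] := tA p Up; exists Tt; split.
have := crit x y d (fun e t => <[col 0%R (lowered F w (e, t))]>%VS) a k tt
  (fun e t => A (e, t)) d0.
(* Twist times strain is the entry (0, 2) of N itself, since [tt] was defined with division by
   [a]. *)
have E : \forall e \near (0 : R), total_twist (a e) (tt e) x y =
    \int[lebesgue_measure]_(t in `[x, y]) complex.Re (N (e, t) i0 i2).
  have : \forall e \near (0 : R), - d < e < d.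
    have := near_in_itvoo (a := - d) (b := d) (x := 0); rewrite in_itv /= oppr_lt0 d0 => /(_ isT).
    by apply: filterS => e; rewrite in_itv.
  apply: filterS => e ed; apply: eq_Rintegral => t; rewrite inE /= in_itv /= => /Jxy Jt.
  by rewrite /tt divfK// gt_eqF//; exact: (pA (e, t) (conj ed Jt)).
have var : compact_variation J gamma x y d (fun e t => <[col 0%R (lowered F w (e, t))]>%VS).
  split.
  - exact: Jxy.
  - exists (fun p => col 0 (lowered F w p)).
      apply: smooth_mx_col; apply: (smooth_mx_subset _ (smooth_lowered oJ sF sw)).
      by move=> p [].
    move=> e t ed Jt; have gl : groupG (lowered F w (e, t)) by exact: (lowered_G w gF).
    by have [n0 h0] := groupG_col0 gl; split.
  - by move=> t Jt; rewrite low ?gammaE//; left.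
  - by move=> e t ed Jt /off h; rewrite low ?gammaE//; right.
  - by move=> e ed; case: (frame e ed).
have wf e : - d < e < d -> wilczynski_frame J (fun t => <[col 0%R (lowered F w (e, t))]>%VS)
    (a e) (k e) (tt e) (fun t => A (e, t)).
  by move=> ed; case: (frame e ed).
move=> /(_ var wf) D; have {}D := near_eq_is_derive E D.
exact: (first_variation oJ sF gF mF sk st sw xx xy1 yy Jxy d0 sA sN dA pA wN fixed tA' D).
Qed.

Lemma critical_euler_lagrange (J : set R) (gamma : R -> {vspace 'cV[C]_3})
    (F : R -> 'M[C]_3) (kappa tau : R -> R) s : open J -> is_interval J -> critical J gamma ->
  wilczynski_frame J gamma (fun=> 1) kappa tau F -> J s -> EL_at kappa tau s = 0.
Proof.
move=> oJ iJ crit WF Js; have [[_ sk st _] _ _ _ _] := WF.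
have [x [x1 [y1 [y [xx /andP[xs sy] yy Jx Jy]]]]] := interval_margins oJ Js.
have Jxy r : x <= r <= y -> J r by exact: iJ.
have [b [sb b0 bp bz]] := bump_exists x1 y1.
pose E := EL_at kappa tau; have sE : smoothC J E := smoothC_EL oJ sk st.
have sbJ : smoothC J (fun r => (b r)%:C).
  by apply: smoothC_real; apply: (smooth_subset _ sb).
have sw : smoothC J (fun r => (b r)%:C * (I * conjc (E r))).
  apply: (smoothCM oJ) => //; apply: (smoothCM oJ); [exact: smoothC_cst|].
  exact: (smoothC_conj oJ).
have w0 r : ~~ (x1 <= r <= y1) -> (b r)%:C * (I * conjc (E r)) = 0.
  move=> h; rewrite bz ?mul0r//; apply: contra h => /andP[a1 a2]; by rewrite !ltW.
have xy1 : x1 <= y1 by rewrite ltW// (lt_trans xs).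
have int0 := critical_first_variation oJ crit WF sw w0 xx xy1 yy Jxy.
pose q r := b r * (complex.Re (E r) ^+ 2 + complex.Im (E r) ^+ 2).
(* With this [w] the integrand is the bump times the squared modulus of E, hence nonnegative. *)
have Eq : (fun r => complex.Im (E r * ((b r)%:C * (I * conjc (E r))))) = q.
  by apply/funext => r; rewrite /q !Im_mul !Re_mul Im_conj Re_conj /=; ring.
have sq : smooth J q by rewrite -Eq; have [] := smoothCM oJ sE sw.
have : q s = 0.
  apply: (@Rintegral_eq0_continuous _ q x y).
  - by move=> t /Jxy Jt; exact: smooth_continuous sq Jt.
  - by move=> t _; rewrite mulr_ge0// addr_ge0// sqr_ge0.
  - by rewrite -Eq.
  - by rewrite (lt_trans xx xs) (lt_trans sy yy).
move/eqP; rewrite mulf_eq0 gt_eqF ?bp ?xs ?sy//= paddr_eq0 ?sqr_ge0// !sqrf_eq0 => /andP[r0 i0].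
by apply/eqP; rewrite -/E eq_complex r0 i0.
Qed.

End CriticalEulerLagrange.

(** * Integration of the momentum equation *)

Section Modulus.
Context {R : realType}.

Lemma interval_cst (J : set R) (f : R -> R) s : is_interval J -> J 0 -> J s ->
  (forall r, J r -> is_derive r (1 : R) f 0) -> f s = f 0.
Proof.
move=> iJ J0 Js df.
have H x y : J x -> J y -> x < y -> f y = f x.
  move=> Jx Jy xy; have D t : x <= t <= y -> is_derive t (1 : R) f 0 by move=> /(iJ _ _ Jx Jy)/df.
  have Z t : x <= t <= y -> {for t, continuous (fun=> 0 : R)} by move=> _; exact: cvg_cst.
  have := Rintegral_derive xy D Z.
  rewrite (_ : \int[_]_(_ in _) _ = 0); first by move/eqP; rewrite eq_sym subr_eq0 => /eqP.
  by rewrite /Rintegral integral0.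
by case: (ltgtP s 0) => [h|h|->//]; [rewrite (H s 0)|rewrite (H 0 s)].
Qed.

Lemma EL_eq0 (k t t1 k1 t2 : R) : EL k t t1 k1 t2 = 0 ->
  t * k1 = - 2 * k * t1 /\ t2 = t ^+ 2 - 9 * k * (1 - t * k).
Proof. by move=> /eqP; rewrite eq_complex /= => /andP[/eqP h1 /eqP h2]; split; lra. Qed.

Variables (J : set R) (kappa tau : R -> R).
Hypotheses (oJ : open J) (iJ : is_interval J) (J0 : J 0)
  (sk : smooth J kappa) (st : smooth J tau)
  (el : forall s, J s -> EL_at kappa tau s = 0).

Lemma is_derive_kappa s : J s -> is_derive s (1 : R) kappa (derive1 kappa s).
Proof. by move=> Js; rewrite derive1E; apply: derivableP; exact: (smooth_derivable sk). Qed.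

Lemma is_derive_tau s : J s -> is_derive s (1 : R) tau (derive1 tau s).
Proof. by move=> Js; rewrite derive1E; apply: derivableP; exact: (smooth_derivable st). Qed.

Lemma smooth_tau1 : smooth J (derive1 tau).
Proof.
have -> : derive1 tau = 'D_1 tau by apply/funext => r; rewrite derive1E.
exact: smooth_derive.
Qed.

Lemma is_derive_tau1 s : J s -> is_derive s (1 : R) (derive1 tau) (derive1 (derive1 tau) s).
Proof.
by move=> Js; rewrite derive1E; apply: derivableP; exact: (smooth_derivable smooth_tau1).
Qed.

Lemma modulus1_cst s : J s -> kappa s * tau s ^+ 2 = kappa 0 * tau 0 ^+ 2.
Proof.
move=> Js; apply: (@interval_cst J (fun s => kappa s * tau s ^+ 2)) => // r Jr.
have [h1 h2] := EL_eq0 (el Jr).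
have dk := is_derive_kappa Jr; have dt := is_derive_tau Jr.
apply: is_derive_eq; rewrite /GRing.scale /=.
transitivity (tau r * (tau r * derive1 kappa r + 2 * kappa r * derive1 tau r)); first by ring.
by rewrite h1; ring.
Qed.

Lemma modulus2_cst s : J s ->
  - (18 * kappa s * tau s) + 9 * kappa s ^+ 2 * tau s ^+ 2
    - 2 / 3 * tau s ^+ 3 + derive1 tau s ^+ 2 =
  - (18 * kappa 0 * tau 0) + 9 * kappa 0 ^+ 2 * tau 0 ^+ 2
    - 2 / 3 * tau 0 ^+ 3 + derive1 tau 0 ^+ 2.
Proof.
move=> Js; pose f s := - (18 * kappa s * tau s) +
  9 * kappa s ^+ 2 * tau s ^+ 2 - 2 / 3 * tau s ^+ 3 + derive1 tau s ^+ 2.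
suff df r : J r -> is_derive r (1 : R) f 0 by exact: (interval_cst iJ J0 Js df).
move=> Jr; rewrite /f.
have [h1 h2] := EL_eq0 (el Jr).
have dk := is_derive_kappa Jr; have dt := is_derive_tau Jr; have dt1 := is_derive_tau1 Jr.
apply: is_derive_eq; rewrite /GRing.scale /= h2.
transitivity (18 * (tau r * kappa r - 1) * (tau r * derive1 kappa r + 2 * kappa r * derive1 tau r)).
  by field.
by rewrite h1; ring.
Qed.

(** If the bending were nonzero at [s], then on a neighbourhood the constant c1 = 0 would force tau
    = 0, and the first equation tau' = 0. Hence tau'' = 0 at [s], and the second equation gives
    kappa = 0 there. *)
Lemma bending_eq0 s : kappa 0 * tau 0 ^+ 2 = 0 -> J s -> kappa s = 0.
Proof.
move=> c0 Js; apply/eqP/negPn/negP => k0.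
have nk : \forall r \near s, kappa r != 0.
  exact: (smooth_continuous sk Js) _ (open_nbhs_nbhs (conj open_neq0 k0)).
have nJ : \forall r \near s, J r by exact: open_nbhs_nbhs.
have T0 r : J r -> kappa r != 0 -> tau r = 0 /\ derive1 tau r = 0.
  move=> Jr kr; have := modulus1_cst Jr; rewrite c0 => /eqP.
  rewrite mulf_eq0 (negPf kr) /= sqrf_eq0 => /eqP t0; split=> //.
  have [h1 _] := EL_eq0 (el Jr); move: h1; rewrite t0 mul0r => /esym/eqP.
  by rewrite !mulf_eq0 (negPf kr) oppr_eq0 pnatr_eq0 /= => /eqP.
have n0 : \forall r \near s, derive1 tau r = (cst 0 : R -> R) r.
  by move: nk nJ; apply: filterS2 => r kr Jr; case: (T0 r Jr kr).
have c : is_derive s (1 : R) (cst 0 : R -> R) (derive1 (derive1 tau) s).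
  exact: near_eq_is_derive n0 (is_derive_tau1 Js).
have t20 : derive1 (derive1 tau) s = 0.
  have c' : is_derive s (1 : R) (cst 0 : R -> R) 0 by exact: is_derive_cst.
  by case: c => _ <-; case: c'.
have [_ h2] := EL_eq0 (el Js); have [t0 _] := T0 s Js k0.
by move: h2 k0; rewrite t20 t0 => h2 /eqP; apply; lra.
Qed.

End Modulus.

(** * Characteristic polynomial and eigenvectors of the momentum matrix *)

Section Eigenvectors.
Context {R : realType}.
Local Notation C := R[i].
Local Notation I := ('i%C : C).

Definition charQ (c1 c2 : R) (l : C) : C := l ^+ 3 + 6 * c1%:C * l + (27 + 3 * c2%:C).

(* [yvec] with the bending in place of the modulus; this removes the division by tau. *)
Definition yk (k t t1 : R) (l : C) : 'cV[C]_3 :=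
  col3 (t%:C * (3 - I * t1%:C) - l ^+ 2 - 3 * k%:C * t%:C ^+ 2)
       (9 - 9 * k%:C * t%:C - l * t%:C - 3 * I * t1%:C)
       (I * (t%:C ^+ 2 - 3 * l)).

Lemma realC_ops : [/\ forall a b : R, (a + b)%:C = a%:C + b%:C, forall a : R, (- a)%:C = - a%:C,
  forall a b : R, (a * b)%:C = a%:C * b%:C, forall (a : R) n, (a ^+ n)%:C = a%:C ^+ n &
  forall n, (n%:R : R)%:C = n%:R].
Proof.
by split=> *; rewrite ?rmorphD ?rmorphN ?rmorphM ?rmorphXn ?rmorph_nat.
Qed.

Lemma momentum_mxE (k t t1 : R) : let u := 3 * (1 - t%:C * k%:C) in
  momentum_mx k t t1 = mx3 [:: [:: 0; u + I * t1%:C; 2 * I * t%:C];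
          [:: t%:C; 0; t1%:C + I * u]; [:: 3 * I; - I * t%:C; 0]].
Proof.
by apply: eq_mx3; rewrite !mx3E; mx3simp; apply/eqP; rewrite eq_complex /=;
  apply/andP; split; apply/eqP; ring.
Qed.

Definition mod2 (k t t1 : R) : R :=
  - (18 * k * t) + 9 * k ^+ 2 * t ^+ 2 - 2 / 3 * t ^+ 3 + t1 ^+ 2.

(** The factor 3, which is the coefficient of c2 in Q, clears the denominator of 2/3 and leaves a
    polynomial over the complex numbers. *)
Lemma mod2C (k t t1 : R) : 3 * (mod2 k t t1)%:C = - (54 * k%:C * t%:C) +
  27 * k%:C ^+ 2 * t%:C ^+ 2 - 2 * t%:C ^+ 3 + 3 * t1%:C ^+ 2.
Proof.
have [rD rN rM rX rn] := realC_ops.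
have -> : (3 : C) = (3 : R)%:C by rewrite rn.
rewrite -rM (_ : 3 * mod2 k t t1 = - (54 * k * t) + 27 * k ^+ 2 * t ^+ 2 - 2 * t ^+ 3 +
  3 * t1 ^+ 2); last by rewrite /mod2; field.
by rewrite !(rD, rN, rM, rX, rn).
Qed.

Lemma charQ_momentum (k t t1 : R) (l : C) :
  \det (momentum_mx k t t1 - l%:M) = - charQ (k * t ^+ 2) (mod2 k t t1) l.
Proof.
have sub (X Y : 'M[C]_3) i j : (X - Y) i j = X i j - Y i j by rewrite !mxE.
have sc i j : (l%:M : 'M[C]_3) i j = if i == j then l else 0.
  by rewrite mxE; case: (i == j).
have [rD rN rM rX rn] := realC_ops.
rewrite det3 !sub !sc momentum_mxE !mx3E; mx3simp; rewrite /= /charQ mod2C rM rX.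
have hI := II (R := R); ring: hI.
Qed.

Lemma momentum_yk (k t t1 : R) (l : C) : charQ (k * t ^+ 2) (mod2 k t t1) l = 0 ->
  momentum_mx k t t1 *m yk k t t1 l = l *: yk k t t1 l.
Proof.
move=> hQ; have [rD rN rM rX rn] := realC_ops.
(* The characteristic equation solved for the cube of [l]; modulo this rule and i^2 = -1 the
   coordinates below are polynomial identities. *)
have hl : l ^+ 3 = - (6 * (k%:C * t%:C ^+ 2) * l + (27 + (- (54 * k%:C * t%:C) +
  27 * k%:C ^+ 2 * t%:C ^+ 2 - 2 * t%:C ^+ 3 + 3 * t1%:C ^+ 2))).
  by apply/eqP; rewrite -addr_eq0 -mod2C -rX -rM; apply/eqP; rewrite -[RHS]hQ /charQ addrA.
have [y0 y1 y2] := col3E (t%:C * (3 - I * t1%:C) - l ^+ 2 - 3 * k%:C * t%:C ^+ 2)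
       (9 - 9 * k%:C * t%:C - l * t%:C - 3 * I * t1%:C) (I * (t%:C ^+ 2 - 3 * l)).
have hI := II (R := R).
apply/matrixP => i j; rewrite (ord1 j) [RHS]mxE mulmx3E momentum_mxE !mx3E /yk y0 y1 y2.
move: i; apply: ord3P; rewrite ?y0 ?y1 ?y2; mx3simp; rewrite /=; ring: hI hl.
Qed.

Lemma twist_sq_neq (k t t1 : R) (l : C) : charQ (k * t ^+ 2) (mod2 k t t1) l = 0 ->
  Delta2 (k * t ^+ 2) (mod2 k t t1) != 0 -> t%:C ^+ 2 - 3 * l != 0.
Proof.
move=> hQ; apply: contra => /eqP g0.
have [rD rN rM rX rn] := realC_ops.
have lE : l = (t ^+ 2 / 3)%:C.
  have -> : t ^+ 2 / 3 = 3^-1 * t ^+ 2 by rewrite mulrC.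
  have l3 : 3 * l = t%:C ^+ 2 by apply/esym/eqP; rewrite -subr_eq0 g0.
  have h3 : (3 : C) != 0 by rewrite pnatr_eq0.
  have h3R : (3 : R) != 0 by rewrite pnatr_eq0.
  by apply: (mulfI h3); rewrite l3 -(rn 3%N) -rM mulrA mulfV ?mul1r ?rX.
have : 27 * (1 - k * t - t ^+ 3 / 27) ^+ 2 + 3 * t1 ^+ 2 = 0.
  have : charQ (k * t ^+ 2) (mod2 k t t1) l =
      (27 * (1 - k * t - t ^+ 3 / 27) ^+ 2 + 3 * t1 ^+ 2)%:C.
    have chR a b x : charQ a b x%:C = (x ^+ 3 + 6 * a * x + (27 + 3 * b))%:C.
      by rewrite /charQ !(rD, rM, rX, rn).
    by rewrite lE chR; congr (_%:C); rewrite /mod2; field.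
  by rewrite hQ => /esym/(congr1 (@complex.Re R)).
have ge0 m x : 0 <= m%:R * x ^+ 2 :> R by rewrite mulr_ge0 ?ler0n ?sqr_ge0.
move=> /eqP; rewrite (paddr_eq0 (ge0 _ _) (ge0 _ _)) !mulf_eq0 !pnatr_eq0 /= !orbb.
move=> /andP[/eqP h /eqP ->].
(* With tau' = 0 this makes both moduli polynomials in [t] alone, a parametrized curve on which
   [Delta2] vanishes identically. *)
have kt : k * t = 1 - t ^+ 3 / 27.
  by apply/eqP; rewrite -subr_eq0 -oppr_eq0 -[X in _ == X]h; apply/eqP; ring.
rewrite /Delta2 /mod2 (_ : k * t ^+ 2 = (k * t) * t); last by rewrite expr2 mulrA.
rewrite (_ : 18 * k * t = 18 * (k * t)); last by rewrite mulrA.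
rewrite (_ : 9 * k ^+ 2 * t ^+ 2 = 9 * (k * t) ^+ 2); last by ring.
by rewrite kt; apply/eqP; field.
Qed.

End Eigenvectors.

(** * Scalar linear equations with a prescribed square root *)

Section PhaseSolution.
Context {R : realType}.
Local Notation C := R[i].
Local Notation I := ('i%C : C).

Lemma is_derC_continuousC (J : set R) (f df : R -> C) :
  (forall s, J s -> is_derC s (1 : R) f (df s)) -> continuousC J f.
Proof.
move=> h s /h[[dr _] [di _]].
by split; apply/differentiable_continuous/derivable1_diffP.
Qed.

Lemma continuousCM (J : set R) (f g : R -> C) : continuousC J f -> continuousC J g ->
  continuousC J (fun s => f s * g s).
Proof.
move=> cf cg s Js; have [fr fi] := cf s Js; have [gr gi] := cg s Js; split.
  rewrite (_ : (fun t => complex.Re (f t * g t)) = (fun t => complex.Re (f t) * complex.Re (g t)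
    - complex.Im (f t) * complex.Im (g t))); first by apply: cvgB; apply: cvgM.
  by apply/funext => t; exact: Re_mul.
rewrite (_ : (fun t => complex.Im (f t * g t)) = (fun t => complex.Re (f t) * complex.Im (g t)
  + complex.Im (f t) * complex.Re (g t))); first by apply: cvgD; apply: cvgM.
by apply/funext => t; exact: Im_mul.
Qed.

(** The normalized function takes only the values 1 and -1; a change of sign would give its real
    part a zero by the intermediate value theorem. *)
Lemma sq_cst_continuous (J : set R) (w : R -> C) s : is_interval J -> J 0 -> J s ->
  continuousC J w -> (forall r, J r -> w r ^+ 2 = w 0 ^+ 2) -> w s = w 0.
Proof.
move=> iJ J0 Js cw w2; have [w0|w0] := eqVneq (w 0) 0.
  have := w2 s Js; rewrite w0 expr0n /= => /eqP; by rewrite sqrf_eq0 => /eqP.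
pose u r := (w 0)^-1 * w r.
have cu : continuousC J u.
  apply: continuousCM => //; split; exact: cvg_cst.
have u1 r : J r -> u r = 1 \/ u r = -1.
  move=> Jr; have /eqP : u r ^+ 2 = 1 by rewrite /u exprMn w2// exprVn mulVf// sqrf_eq0.
  by rewrite sqrf_eq1 => /orP[] /eqP; [left|right].
have u01 : u 0 = 1 by rewrite /u mulVf.
suff us : u s = 1 by rewrite -[RHS]mulr1 -us /u mulrA mulfV// mul1r.
case: (u1 s Js) => // us; exfalso.
have Re1 : complex.Re (u s) = -1 by rewrite us.
have Re0 : complex.Re (u 0) = 1 by rewrite u01.
have cR a b : J a -> J b -> {within `[a, b], continuous (fun r => complex.Re (u r))}.
  move=> Ja Jb; apply: segment_continuous => t abt.
  by have [] := cu t (iJ _ _ Ja Jb _ abt).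
have nz a b c : J a -> J b -> c \in `[a, b] -> complex.Re (u c) = 0 -> False.
  move=> Ja Jb; rewrite in_itv /= => /(iJ _ _ Ja Jb)/u1[] -> /= /eqP;
  by rewrite ?oppr_eq0 oner_eq0.
have mm : Num.min (1 : R) (-1) <= 0 <= Num.max (1 : R) (-1).
  by rewrite ge_min le_max ler01 lerN10 orbT.
have [s0|s0] := leP 0 s.
  have [|c cs c0] := IVT s0 (cR _ _ J0 Js) (v := 0); first by rewrite Re1 Re0.
  exact: nz J0 Js cs c0.
have [|c cs c0] := IVT (ltW s0) (cR _ _ Js J0) (v := 0).
  by rewrite Re1 Re0 minC maxC.
exact: nz Js J0 cs c0.
Qed.

Lemma expC_opp (z : C) : expC z * expC (- z) = 1.
Proof.
case: z => a b; rewrite /expC /= expRN cosN sinN.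
have e0 : expR a != 0 by rewrite gt_eqF// expR_gt0.
apply/eqP; rewrite eq_complex /=; apply/andP; split; apply/eqP; last by ring.
transitivity (expR a / expR a * (cos b ^+ 2 + sin b ^+ 2)); first by ring.
by rewrite cos2Dsin2 mulr1 mulfV.
Qed.

Lemma expC0 : expC (0 : C) = 1.
Proof. by rewrite /expC /= expR0 cos0 sin0 mul1r. Qed.

Lemma is_derC_expC (f : R -> C) df s : is_derC s (1 : R) f df ->
  is_derC s (1 : R) (fun r => expC (f r)) (df * expC (f s)).
Proof.
move=> [fr fi].
have hc := is_derive_chain (is_derive_cos (complex.Im (f s))) fi.
have hs := is_derive_chain (is_derive_sin (complex.Im (f s))) fi.
have he := is_derive_chain (is_derive_expR (complex.Re (f s))) fr.
have h2 : is_derC s (1 : R) (fun r => cos (complex.Im (f r)) +i* sin (complex.Im (f r)))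
   ((- sin (complex.Im (f s)) * complex.Im df) +i* (cos (complex.Im (f s)) * complex.Im df)).
  by split.
apply: is_derC_eq (is_derCM (is_derC_real he) h2) _.
clear; rewrite /expC; case: df => a b; apply/eqP; rewrite eq_complex /=.
by apply/andP; split; apply/eqP; ring.
Qed.

(** The inverse is already known to be smooth, so its derivative can be solved for from the
    derivative of the constant product with [g]. *)
Lemma is_derC_inv (J : set R) (g g' : R -> C) s : open J -> J s -> smoothC J g ->
  (forall r, J r -> g r != 0) -> is_derC s (1 : R) g (g' s) ->
  is_derC s (1 : R) (fun r => (g r)^-1) (- ((g s)^-1 * g' s * (g s)^-1)).
Proof.
move=> oJ Js sg g0 dg.
have dh := smoothC_is_derC (1 : R) (smoothC_inv oJ g0 sg) Js.
move: dh; set d := DC _ _ _ => dh.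
have E r : J r -> (g r)^-1 * g r = 1 by move=> Jr; rewrite mulVf// g0.
have D := near_is_derC (open_near_eq oJ E Js) (is_derCM dh dg).
have := DC_val D; rewrite (DC_val (is_derC_cst s (1 : R) 1)) => /esym/eqP.
rewrite addr_eq0 => /eqP h; apply: (is_derC_eq dh).
by rewrite -[LHS](mulfK (g0 s Js)) h mulNr.
Qed.

(* No smoothness of r is needed: z = f e^(-i phi) / g satisfies z' = - z g' / (2 g),
   so (z r)^2 = z^2 g is constant, and z r is constant by continuity. *)
Lemma phase_solution (J : set R) (f g g' theta phi r : R -> C) s : open J ->
  is_interval J -> J 0 -> J s ->
  (forall s, J s -> is_derC s (1 : R) f ((g' s / (2 * g s) + I * theta s) * f s)) ->
  smoothC J g -> (forall s, J s -> g s != 0) ->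
  (forall s, J s -> is_derC s (1 : R) g (g' s)) ->
  (forall s, J s -> is_derC s (1 : R) phi (theta s)) -> phi 0 = 0 ->
  continuousC J r -> (forall s, J s -> r s ^+ 2 = g s) ->
  f s * r 0 = f 0 * (r s * expC (I * phi s)).
Proof.
move=> oJ iJ J0 Js df sg g0 dg dphi phi0 cr r2.
pose E t := expC (- (I * phi t)).
pose z t := f t * E t * (g t)^-1.
have dE t : J t -> is_derC t (1 : R) E (- (I * theta t) * E t).
  move=> Jt.
  apply: is_derC_eq (is_derC_expC (is_derCN (is_derCM (is_derC_cst _ _ I) (dphi t Jt)))) _.
  by rewrite mul0r add0r.
have h2 : (2 : C) != 0 by rewrite pnatr_eq0.
have dz t : J t -> is_derC t (1 : R) z (- (g' t / (2 * g t)) * z t).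
  move=> Jt; have gt0 := g0 t Jt.
  apply: is_derC_eq (is_derCM (is_derCM (df t Jt) (dE t Jt)) (is_derC_inv oJ Jt sg g0 (dg t Jt))) _.
  by rewrite /z; field; exact: gt0.
pose q t := z t * z t * g t.
have dq t : J t -> is_derC t (1 : R) q 0.
  move=> Jt; have gt0 := g0 t Jt.
  apply: is_derC_eq (is_derCM (is_derCM (dz t Jt) (dz t Jt)) (dg t Jt)) _.
  by field; exact: gt0.
have qE t : J t -> q t = q 0.
  move=> Jt; have hr : complex.Re (q t) = complex.Re (q 0).
    by apply: (interval_cst (f := fun t => complex.Re (q t)) iJ J0 Jt) => a /dq[].
  have hi : complex.Im (q t) = complex.Im (q 0).
    by apply: (interval_cst (f := fun t => complex.Im (q t)) iJ J0 Jt) => a /dq[].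
  by apply/eqP; rewrite eq_complex hr hi !eqxx.
have sq (a b : C) : (a * b) ^+ 2 = a * a * b ^+ 2 by ring.
have w2 t : J t -> (z t * r t) ^+ 2 = (z 0 * r 0) ^+ 2.
  by move=> Jt; rewrite (sq (z t)) (sq (z 0)) !r2//; exact: qE.
have w := sq_cst_continuous iJ J0 Js (continuousCM (is_derC_continuousC dz) cr) w2.
have rn t : J t -> r t != 0 by move=> Jt; have := g0 t Jt; rewrite -r2// sqrf_eq0.
have E0 : E 0 = 1 by rewrite /E phi0 mulr0 oppr0 expC0.
have EE : E s * expC (I * phi s) = 1 by rewrite mulrC; exact: expC_opp.
(* As [g] is the square of [r], the constant function [z * r] is the quotient of [f * E] by [r], and
   comparing it with its value at 0 is the claim. *)
have zr t : J t -> z t * r t = f t * E t / r t.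
  by move=> Jt; rewrite /z -r2//; field; exact: rn.
move: w; rewrite !zr// E0 mulr1 => w.
have r0 := rn 0 J0; have rs := rn s Js.
have -> : f s * r 0 = (f s * E s / r s) * (r 0 * r s * expC (I * phi s)).
  transitivity (f s * r 0 * (E s * expC (I * phi s))); first by rewrite EE mulr1.
  by field.
by rewrite w; field.
Qed.

End PhaseSolution.

(** * Transport of the eigenvectors along the curve *)

Section ExplicitSolution.
Context {R : realType}.
Local Notation C := R[i].
Local Notation I := ('i%C : C).

(* The integrand of phi in terms of the bending and the twist. *)
Definition theta (k t : R) (l : C) : C :=
  (3 * t%:C - l ^+ 2 - 4 * k%:C * t%:C ^+ 2 + 3 * k%:C * l) / (3 * l - t%:C ^+ 2).

(* The derivative of [yk] along a solution of the Euler-Lagrange equations. *)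
Definition dyk (k t t1 : R) (l : C) : 'cV[C]_3 :=
  col3 (t1%:C * (3 - I * t1%:C) - I * t%:C * (t%:C ^+ 2 - 9 * k%:C * (1 - t%:C * k%:C)))
       (9 * k%:C * t1%:C - l * t1%:C - 3 * I * (t%:C ^+ 2 - 9 * k%:C * (1 - t%:C * k%:C)))
       (2 * I * t%:C * t1%:C).

(** The first summand of the factor is half the logarithmic derivative of the gap [t ^+ 2 - 3 * l].
    After multiplication by the gap, every coordinate is a polynomial identity modulo the
    characteristic equation. *)
Lemma yk_ode (k t t1 : R) (l : C) : charQ (k * t ^+ 2) (mod2 k t t1) l = 0 ->
  t%:C ^+ 2 - 3 * l != 0 ->
  wilczynski_mx k t *m yk k t t1 l + dyk k t t1 l =
  (2 * t%:C * t1%:C / (2 * (t%:C ^+ 2 - 3 * l)) + I * theta k t l) *: yk k t t1 l.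
Proof.
move=> hQ g0; have [rD rN rM rX rn] := realC_ops (R := R).
have hl : l ^+ 3 = - (6 * (k%:C * t%:C ^+ 2) * l + (27 + (- (54 * k%:C * t%:C) +
  27 * k%:C ^+ 2 * t%:C ^+ 2 - 2 * t%:C ^+ 3 + 3 * t1%:C ^+ 2))).
  by apply/eqP; rewrite -addr_eq0 -mod2C -rX -rM; apply/eqP; rewrite -[RHS]hQ /charQ addrA.
have [y0 y1 y2] := col3E (t%:C * (3 - I * t1%:C) - l ^+ 2 - 3 * k%:C * t%:C ^+ 2)
       (9 - 9 * k%:C * t%:C - l * t%:C - 3 * I * t1%:C) (I * (t%:C ^+ 2 - 3 * l)).
have [d0 d1 d2] := col3E
  (t1%:C * (3 - I * t1%:C) - I * t%:C * (t%:C ^+ 2 - 9 * k%:C * (1 - t%:C * k%:C)))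
  (9 * k%:C * t1%:C - l * t1%:C - 3 * I * (t%:C ^+ 2 - 9 * k%:C * (1 - t%:C * k%:C)))
  (2 * I * t%:C * t1%:C).
have hI := II (R := R).
have rho : 2 * t%:C * t1%:C / (2 * (t%:C ^+ 2 - 3 * l)) + I * theta k t l =
  (t%:C * t1%:C - I * (3 * t%:C - l ^+ 2 - 4 * k%:C * t%:C ^+ 2 + 3 * k%:C * l)) /
  (t%:C ^+ 2 - 3 * l).
  by rewrite /theta -(opprB _ (3 * l)) invrN; field; exact: g0.
rewrite rho; apply/matrixP => i j; rewrite (ord1 j) [RHS]mxE [LHS]mxE mulmx3E !mx3E.
rewrite /yk /dyk y0 y1 y2.
apply: (mulfI g0); rewrite [RHS]mulrA (mulrCA _ _ (_^-1)) mulfV// mulr1.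
move: i; apply: ord3P; rewrite ?y0 ?y1 ?y2 ?d0 ?d1 ?d2; mx3simp; rewrite /=; ring: hI hl.
Qed.

Lemma is_derC_sq (V : normedModType R) (x v : V) (f : V -> C) df :
  is_derC x v f df -> is_derC x v (fun y => f y ^+ 2) (2 * f x * df).
Proof.
by move=> h; apply: is_derC_eq (is_derCM h h) _; ring.
Qed.

Lemma is_derM_yk (k t t1 : R -> R) (dk d2t : R) l (s : R) :
  is_derive s (1 : R) k dk -> is_derive s (1 : R) t (t1 s) -> is_derive s (1 : R) t1 d2t ->
  t s * dk = - 2 * k s * t1 s -> d2t = t s ^+ 2 - 9 * k s * (1 - t s * k s) ->
  is_derM s (1 : R) (fun r => yk (k r) (t r) (t1 r) l) (dyk (k s) (t s) (t1 s) l).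
Proof.
move=> /is_derC_real hk /is_derC_real ht /is_derC_real ht1 e1 e2.
have [rD rN rM rX rn] := realC_ops (R := R).
have {}e1 : (t s)%:C * dk%:C = - 2 * (k s)%:C * (t1 s)%:C.
  by rewrite -rM e1 !(rM, rN, rn).
have {}e2 : d2t%:C = (t s)%:C ^+ 2 - 9 * (k s)%:C * (1 - (t s)%:C * (k s)%:C).
  by rewrite e2 !(rD, rN, rM, rX, rn).
have c (z : C) : is_derC s (1 : R) (fun=> z) 0 by exact: is_derC_cst.
apply: is_derM_col3.
- apply: is_derC_eq (is_derCB (is_derCB (is_derCM ht (is_derCB (c 3) (is_derCM (c I) ht1)))
    (c (l ^+ 2))) (is_derCM (is_derCM (c 3) hk) (is_derC_sq ht))) _.
  rewrite e2; transitivity ((t1 s)%:C * (3 - I * (t1 s)%:C) - I * (t s)%:C * ((t s)%:C ^+ 2 -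
    9 * (k s)%:C * (1 - (t s)%:C * (k s)%:C)) - 3 * (t s)%:C * ((t s)%:C * dk%:C +
    2 * (k s)%:C * (t1 s)%:C)); first by ring.
  by rewrite e1; ring.
- apply: is_derC_eq (is_derCB (is_derCB (is_derCB (c 9) (is_derCM (is_derCM (c 9) hk) ht))
    (is_derCM (c l) ht)) (is_derCM (c (3 * I)) ht1)) _.
  rewrite e2; transitivity (- 9 * ((t s)%:C * dk%:C) - 9 * (k s)%:C * (t1 s)%:C - l * (t1 s)%:C -
    3 * I * ((t s)%:C ^+ 2 - 9 * (k s)%:C * (1 - (t s)%:C * (k s)%:C))); first by ring.
  by rewrite e1; ring.
- apply: is_derC_eq (is_derCM (c I) (is_derCB (is_derC_sq ht) (c (3 * l)))) _.
  by ring.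
Qed.

(** For the eigenvectors in question the last entries are, up to the factor i, the gaps. Requiring
    them to be nonzero makes a multiple of the determinant an explicit product of nonzero
    factors. *)
Lemma det_eigenvectors (L V : 'M[C]_3) (l : 'I_3 -> C) :
  (forall j, L *m col j V = l j *: col j V) -> injective l ->
  (forall j, V i2 j != 0) -> \det V != 0.
Proof.
move=> LV inj V2; apply/eqP => dV.
have pow n j : L ^+ n *m col j V = l j ^+ n *: col j V.
  elim: n => [|n IH]; first by rewrite !expr0 mul1mx scale1r.
  by rewrite exprS -mulmxE -mulmxA IH -scalemxAr LV scalerA exprSr.
(* W V is a Vandermonde matrix with columns scaled by the last row of V. *)
pose W : 'M[C]_3 := \matrix_(i, j) (L ^+ i) i2 j.
have WV i j : (W *m V) i j = l j ^+ i * V i2 j.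
  have /matrixP/(_ i2 0) := pow i j; rewrite mulmx3E [RHS]mxE !mxE => <-.
  by rewrite sum3 !mxE.
have := det_mulmx W V; rewrite dV mulr0 det3 !WV.
have -> : l i0 ^+ i0 = 1 by [].
have n (i j : 'I_3) : i != j -> l i - l j != 0.
  by move=> ij; rewrite subr_eq0; apply: contra ij => /eqP/inj ->.
have n10 := n i1 i0 isT; have n20 := n i2 i0 isT; have n21 := n i2 i1 isT.
move=> E; have : (l i1 - l i0) * (l i2 - l i0) * (l i2 - l i1) * (V i2 i0 * V i2 i1 * V i2 i2) = 0.
  by rewrite -[RHS]E /=; ring.
by move/eqP; rewrite !mulf_eq0 (negPf n10) (negPf n20) (negPf n21) !(negPf (V2 _)).
Qed.

Lemma yvec_yk (k t t1 : R) l : yvec (k * t ^+ 2) t t1 l = yk k t t1 l.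
Proof.
have [rD rN rM rX rn] := realC_ops (R := R).
rewrite /yvec /yk; congr col3; rewrite -?complexiE.
- by rewrite rM rX; ring.
- have -> : 9 * (k * t ^+ 2) / t = 9 * k * t.
    (* At [t = 0] the quotient is 0 by the convention for division by 0, and the other side is 0 as
       well. *)
    have [->|t0] := eqVneq t 0; first by rewrite invr0 !mulr0.
    by field.
  by rewrite !rM rn.
Qed.

Lemma yk_last (k t t1 : R) l : yk k t t1 l i2 0 = I * (t%:C ^+ 2 - 3 * l).
Proof. by rewrite mxE. Qed.

(** If c1 = 0 the bending is 0, and otherwise [t] is nonzero and its square cancels. Both branches
    thus agree with one formula, which remains smooth at zeros of the twist. *)
Lemma phi_integrand_theta (k t : R) l : (k * t ^+ 2 = 0 -> k = 0) ->
  t%:C ^+ 2 - 3 * l != 0 -> phi_integrand (k * t ^+ 2) t l = theta k t l.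
Proof.
have [rD rN rM rX rn] := realC_ops (R := R).
move=> hk g0; rewrite /phi_integrand /theta.
have g0' : 3 * l - t%:C ^+ 2 != 0 by rewrite -opprB oppr_eq0.
case: eqP => [/hk ->|/eqP]; first by congr (_ / _); rewrite ?mulr0 ?mul0r ?subr0 ?addr0.
rewrite mulf_eq0 sqrf_eq0 negb_or => /andP[_ t0].
have tC : t%:C != 0 by rewrite eq_complex /= eqxx andbT.
by rewrite rM rX; field; rewrite g0' tC.
Qed.

Lemma eigenvalue_charQ (F : 'M[C]_3) (k t t1 : R) l : F \in unitmx ->
  eigenvalue (F *m momentum_mx k t t1 *m invmx F) l ->
  charQ (k * t ^+ 2) (mod2 k t t1) l = 0.
Proof.
move=> uF /eigenvalueP[v vE v0].
(* [eigenvalue] speaks of row vectors, so a left eigenvector [v] of the momentum is carried to the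
   frame as [v *m F]. *)
apply/eqP; rewrite -oppr_eq0 -charQ_momentum; apply/det0P; exists (v *m F).
  by apply: contra v0 => /eqP E; rewrite -(mulmxK uF v) E mul0mx.
have /(congr1 (mulmx^~ F)) := vE; rewrite /= !mulmxA mulmxKV// -scalemxAl => E.
by rewrite mulmxBr mul_mx_scalar E subrr.
Qed.

Lemma mul_mx_diag3 (A : 'M[C]_3) z i j : (A *m diag3 z) i j = A i j * z j.
Proof. by rewrite /diag3 mul_mx_diag !mxE. Qed.

Lemma invmx_diag3 (z : 'I_3 -> C) : (forall j, z j != 0) ->
  invmx (diag3 z) = diag3 (fun j => (z j)^-1).
Proof.
move=> z0; have E : diag3 z *m diag3 (fun j => (z j)^-1) = 1%:M.
  apply/matrixP => i j; rewrite mul_mx_diag3 /diag3 !mxE.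
  by case: (i =P j) => [->|_]; rewrite ?mulr1n ?mulr0n ?mul0r ?mulfV.
by rewrite -[RHS]mul1mx -(mulVmx (proj1 (mulmx1_unit E))) -mulmxA E mulmx1.
Qed.

Lemma oint0 (f : R -> R) : oint f 0 0 = 0.
Proof. by rewrite /oint lexx set_itv1 Rintegral_set1. Qed.

Lemma act_line (A : 'M[C]_3) (z : 'cV[C]_3) : act A <[z]>%VS = <[A *m z]>%VS.
Proof. by rewrite /act limg_line lfunE. Qed.

Variables (J : set R) (kappa tau : R -> R) (l : C).
Hypotheses (oJ : open J) (iJ : is_interval J) (J0 : J 0)
  (sk : smooth J kappa) (st : smooth J tau)
  (el : forall s, J s -> EL_at kappa tau s = 0)
  (hQ : charQ (kappa 0 * tau 0 ^+ 2) (mod2 (kappa 0) (tau 0) (derive1 tau 0)) l = 0)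
  (hD : Delta2 (kappa 0 * tau 0 ^+ 2) (mod2 (kappa 0) (tau 0) (derive1 tau 0)) != 0).

(** Constancy of the two moduli replaces constancy of the momentum: the polynomial Q is the same at
    every [s], so [l] remains a root. *)
Lemma charQ_curve s : J s ->
  charQ (kappa s * tau s ^+ 2) (mod2 (kappa s) (tau s) (derive1 tau s)) l = 0.
Proof.
by move=> Js; rewrite /mod2 (modulus1_cst iJ J0 sk st el Js) (modulus2_cst iJ J0 sk st el Js).
Qed.

Lemma gap_neq0 s : J s -> (tau s)%:C ^+ 2 - 3 * l != 0.
Proof.
move=> Js; apply: (twist_sq_neq (charQ_curve Js)).
by rewrite /mod2 (modulus1_cst iJ J0 sk st el Js) (modulus2_cst iJ J0 sk st el Js).
Qed.

Lemma smoothC_gap : smoothC J (fun s => (tau s)%:C ^+ 2 - 3 * l).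
Proof.
have sc := smoothC_real st.
by apply: (smoothCB oJ); [exact: (smoothCM oJ sc sc)|exact: smoothC_cst].
Qed.

Lemma is_derC_gap s : J s ->
  is_derC s (1 : R) (fun s => (tau s)%:C ^+ 2 - 3 * l) (2 * (tau s)%:C * (derive1 tau s)%:C).
Proof.
move=> Js; have h := is_derC_real (is_derive_tau st Js).
by apply: is_derC_eq (is_derCB (is_derC_sq h) (is_derC_cst _ _ (3 * l))) _; rewrite subr0.
Qed.

Lemma smoothC_theta : smoothC J (fun s => theta (kappa s) (tau s) l).
Proof.
have sc := smoothC_real st; have skc := smoothC_real sk.
have c (z : C) := @smoothC_cst R _ J z.
apply: (smoothCM oJ).
  apply: (smoothCD oJ); last by apply: (smoothCM oJ) => //; exact: (smoothCM oJ).
  apply: (smoothCB oJ).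
    by apply: (smoothCB oJ) => //; exact: (smoothCM oJ).
  by apply: (smoothCM oJ); [exact: (smoothCM oJ)|exact: (smoothCM oJ sc sc)].
apply: (smoothC_inv oJ) => [s Js|].
  by rewrite -opprB oppr_eq0 gap_neq0.
by apply: (smoothCB oJ) => //; exact: (smoothCM oJ sc sc).
Qed.

Lemma bending_eq0_at s : J s -> kappa s * tau s ^+ 2 = 0 -> kappa s = 0.
Proof.
move=> Js h; apply: (bending_eq0 oJ iJ J0 sk st el _ Js).
by rewrite -(modulus1_cst iJ J0 sk st el Js).
Qed.

(** The integrand agrees on J with [theta] along the curve. That function is smooth, which supplies
    the continuity for the fundamental theorem of calculus. *)
Lemma is_derC_phi s : J s -> is_derC s (1 : R) (phi (kappa 0 * tau 0 ^+ 2) tau l)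
  (theta (kappa s) (tau s) l).
Proof.
move=> Js; set c1 := _ * _.
have E r : J r -> theta (kappa r) (tau r) l = phi_integrand c1 (tau r) l.
  move=> Jr; rewrite /c1 -(modulus1_cst iJ J0 sk st el Jr) phi_integrand_theta//.
    exact: bending_eq0_at.
  exact: gap_neq0.
have [sr si] := eq_smoothC oJ E smoothC_theta.
rewrite E//; split; apply: (is_derive_oint oJ iJ J0 Js) => t Jt.
  exact: (smooth_continuous sr Jt).
exact: (smooth_continuous si Jt).
Qed.

(** The vector equation has a scalar coefficient, so [phase_solution] applies to each entry
    separately. *)
Lemma eigenvector_transport (F : R -> 'M[C]_3) (r : R -> C) s :
  (forall s, J s -> is_derM s (1 : R) F (F s *m wilczynski_mx (kappa s) (tau s))) ->
  continuousC J r -> (forall s, J s -> r s ^+ 2 = (tau s)%:C ^+ 2 - 3 * l) -> J s ->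
  F s *m yk (kappa s) (tau s) (derive1 tau s) l =
  (r s * expC (I * phi (kappa 0 * tau 0 ^+ 2) tau l s) / r 0) *:
    (F 0 *m yk (kappa 0) (tau 0) (derive1 tau 0) l).
Proof.
move=> dF cr r2 Js.
have r0 : r 0 != 0 by have := gap_neq0 J0; rewrite -r2// sqrf_eq0.
pose Y r := yk (kappa r) (tau r) (derive1 tau r) l.
have dFY r' : J r' -> is_derM r' (1 : R) (fun s => F s *m Y s)
    ((2 * (tau r')%:C * (derive1 tau r')%:C / (2 * ((tau r')%:C ^+ 2 - 3 * l)) +
      I * theta (kappa r') (tau r') l) *: (F r' *m Y r')).
  move=> Jr; have [e1 e2] := EL_eq0 (el Jr).
  have dY := is_derM_yk l (is_derive_kappa sk Jr) (is_derive_tau st Jr)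
    (is_derive_tau1 st Jr) e1 e2.
  have := is_derM_mul (dF r' Jr) dY.
  by rewrite -mulmxA -mulmxDr (yk_ode (charQ_curve Jr) (gap_neq0 Jr)) -scalemxAr.
have phi0 : phi (kappa 0 * tau 0 ^+ 2) tau l 0 = 0 by rewrite /phi /ointC !oint0.
apply/matrixP => i j; rewrite [RHS]mxE.
have df t (Jt : J t) : is_derC t (1 : R) (fun s => (F s *m Y s) i j)
    ((2 * (tau t)%:C * (derive1 tau t)%:C / (2 * ((tau t)%:C ^+ 2 - 3 * l)) +
      I * theta (kappa t) (tau t) l) * (F t *m Y t) i j).
  by have := dFY t Jt i j; rewrite [X in is_derC _ _ _ X]mxE.
have := phase_solution oJ iJ J0 Js df smoothC_gap gap_neq0 is_derC_gap is_derC_phi phi0 cr r2.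
move=> /(canRL (mulfK r0)) ->; rewrite /Y; ring.
Qed.

End ExplicitSolution.

Theorem theorem2 (R : realType) (J : set R)
    (gamma : R -> {vspace 'cV[R[i]]_3}) (F : R -> 'M[R[i]]_3)
    (kappa tau : R -> R) (c1 c2 : R) (lambda : 'I_3 -> R[i]) :
  open J -> is_interval J -> J 0 ->
  critical J gamma ->
  wilczynski_frame J gamma (fun _ : R => 1) kappa tau F ->
  maximal_twist J kappa tau ->
  is_modulus kappa tau c1 c2 ->
  general_modulus c1 c2 ->
  injective lambda ->
  (forall j, eigenvalue (momentum kappa tau F) (lambda j)) ->
  (forall s, J s -> \det (Vmx c1 tau lambda s) != 0 /\
     forall j, (tau s)%:C ^+ 2 - 3 * lambda j != 0) /\
  (forall r : 'I_3 -> R -> R[i],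
     (forall j, continuousC J (r j)) ->
     (forall j s, J s -> r j s ^+ 2 = (tau s)%:C ^+ 2 - 3 * lambda j) ->
     (forall s, J s -> sphereS (explicit_curve c1 tau lambda r s)) /\
     congruent J gamma (explicit_curve c1 tau lambda r)).

Proof.
move=> oJ iJ J0 crit WF _ [c1E ->] gm inj eig.
have [[_ sk st sF] [[_ lift] _] _ gF mF] := WF.
have el s : J s -> EL_at kappa tau s = 0 := critical_euler_lagrange oJ iJ crit WF.
have hD : Delta2 (kappa 0 * tau 0 ^+ 2) (mod2 (kappa 0) (tau 0) (derive1 tau 0)) != 0.
  by rewrite -c1E; move: gm; rewrite /general_modulus mulf_eq0 negb_or => /andP[].
have hQ j := eigenvalue_charQ (groupG_unit (gF 0 J0)) (eig j).
have g0 j s (Js : J s) : (tau s)%:C ^+ 2 - 3 * lambda j != 0.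
  exact: (gap_neq0 iJ J0 sk st el (hQ j) hD Js).
set V := Vmx c1 tau lambda.
have VE s i j : J s -> V s i j = yk (kappa s) (tau s) (derive1 tau s) (lambda j) i 0.
  by move=> Js; rewrite mxE c1E -(modulus1_cst iJ J0 sk st el Js) yvec_yk.
have colV s j : J s -> col j (V s) = yk (kappa s) (tau s) (derive1 tau s) (lambda j).
  by move=> Js; apply/matrixP => i k; rewrite mxE VE// (ord1 k).
have dV s : J s -> \det (V s) != 0.
  move=> Js; apply: (det_eigenvectors (L := momentum_mx (kappa s) (tau s) (derive1 tau s))
    _ inj) => j.
    by rewrite colV// momentum_yk//; exact: (charQ_curve iJ J0 sk st el (hQ j) Js).
  rewrite VE// yk_last.
  by rewrite mulf_neq0// ?g0// eq_complex /= oner_eq0 andbF.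
split=> [s Js|r cr r2]; first by split=> [|j]; [exact: dV|exact: g0].
have r0 j : r j 0 != 0 by have := g0 j 0 J0; rewrite -r2// sqrf_eq0.
pose M := V 0 *m invmx (diag3 (fun j => r j 0)).
pose D s := diag3 (fun j => r j s * expC ('i * phi c1 tau (lambda j) s)).
pose z s := M *m D s *m invmx (V s) *m col3 1 0 0.
have dF s : J s -> is_derM s (1 : R) F (F s *m wilczynski_mx (kappa s) (tau s)).
  move=> Js; have := smooth_mx_is_derM (1 : R) sF Js; congr is_derM.
  have := mF s Js; rewrite scale1r => <-.
  by rewrite entrywise_derivE mulKVmx// groupG_unit//; exact: gF.
(* Column by column this is the transport of the eigenvectors; the factors 1/r_j(0) are absorbed in
   [M]. *)
have FV s : J s -> F s *m V s = F 0 *m (M *m D s).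
  move=> Js; apply/matrixP => i j.
  have E t : J t -> (F t *m V t) i j =
      (F t *m yk (kappa t) (tau t) (derive1 tau t) (lambda j)) i 0.
    by move=> Jt; rewrite !mulmx3E !VE.
  rewrite E// (eigenvector_transport oJ iJ J0 sk st el (hQ j) hD dF (cr j) (r2 j) Js).
  rewrite mxE -E// /M /D invmx_diag3// !mulmxA !mul_mx_diag3 -c1E -complexiE.
  by ring.
have Fz s : J s -> F 0 *m z s = col 0 (F s).
  move=> Js; have uV : V s \in unitmx by rewrite unitmxE unitfE dV.
  rewrite colE; have -> : delta_mx 0 0 = col3 1 0 0 :> 'cV[R[i]]_3.
    by apply/matrixP; apply: ord3P => j; rewrite (ord1 j) !mxE.
  by rewrite /z (mulmxA (F 0) _ (col3 1 0 0)) (mulmxA (F 0) (M *m D s)) -FV// mulmxK.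
split.
  (* Membership in the sphere is pulled back from the first column of [F s] by the isometry
     [F 0]. *)
  move=> s Js; exists (z s); have [n0 h0] := groupG_col0 (gF s Js).
  split=> //.
    by apply: contra n0 => /eqP E; rewrite -Fz// E mulmx0.
  by rewrite -(herm_mul (A := F 0)) ?Fz//; case: (gF 0 J0).
(* The congruence is the frame at the origin, since [F 0] maps the explicit vector to the first
   column of [F s]. *)
exists (F 0); first exact: gF.
move=> s Js; have [_ _ ->] := lift s Js.
rewrite invr1 scale1r -Fz//; symmetry; exact: act_line.
Qed.
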